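(* Assume (A1) $\mathbb{E}[|X(1)|]<\infty$; (A2) $X$ is not a driftless compound Poisson process; (A3) if $X$ has paths of unbounded variation, then for every $a>0$ the mapping $x\mapsto\mathbb{E}_x[e^{-q\kappa_0^{a,-}(r)};\kappa_0^{a,-}(r)<\infty]$ has an a.e.-continuous Radon–Nikodym density bounded on every compact subset of $(0,\infty)$. Let $a^*:=\inf\{a\ge0:\beta\,\mathbb{E}_a[e^{-q\kappa_0^{a,-}(r)}]\le1\}$. Then the periodic-classical barrier strategy at $a^*$ (dividends at level $a^*$ at Poisson times, classical capital injection at $0$) is optimal: $v(x)=v_{a^*}(x)$ for all $x\ge0$.
   Context: $X$ is a real-valued Lévy process, $\mathbb{P}_x$ ($\mathbb{E}_x$) its law started at $x$; $N_r$ is an independent Poisson process of rate $r>0$ with arrival times $0<T_1<T_2<\cdots$, $T_0:=0$; $\mathbb{F}$ is the filtration generated by $X$ and $N_r$; $q>0$, $\beta>1$. A strategy $\pi=(L^\pi,R^\pi)$ is admissible if $L^\pi(t)=\int_{[0,t]}\varrho^\pi(s)dN_r(s)$ for an $\mathbb{F}$-adapted càglàd $\varrho^\pi$, $R^\pi$ is non-decreasing, right-continuous, $\mathbb{F}$-adapted with $R^\pi(0-)=0$ and $\mathbb{E}_x[\int_{[0,\infty)}e^{-qt}dR^\pi(t)]<\infty$ for $x\ge0$, and $X(t)-L^\pi(t)+R^\pi(t)\ge0$ for all $t\ge0$ a.s. $v_\pi(x):=\mathbb{E}_x[\int_{[0,\infty)}e^{-qt}dL^\pi(t)-\beta\int_{[0,\infty)}e^{-qt}dR^\pi(t)]$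 and $v(x):=\sup_{\pi\text{ admissible}}v_\pi(x)$, $x\ge0$. $U_r^a$ (periodic reflection above at $a$): starts at $X(0)$, $U_r^a(t)=U_r^a(T_k)+X(t)-X(T_k)$ on $[T_k,T_{k+1})$, $U_r^a(T_{k+1})=\min\{U_r^a(T_{k+1}-),a\}$; $\kappa_0^{a,-}(r):=\inf\{t\ge0:U_r^a(t)<0\}$. Periodic-classical barrier strategy at $a\ge0$, controlled process $U_r^{0,a}=X-L_r^{0,a}+R_r^{0,a}$ started at $x\ge0$: $L_r^{0,a}(0)=0$, constant on each $[T_k,T_{k+1})$; on $[T_k,T_{k+1})$, with $Y(t):=U_r^{0,a}(T_k)+X(t)-X(T_k)$ ($U_r^{0,a}(T_0):=x$), $R_r^{0,a}(t)=R_r^{0,a}(T_k)+\max\{0,\sup_{s\in[T_k,t]}(-Y(s))\}$ ($R_r^{0,a}(T_0):=0$), $U_r^{0,a}(t)=Y(t)+R_r^{0,a}(t)-R_r^{0,a}(T_k)$; at $T_{k+1}$, $L_r^{0,a}$ jumps by $(U_r^{0,a}(T_{k+1}-)-a)^+$ and $U_r^{0,a}(T_{k+1})=\min\{U_r^{0,a}(T_{k+1}-),a\}$. $v_a$ denotes $v_\pi$ for this strategy.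
   Formalization: Admissible strategies are also required to have nonnegative dividend rate ϱ (L non-decreasing); with signed ϱ the claim fails, e.g. for X(t) = −t at x = 0, where a negative dividend acts as a capital injection at unit cost below β. *)

(* Defs.v *)
From HB Require Import structures.
From mathcomp Require Import all_boot all_order all_algebra.
From mathcomp Require Import all_classical all_reals all_analysis.
Set Implicit Arguments. Unset Strict Implicit. Unset Printing Implicit Defensive.
Import Order.TTheory GRing.Theory Num.Theory.
Import numFieldNormedType.Exports.
Local Open Scope classical_set_scope.
Local Open Scope ring_scope.

Section Pathwise.
Context {R : realType}.

Definition left_lim (f : R -> R) (t : R) : R := lim (f @ t^'-).

Definition cadlag (f : R -> R) : Prop :=
  (forall t, 0 <= t -> f @ t^'+ --> f t) /\
  (forall t, 0 < t -> exists l : R, f @ t^'- --> l).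

Definition caglad (f : R -> R) : Prop :=
  (forall t, 0 < t -> f @ t^'- --> f t) /\
  (forall t, 0 <= t -> exists l : R, f @ t^'+ --> l).

(* Lebesgue--Stieltjes integral  \int_{[0,oo)} e^{-qt} dF(t)  for a
   non-decreasing right-continuous F (F is extended by F(t) = 0 for t < 0
   by the caller, so that the atom at 0 is F(0) - F(0-) = F(0));
   set to 0 when F is not non-decreasing right-continuous. *)
Definition stieltjes_exp (q : R) (F : R -> R) : \bar R :=
  match pselect ({homo F : x y / x <= y} /\ right_continuous F) with
  | left H =>
    let G : cumulative R R :=
      HB.pack_for (cumulative R R) F
        (isCumulative.Build R _ R F (proj1 H) (proj2 H)) in
    (\int[lebesgue_stieltjes_measure G]_(t in (`[0%R, +oo[%classic : set R))
        (expR (- q * t))%:E)%E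
  | right _ => 0%E
  end.

Definition arrival (Ev : nat -> R) (k : nat) : R := \sum_(i < k) Ev i.

(* --- periodic reflection from above at a (process U_r^a started at x) --- *)
Fixpoint prefl (a x : R) (f : R -> R) (T : nat -> R) (k : nat) : R :=
  match k with
  | 0 => x
  | k'.+1 => Num.min (prefl a x f T k' + left_lim f (T k'.+1) - f (T k')) a
  end.

(* kappa_0^{a,-}(r) = inf {t >= 0 : U_r^a(t) < 0}  (inf of the empty set = +oo);
   on [T_k, T_(k+1)), U_r^a(t) = U_r^a(T_k) + X(t) - X(T_k). *)
Definition kappa_refl (a x : R) (f : R -> R) (T : nat -> R) : \bar R :=
  ereal_inf [set t%:E | t in [set t : R | exists k,
     T k <= t < T k.+1 /\ prefl a x f T k + f t - f (T k) < 0]].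

(* --- periodic-classical barrier strategy at a, started at x ---
   state k = (U(T_k), R(T_k)) *)
Definition pcb_ml (u : R) (f : R -> R) (T : nat -> R) (k : nat) : R :=
  Num.max 0 (sup [set - (u + f s - f (T k)) | s in [set s | T k <= s < T k.+1]]).

Definition pcb_um (u : R) (f : R -> R) (T : nat -> R) (k : nat) : R :=
  u + left_lim f (T k.+1) - f (T k) + pcb_ml u f T k.

Fixpoint pcb_state (a x : R) (f : R -> R) (T : nat -> R) (k : nat) : R * R :=
  match k with
  | 0 => (x, 0)
  | k'.+1 =>
    let st := pcb_state a x f T k' in
    (Num.min (pcb_um st.1 f T k') a, st.2 + pcb_ml st.1 f T k')
  end.

(* dividend paid at T_(k+1): (U(T_(k+1)-) - a)^+ *)
Definition pcb_div (a x : R) (f : R -> R) (T : nat -> R) (k : nat) : R :=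
  Num.max 0 (pcb_um (pcb_state a x f T k).1 f T k - a).

(* cumulative capital injection R_r^{0,a}(t)  (0 for t < 0) *)
Definition pcb_inj (a x : R) (f : R -> R) (T : nat -> R) (t : R) : R :=
  match pselect (exists k, T k <= t < T k.+1) with
  | left H =>
    let k := xget 0%N [set k | T k <= t < T k.+1] in
    let st := pcb_state a x f T k in
    st.2 + Num.max 0 (sup [set - (st.1 + f s - f (T k)) | s in [set s | T k <= s <= t]])
  | right _ => 0
  end.

End Pathwise.

Section Prob.
Context {R : realType} {d : measure_display} {Omega : measurableType d}.
Variable P : probability Omega R.

Definition gen_rv (Y : Omega -> R) : set (set Omega) :=
  [set A | exists2 B : set R, measurable B & A = Y @^-1` B].

Definition mutually_indep (n : nat) (Y : nat -> Omega -> R) : Prop :=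
  forall B : nat -> set R, (forall i, measurable (B i)) ->
    fine (P (\bigcap_(i < n) (Y i @^-1` B i))) =
    \prod_(i < n) fine (P (Y i @^-1` B i)).

Definition indep_sigma (G1 G2 : set (set Omega)) : Prop :=
  forall A B, <<s G1 >> A -> <<s G2 >> B -> P (A `&` B) = (P A * P B)%E.

Definition levy_process (X : R -> Omega -> R) : Prop :=
  [/\ (forall t, 0 <= t -> measurable_fun setT (X t)),
      (forall w, X 0 w = 0),
      (forall w, cadlag (X ^~ w)),
      (forall s t, 0 <= s <= t -> forall B : set R, measurable B ->
         P ((fun w => X t w - X s w) @^-1` B) = P (X (t - s) @^-1` B)) &
      (forall n (tt : nat -> R), 0 <= tt 0%N -> (forall i, tt i <= tt i.+1) ->
         mutually_indep n (fun i w => X (tt i.+1) w - X (tt i) w))].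

Definition poisson_interarrivals (r : R) (E : nat -> Omega -> R) : Prop :=
  [/\ (forall k, measurable_fun setT (E k)),
      (forall k w, 0 < E k w),
      (forall k (B : set R), measurable B -> P (E k @^-1` B) = exponential_prob r B) &
      (forall n, mutually_indep n E)].

Definition T_of (E : nat -> Omega -> R) (k : nat) (w : Omega) : R :=
  arrival (fun i => E i w) k.

Definition gen_X (X : R -> Omega -> R) : set (set Omega) :=
  [set A | exists2 t, 0 <= t & gen_rv (X t) A].
Definition gen_N (E : nat -> Omega -> R) : set (set Omega) :=
  [set A | exists k, exists2 s, 0 <= s & A = [set w | T_of E k w <= s]].

(* generators of F_t = sigma(X(s), N_r(s) ; s <= t); note {N_r(s) >= k} = {T_k <= s} *)
Definition gen_F (X : R -> Omega -> R) (E : nat -> Omega -> R) (t : R) : set (set Omega) :=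
  [set A | (exists s, 0 <= s <= t /\ gen_rv (X s) A) \/
           (exists k, exists s, 0 <= s <= t /\ A = [set w | T_of E k w <= s])].

Definition adapted (X : R -> Omega -> R) (E : nat -> Omega -> R) (Y : R -> Omega -> R) : Prop :=
  forall t, 0 <= t -> forall B : set R, measurable B -> <<s gen_F X E t >> (Y t @^-1` B).

(* L(t) = \int_{[0,t]} rho(s) dN_r(s) = \sum_{k >= 1, T_k <= t} rho(T_k) *)
Definition Ldiv (E : nat -> Omega -> R) (rho : R -> Omega -> R) (t : R) (w : Omega) : \bar R :=
  (\sum_(0 <= k <oo | (T_of E k.+1 w <= t)%R) (rho (T_of E k.+1 w) w)%:E)%E.

(* E_x[\int e^{-qt} dL(t) ] - beta E_x[\int e^{-qt} dR(t)], where D k is the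
   dividend paid at T_(k+1) and Rinj the cumulative injection *)
Definition payoff (q beta : R) (E : nat -> Omega -> R) (D : nat -> Omega -> R)
    (Rinj : R -> Omega -> R) : \bar R :=
  ((\int[P]_w (\sum_(0 <= k <oo) (expR (- q * T_of E k.+1 w) * D k w)%:E))
   - beta%:E * (\int[P]_w stieltjes_exp q (Rinj ^~ w)))%E.

Definition admissible (q : R) (X : R -> Omega -> R) (E : nat -> Omega -> R) (x : R)
    (rho Rinj : R -> Omega -> R) : Prop :=
  [/\ adapted X E rho /\ (forall w, caglad (rho ^~ w)) /\
        (forall t w, 0 <= t -> 0 <= rho t w),
      adapted X E Rinj,
      (forall w, {homo Rinj ^~ w : s t / s <= t}) /\
        (forall w, right_continuous (Rinj ^~ w)) /\ (forall t w, t < 0 -> Rinj t w = 0),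
      (\int[P]_w stieltjes_exp q (Rinj ^~ w) < +oo)%E &
      {ae P, forall w, forall t, 0 <= t ->
          (0 <= (x + X t w + Rinj t w)%:E - Ldiv E rho t w)%E}].

Definition value (q beta : R) (X : R -> Omega -> R) (E : nat -> Omega -> R) (x : R) : \bar R :=
  ereal_sup [set v | exists rho Rinj, admissible q X E x rho Rinj /\
                      v = payoff q beta E (fun k w => rho (T_of E k.+1 w) w) Rinj].

Definition barrier_value (q beta : R) (X : R -> Omega -> R) (E : nat -> Omega -> R)
    (a x : R) : \bar R :=
  payoff q beta E (fun k w => pcb_div a x (X ^~ w) (T_of E ^~ w) k)
                  (fun t w => pcb_inj a x (X ^~ w) (T_of E ^~ w) t).

Definition ruin_lt (q : R) (X : R -> Omega -> R) (E : nat -> Omega -> R) (a x : R) : R :=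
  fine (\int[P]_w (match kappa_refl a x (X ^~ w) (T_of E ^~ w) with
                   | EFin t => (expR (- q * t))%:E
                   | _ => 0%E end)).

Definition astar (q beta : R) (X : R -> Omega -> R) (E : nat -> Omega -> R) : R :=
  inf [set a : R | 0 <= a /\ beta * ruin_lt q X E a a <= 1].

(* X is a driftless compound Poisson process: a.s. its paths are step
   functions (finitely many jumps on compacts, constant in between) *)
Definition driftless_CP (X : R -> Omega -> R) : Prop :=
  {ae P, forall w, forall t, 0 < t -> exists (m : nat) (s : nat -> R),
      [/\ s 0%N = 0, s m = t, (forall i, (i < m)%N -> s i < s i.+1) &
          (forall i, (i < m)%N -> forall u, s i <= u < s i.+1 -> X u w = X (s i) w)]}.

Definition bv_paths (X : R -> Omega -> R) : Prop :=
  {ae P, forall w, forall t, 0 < t -> bounded_variation 0 t (X ^~ w)}.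

End Prob.

Definition good_density {R : realType} (g : R -> R) : Prop :=
  exists dens : R -> R,
    [/\ (forall x y, 0 < x -> x <= y ->
           (lebesgue_measure : set R -> \bar R).-integrable `[x, y] (EFin \o dens) /\
           ((g y - g x)%:E = \int[lebesgue_measure]_(z in `[x, y]) (dens z)%:E)%E),
        {ae (lebesgue_measure : set R -> \bar R), forall z, 0 < z -> {for z, continuous dens}} &
        (forall K : set R, compact K -> K `<=` `]0, +oo[ ->
           exists M : R, forall z, K z -> `|dens z| <= M)].

(* Main.v *)
Require Import Defs.
From HB Require Import structures.
From mathcomp Require Import all_boot all_order all_algebra.
From mathcomp Require Import all_classical all_reals all_analysis measurable_realfun.
From mathcomp Require Import lra.
Import Order.TTheory GRing.Theory Num.Theory.
Import numFieldNormedType.Exports.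
Local Open Scope classical_set_scope.
Local Open Scope ring_scope.
Set Implicit Arguments. Unset Strict Implicit. Unset Printing Implicit Defensive.

(** The proof is a pathwise concave duality. Fix the barrier [a], a level
[b <= a] and a time [s], and let [hit b k s] say that before [s] the path falls
by more than [b] below its value at some dividend date [T_j], [j >= k]. Weighting
the dividend paid at [T_k] with the indicator of [hit b k s], the quantity
(weighted dividends) - (injections up to [s]) of any admissible strategy exceeds
that of the barrier strategy by at most [a - b] ([duality]).

Discounting amounts to evaluating at an independent exponential time, so one
integrates over [s]. By the strong Markov property at the dividend dates the
weight of the k-th dividend becomes [e^{-q T_k}] times the constant
[c_b = E_b[e^{-q kappa_0^{b,-}}]], hence with [A], [B] the expected discounted
dividends and injections, and [A'], [B'] those of the barrier strategy,
[c_b A - B <= c_b A' - B' + (a - b)]. Right-continuity of [b |-> c_b] gives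
[beta c_a <= 1] at [a = a*], while [beta c_b >= 1] for [b < a*]; using the first
bound when [A <= A'] and the second, with [b] increasing to [a*], when [A >= A']
yields [A - beta B <= A' - beta B'].

If [B'] is infinite there is no admissible strategy and both sides are [-oo];
otherwise the barrier strategies stopped after [n] payments are admissible and
their payoffs increase to that of the barrier strategy. *)

(** * Path spaces and independence *)

(** The weight is a multiplier found in hindsight: keeping a unit back at a date saves an injection
    when the process restarted from the barrier at that date is later ruined. At a fixed horizon the
    weights are 1 up to the last date from which the path falls by more than [b] and 0 afterwards.
    The solvency constraint at one well-chosen time then bounds every strategy, and the barrier
    strategy makes it tight up to [a - b]. A level strictly below a* is used because [b |-> c_b] is
    only known to be right-continuous: it may jump across [1/beta] at a*, in which case no level
    solves [beta c_b = 1]. Two obstacles shape the rest. The weight looks into the future of [T_k]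
    while the dividend is adapted and caglad, so factorising their product needs a strong Markov
    property for path and clock jointly; it comes from reading the dividend at a grid point before
    [T_k] and the path from a grid point after it. And the barrier strategy is described block by
    block, without any measurability, so it is identified with iterated Skorokhod reflections path
    by path, off a null set. *)

Section path_space.
Context {R : realType} {I : Type}.

Definition coord_sets : set (set (I -> R)) :=
  [set A | exists i, exists2 B : set R, measurable B & A = (fun f => f i) @^-1` B].

Definition pathT := g_sigma_algebraType coord_sets.

Lemma measurable_coord i : measurable_fun setT (fun f : pathT => f i).
Proof.
move=> _ B mB; rewrite setTI; apply: sub_sigma_algebra.
by exists i; exists B.
Qed.

Lemma measurable_path d (T : measurableType d) (F : T -> pathT) :
  (forall i, measurable_fun setT (fun w => F w i)) -> measurable_fun setT F.
Proof.
move=> mF; apply: (measurability _ (erefl : @measurable _ pathT = <<s coord_sets >>)).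
move=> _ [_ [i [B mB ->]] <-]; have := mF i measurableT B mB.
by rewrite setTI.
Qed.

Definition cylinder (n : nat) (c : nat -> I) (B : nat -> set R) : set (I -> R) :=
  [set f | forall i, (i < n)%N -> B i (f (c i))].

Definition cylinders (G : set (set R)) : set (set (I -> R)) :=
  [set A | exists n c B, (forall i, G (B i)) /\ A = cylinder n c B].

Lemma measurable_cylinder n c B :
  (forall i, (i < n)%N -> measurable (B i)) -> measurable (cylinder n c B : set pathT).
Proof.
move=> mB; rewrite (_ : cylinder n c B =
    \bigcap_(i in `I_n) (setT `&` (fun f : pathT => f (c i)) @^-1` B i)).
  apply: bigcap_measurableType => i /= ni.
  by apply: measurable_coord => //; exact: mB.
by apply/seteqP; split => f /= h i /= ni; [split => //; exact: h|case: (h i ni)].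
Qed.

(** The coordinates of a cylinder may repeat, so an intersection is obtained by concatenating the
    two lists of constraints, whatever [G] is. *)
Lemma cylinders_setI G : setI_closed (cylinders G).
Proof.
move=> _ _ [n [c [B [GB ->]]]] [m [c' [B' [GB' ->]]]].
exists (n + m)%N, (fun i => if (i < n)%N then c i else c' (i - n)%N),
  (fun i => if (i < n)%N then B i else B' (i - n)%N); split.
  by move=> i; case: ifP.
apply/seteqP; split => f /=.
  move=> [h1 h2] i inm; case: ifPn => [/h1//|]; rewrite -leqNgt => ni.
  by apply: h2; rewrite ltn_subLR.
move=> h; split => i ni.
  by have := h i; rewrite ni; apply; exact: ltn_addr.
have := h (n + i)%N; rewrite ltn_add2l (_ : (n + i < n)%N = false) ?addKn; first exact.
by rewrite ltnNge leq_addr.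
Qed.

(** Two choices of [G] occur: all Borel sets for path segments, and closed half-lines when
    indicators of cylinders must be limits of continuous functions. *)
Lemma cylinders_gen G : measurable = <<s G >> ->
  @measurable _ pathT = <<s cylinders G >>.
Proof.
move=> mG; apply/seteqP; split.
  apply: smallest_sub; first exact: smallest_sigma_algebra.
  move=> _ [i [B mB ->]].
  pose H := [set B : set R | <<s cylinders G >> ((fun f : I -> R => f i) @^-1` B)].
  suff : measurable `<=` H by exact.
  rewrite mG; apply: smallest_sub.
    have [s0 sC sU] : sigma_algebra setT <<s cylinders G >> by exact: smallest_sigma_algebra.
    split.
    - by rewrite /H /= preimage_set0.
    - by move=> A HA; rewrite /H /= setTD preimage_setC -setTD; exact: sC.
    - by move=> F HF; rewrite /H /= preimage_bigcup; exact: sU.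
  move=> A GA; apply: sub_sigma_algebra; exists 1%N, (fun=> i), (fun=> A); split => //.
  by apply/seteqP; split => f /= => [? []//|h]; exact: (h 0%N).
apply: smallest_sub; first exact: sigma_algebra_measurable.
move=> _ [n [c [B [GB ->]]]]; apply: measurable_cylinder => i _.
by rewrite mG; exact: sub_sigma_algebra.
Qed.

Lemma cylinders_setT G : G !=set0 -> (inhabited I) -> cylinders G setT.
Proof.
move=> [A GA] [i]; exists 0%N, (fun=> i), (fun=> A); split => //.
by apply/seteqP; split.
Qed.

End path_space.
Arguments pathT R I : clear implicits.

(** Carries the measurability proof of [f], so that the pushforward comes with its measure
    structure. *)
Definition push_measure d1 d2 (T1 : measurableType d1) (T2 : measurableType d2)
    (R : realType) (m : {measure set T1 -> \bar R}) (f : T1 -> T2)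
    (mf : measurable_fun setT f) : {measure set T2 -> \bar R}.
Proof. by refine (pushforward m f). Defined.

Section independence.
Context {R : realType} {d : measure_display} {Omega : measurableType d}.
Variable P : probability Omega R.

Definition indep_maps d1 (T1 : measurableType d1) d2 (T2 : measurableType d2)
    (Y1 : Omega -> T1) (Y2 : Omega -> T2) :=
  forall A B, measurable A -> measurable B ->
    P (Y1 @^-1` A `&` Y2 @^-1` B) = (P (Y1 @^-1` A) * P (Y2 @^-1` B))%E.

Let mscalep (a : \bar R) (a0 : (0 <= a)%E) (afin : a \is a fin_num) :
  exists p : {nonneg R}, p%:num%:E = a.
Proof.
have a1 : (0 <= fine a)%R by rewrite fine_ge0.
by exists (NngNum a1); rewrite /= fineK.
Qed.

Lemma pi_eq_measures d1 (T1 : measurableType d1) (G : set (set T1))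
    (m1 m2 : {measure set T1 -> \bar R}) :
  measurable = <<s G >> -> setI_closed G -> G setT -> (m1 setT < +oo)%E ->
  (forall A, G A -> m1 A = m2 A) -> forall A, measurable A -> m1 A = m2 A.
Proof.
move=> mG GI GT m1oo m12 A mA.
apply: (measure_unique G (fun=> setT)) => //.
by rewrite bigcup_const.
Qed.

Lemma indep_maps_pi1 d1 (T1 : measurableType d1) (Y1 : Omega -> T1)
    (G : set (set T1)) (B : set Omega) :
  measurable_fun setT Y1 -> measurable B ->
  measurable = <<s G >> -> setI_closed G ->
  (forall A, G A -> P (Y1 @^-1` A `&` B) = (P (Y1 @^-1` A) * P B)%E) ->
  forall A, measurable A -> P (Y1 @^-1` A `&` B) = (P (Y1 @^-1` A) * P B)%E.
Proof.
move=> mY1 mB mG GI GE A mA.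
have [p pE] := mscalep (measure_ge0 P B) (fin_num_measure P B mB).
(* Uniqueness of finite measures wants the whole space in the pi-system, and a generator such as the
   half-lines does not contain it. *)
pose G' := G `|` [set setT].
have mpre C : measurable C -> measurable (Y1 @^-1` C).
  by move=> mC; rewrite -[X in measurable X]setTI; exact: mY1.
pose m1 : {measure set T1 -> \bar R} := push_measure (mrestr P mB) mY1.
pose m2 : {measure set T1 -> \bar R} := mscale p (push_measure P mY1).
suff : m1 A = m2 A.
  by rewrite /m1 /m2 /= /mscale /= /pushforward /mrestr pE muleC.
apply: (@pi_eq_measures _ _ G') => //.
- rewrite mG /G'; apply/seteqP; split.
    by apply: sub_smallest2r; [exact: smallest_sigma_algebra|move=> C GC; left].
  apply: smallest_sub; first exact: smallest_sigma_algebra.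
  move=> C [GC|->]; first exact: sub_sigma_algebra.
  have [s0 sC _] : sigma_algebra setT <<s G >> by exact: smallest_sigma_algebra.
  by have := sC _ s0; rewrite setD0.
- move=> C D [GC|->] [GD|->]; rewrite ?setIT ?setTI; rewrite /G' /=; auto.
- by right.
- rewrite /m1 /= /pushforward /mrestr preimage_setT setTI.
  by rewrite ltey_eq fin_num_measure.
- move=> C [GC|->]; rewrite /m1 /m2 /= /mscale /= /pushforward /mrestr /= pE muleC.
    exact: GE.
  by rewrite preimage_setT setTI probability_setT mul1e.
Qed.

Lemma indep_maps_pi d1 (T1 : measurableType d1) d2 (T2 : measurableType d2)
    (Y1 : Omega -> T1) (Y2 : Omega -> T2) (G1 : set (set T1)) (G2 : set (set T2)) :
  measurable_fun setT Y1 -> measurable_fun setT Y2 ->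
  measurable = <<s G1 >> -> setI_closed G1 ->
  measurable = <<s G2 >> -> setI_closed G2 ->
  (forall A B, G1 A -> G2 B ->
     P (Y1 @^-1` A `&` Y2 @^-1` B) = (P (Y1 @^-1` A) * P (Y2 @^-1` B))%E) ->
  indep_maps Y1 Y2.
Proof.
move=> mY1 mY2 mG1 G1I mG2 G2I GE A B mA mB.
have pre2 C : measurable C -> measurable (Y2 @^-1` C).
  by move=> mC; rewrite -[X in measurable X]setTI; exact: mY2.
have pre1 C : measurable C -> measurable (Y1 @^-1` C).
  by move=> mC; rewrite -[X in measurable X]setTI; exact: mY1.
apply: (indep_maps_pi1 mY1 (pre2 _ mB) mG1 G1I) => // {mA}A GA.
have mA : measurable A by rewrite mG1; exact: sub_sigma_algebra.
rewrite setIC muleC.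
apply: (indep_maps_pi1 mY2 (pre1 _ mA) mG2 G2I) => // {mB}B GB.
by rewrite setIC muleC; exact: GE.
Qed.

(** Independence makes the joint law of the two maps a product measure, and Tonelli factors the
    integral. The target spaces are arbitrary, so that [Y1] can later be the identity towards
    [Omega] with a smaller sigma-algebra. *)
Lemma indep_integral d1 (T1 : measurableType d1) d2 (T2 : measurableType d2)
    (Y1 : Omega -> T1) (Y2 : Omega -> T2) (f : T1 -> \bar R) (g : T2 -> \bar R) :
  measurable_fun setT Y1 -> measurable_fun setT Y2 -> indep_maps Y1 Y2 ->
  measurable_fun setT f -> measurable_fun setT g ->
  (forall y, (0 <= f y)%E) -> (forall y, (0 <= g y)%E) ->
  (\int[P]_w (f (Y1 w) * g (Y2 w)) =
   (\int[P]_w f (Y1 w)) * (\int[P]_w g (Y2 w)))%E.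
Proof.
move=> mY1 mY2 ind mf mg f0 g0.
have mY12 : measurable_fun setT (fun w => (Y1 w, Y2 w)).
  exact: measurable_fun_pair.
pose Y1m : {mfun Omega >-> T1} := HB.pack Y1 (isMeasurableFun.Build _ _ _ _ _ mY1).
pose Y2m : {mfun Omega >-> T2} := HB.pack Y2 (isMeasurableFun.Build _ _ _ _ _ mY2).
pose P1 : probability T1 R := distribution P Y1m.
pose P2 : probability T2 R := distribution P Y2m.
pose P12 : {measure set (T1 * T2) -> \bar R} := push_measure P mY12.
have P12E A : measurable A -> (P1 \x P2)%E A = P12 A.
  by move=> mA; apply: product_measure_unique => // B C mB mC; exact: ind.
pose h (z : T1 * T2) := (f z.1 * g z.2)%E.
have mh : measurable_fun setT h.
  apply: emeasurable_funM; apply: measurableT_comp => //.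
have h0 z : (0 <= h z)%E by rewrite mule_ge0.
transitivity (\int[P12]_z h z)%E.
  by rewrite ge0_integral_pushforward//.
transitivity (\int[(P1 \x P2)%E]_z h z)%E.
  by apply: eq_measure_integral => A mA _; apply/esym; exact: P12E.
rewrite fubini_tonelli1//=.
transitivity (\int[P1]_x (f x * \int[P2]_y g y))%E.
  by apply: eq_integral => x _; rewrite /fubini_F /h /= ge0_integralZl.
rewrite ge0_integralZr//; last exact: integral_ge0.
by rewrite !ge0_integral_pushforward.
Qed.

End independence.

Section independent_sequences.
Context {R : realType} {d : measure_display} {Omega : measurableType d}.
Variable P : probability Omega R.
Local Notation seqT := (pathT R nat).

Lemma preim_measurable d1 (T1 : measurableType d1) d2 (T2 : measurableType d2)
    (f : T1 -> T2) (B : set T2) :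
  measurable_fun setT f -> measurable B -> measurable (f @^-1` B).
Proof. by move=> mf mB; rewrite -[X in measurable X]setTI; exact: mf. Qed.

(** Constraints on the first [n] coordinates in order: the shape of event whose probability
    [mutually_indep] provides. *)
Definition boxes : set (set (nat -> R)) :=
  [set A | exists n (B : nat -> set R), (forall i, measurable (B i)) /\
     A = cylinder n id B].

Lemma boxes_setI : setI_closed boxes.
Proof.
move=> _ _ [n [B [mB ->]]] [m [B' [mB' ->]]].
exists (maxn n m), (fun i => (if (i < n)%N then B i else setT) `&`
   (if (i < m)%N then B' i else setT)); split.
  by move=> i; apply: measurableI; case: ifP.
apply/seteqP; split => f /=.
  move=> [h1 h2] i _; split; case: ifPn => //; [exact: h1|exact: h2].
by move=> h; split => i ni; have := h i; rewrite leq_max ni ?orbT => /(_ erefl)[].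
Qed.

Lemma boxes_gen : @measurable _ seqT = <<s boxes >>.
Proof.
apply/seteqP; split; last first.
  apply: smallest_sub; first exact: sigma_algebra_measurable.
  by move=> _ [n [B [mB ->]]]; exact: measurable_cylinder.
apply: sub_smallest2r; first exact: smallest_sigma_algebra.
move=> _ [i [B mB ->]].
exists i.+1, (fun j => if j == i then B else setT); split.
  by move=> j; case: ifP.
apply/seteqP; split => f /=.
  by move=> Bf j _; case: eqP => [->|].
by move=> /(_ i (ltnSn i)); rewrite eqxx.
Qed.

Lemma boxesT : boxes setT.
Proof. by exists 0%N, (fun=> setT); split => //; apply/seteqP; split. Qed.

Variable Y : nat -> Omega -> R.
Hypothesis mY : forall i, measurable_fun setT (Y i).
Hypothesis iY : forall n, mutually_indep P n Y.

Lemma mutually_indepE n (B : nat -> set R) : (forall i, measurable (B i)) ->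
  P [set w | forall i, (i < n)%N -> B i (Y i w)] =
  (\prod_(i < n) fine (P (Y i @^-1` B i)))%:E.
Proof.
move=> mB; rewrite -iY// fineK; last first.
  apply: fin_num_measure; apply: bigcap_measurableType => i _.
  exact: preim_measurable.
by congr (P _).
Qed.

Lemma mutually_indep_shift p : forall n, mutually_indep P n (fun i => Y (p + i)%N).
Proof.
move=> n B mB; pose B' i := if (i < p)%N then setT else B (i - p)%N.
have mB' i : measurable (B' i) by rewrite /B'; case: ifP.
rewrite (_ : \bigcap_(i < n) _ = [set w | forall i, (i < p + n)%N -> B' i (Y i w)]).
  rewrite mutually_indepE//= big_split_ord/= big1 ?mul1r.
    apply: eq_bigr => i _; rewrite /B' /= (_ : (p + i < p)%N = false) ?addKn//.
    by rewrite ltnNge leq_addr.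
  by move=> i _; rewrite /B' /= ltn_ord preimage_setT probability_setT.
apply/seteqP; split => w /= h i.
  move=> ipn; rewrite /B'; case: ifPn => //; rewrite -leqNgt => pi.
  by have := h (i - p)%N; rewrite subnKC//; apply; rewrite /= ltn_subLR.
move=> /= ni; have := h (p + i)%N; rewrite ltn_add2l => /(_ ni).
by rewrite /B' (_ : (p + i < p)%N = false) ?addKn// ltnNge leq_addr.
Qed.

(** The entries from [p] on are frozen at 0, so that head and tail live in the same path space. *)
Definition head_seq p : Omega -> seqT := fun w i => if (i < p)%N then Y i w else 0.
Definition tail_seq p : Omega -> seqT := fun w i => Y (p + i)%N w.

Lemma measurable_head_seq p : measurable_fun setT (head_seq p).
Proof. by apply: measurable_path => i; rewrite /head_seq; case: (i < p)%N => //; exact: measurable_cst. Qed.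

Lemma measurable_tail_seq p : measurable_fun setT (tail_seq p).
Proof. by apply: measurable_path => i; exact: mY. Qed.

Lemma seq_indep p : indep_maps P (head_seq p) (tail_seq p).
Proof.
apply: (indep_maps_pi (measurable_head_seq p) (measurable_tail_seq p)
  boxes_gen boxes_setI boxes_gen boxes_setI) => _ _ [n [A [mA ->]]] [m [B [mB ->]]].
pose A' i := if (i < n)%N then A i else setT.
pose B' i := if (i < p)%N then setT else if (i < p + m)%N then B (i - p)%N else setT.
pose C i := if (i < p)%N then A' i else B' i.
have mA' i : measurable (A' i) by rewrite /A'; case: ifP.
have mB' i : measurable (B' i) by rewrite /B'; do 2 case: ifP => //.
have mC i : measurable (C i) by rewrite /C; case: ifP.
have postE : tail_seq p @^-1` cylinder m id B =
    [set w | forall i, (i < p + m)%N -> B' i (Y i w)].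
  apply/seteqP; split => w /= h i.
    move=> ipm; rewrite /B' ipm; case: ifPn => //; rewrite -leqNgt => pi.
    by have := h (i - p)%N; rewrite /tail_seq subnKC//; apply; rewrite ltn_subLR.
  move=> mi; have := h (p + i)%N; rewrite ltn_add2l => /(_ mi).
  by rewrite /B' (_ : (p + i < p)%N = false) ?addKn ?ltn_add2l ?mi// ltnNge leq_addr.
have [Q|Q] := pselect (forall i, (p <= i)%N -> (i < n)%N -> A i 0); last first.
  rewrite (_ : head_seq p @^-1` _ = set0) ?set0I ?measure0 ?mul0e//.
  apply/seteqP; split => // w /= h; apply: Q => i pi ni.
  by have := h i ni; rewrite /head_seq ltnNge pi.
have preE : head_seq p @^-1` cylinder n id A =
    [set w | forall i, (i < p)%N -> A' i (Y i w)].
  apply/seteqP; split => w /= h i.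
    by move=> ip; rewrite /A'; case: ifPn => // /h; rewrite /head_seq ip.
  move=> ni; rewrite /head_seq; case: ifPn => [ip|]; last by rewrite -leqNgt => /Q; apply.
  by have := h i ip; rewrite /A' ni.
rewrite postE preE [X in P X = _](_ : _ =
    [set w | forall i, (i < p + m)%N -> C i (Y i w)]); last first.
  apply/seteqP; split => w /=.
    move=> [h1 h2] i ipm; rewrite /C; case: ifPn => [|_]; first exact: h1.
    exact: h2.
  move=> h; split => i ip.
    by have := h i; rewrite /C ip; apply; exact: ltn_addr.
  by have := h i ip; rewrite /C; case: ifPn => // ip'; rewrite /B' ip'.
rewrite !mutually_indepE// -EFinM; congr (_%:E).
rewrite !big_split_ord/= [X in _ * (X * _)]big1 ?mul1r; last first.
  by move=> i _; rewrite /B' /= ltn_ord preimage_setT probability_setT.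
congr (_ * _); apply: eq_bigr => i _; rewrite /C /= ?ltn_ord//.
by rewrite ltnNge leq_addr.
Qed.

End independent_sequences.

Lemma seq_law {R : realType} d (Omega : measurableType d) (P : probability Omega R)
    (Y Y' : nat -> Omega -> R) :
  (forall i, measurable_fun setT (Y i)) -> (forall i, measurable_fun setT (Y' i)) ->
  (forall n, mutually_indep P n Y) -> (forall n, mutually_indep P n Y') ->
  (forall i B, measurable B -> P (Y i @^-1` B) = P (Y' i @^-1` B)) ->
  forall C : set (pathT R nat), measurable C ->
    P ((fun w => Y ^~ w) @^-1` C) = P ((fun w => Y' ^~ w) @^-1` C).
Proof.
move=> mY mY' iY iY' YY' C mC.
have mpY : measurable_fun setT ((fun w => Y ^~ w) : Omega -> pathT R nat).
  exact: measurable_path.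
have mpY' : measurable_fun setT ((fun w => Y' ^~ w) : Omega -> pathT R nat).
  exact: measurable_path.
pose m1 := push_measure P mpY; pose m2 := push_measure P mpY'.
suff : m1 C = m2 C by [].
apply: (@pi_eq_measures R _ (pathT R nat) (@boxes R) m1 m2) => //.
- exact: boxes_gen.
- exact: boxes_setI.
- exact: boxesT.
- by rewrite /m1 /= /pushforward preimage_setT probability_setT ltry.
move=> _ [n [B [mB ->]]]; rewrite /m1 /m2 /= /pushforward.
rewrite (_ : _ @^-1` _ = [set w | forall i, (i < n)%N -> B i (Y i w)])//.
rewrite mutually_indepE// [in RHS](_ : _ @^-1` _ =
  [set w | forall i, (i < n)%N -> B i (Y' i w)])// mutually_indepE//.
by congr (_%:E); apply: eq_bigr => i _; rewrite YY'.
Qed.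

(** * Independent increments as independence of path segments *)

Lemma exists_grid {R : realType} (l : seq R) (t : R) :
  (forall x, x \in l -> 0 <= x <= t) -> 0 <= t ->
  exists (p : nat) (s : nat -> R), [/\ s 0%N = 0, s p = t,
    (forall i, s i <= s i.+1) & forall x, x \in l -> exists2 i, (i <= p)%N & s i = x].
Proof.
move=> lt t0; pose S := sort <=%R (0 :: l).
have memS x : (x \in S) = (x \in 0 :: l) by rewrite mem_sort.
have S0t x : x \in S -> 0 <= x <= t.
  by rewrite memS inE => /orP[/eqP->|/lt//]; rewrite lexx.
have sS : sorted <=%R S by exact: (sort_sorted le_total).
have szS : size S = (size l).+1 by rewrite size_sort.
(* The default value [t] of [nth] makes index [size S] the right endpoint of the grid, and keeps the
   grid constant beyond it. *)
exists (size S), (nth t S); split.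
- have : 0 \in S by rewrite memS inE eqxx.
  move=> /(nthP t)[i iS iE]; apply/eqP; rewrite eq_le.
  have := S0t (nth t S 0) (mem_nth _ _); rewrite szS => /(_ erefl)/andP[-> _].
  rewrite andbT -iE; case: i {iE} iS => [|i] iS//.
  by apply: (sorted_leq_nth le_trans le_refl t sS) => //; rewrite inE szS.
- by rewrite nth_default.
- move=> i; have [iS|iS] := ltnP i.+1 (size S).
    by apply: (sorted_leq_nth le_trans le_refl t sS) => //; rewrite inE// ltnW.
  rewrite [leRHS]nth_default//; have [iS'|iS'] := ltnP i (size S).
    by have /andP[] := S0t _ (mem_nth t iS').
  by rewrite nth_default.
- move=> x xl; have : x \in S by rewrite memS inE xl orbT.
  by move=> /(nthP t)[i iS <-]; exists i => //; exact: ltnW.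
Qed.

Section levy_paths.
Context {R : realType} {d : measure_display} {Omega : measurableType d}.
Variables (P : probability Omega R) (X : R -> Omega -> R).
Hypothesis levyX : levy_process P X.

(** Times are clamped to [[0, t]] here, and to nonnegative values in [postX], so that all of [R] can
    index the paths while [X] is only read at times where it is a Levy process. *)
Definition preX (t : R) : Omega -> pathT R R :=
  fun w u => X (Num.min (Num.max u 0) t) w.
Definition postX (t : R) : Omega -> pathT R R :=
  fun w u => X (t + Num.max u 0) w - X t w.

Lemma levy_measurable t : 0 <= t -> measurable_fun setT (X t).
Proof. by case: levyX => + _ _ _ _; exact. Qed.

Lemma measurable_preX t : 0 <= t -> measurable_fun setT (preX t).
Proof.
move=> t0; apply: measurable_path => u; apply: levy_measurable.
by rewrite le_min t0 andbT le_max lexx orbT.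
Qed.

Lemma measurable_postX t : 0 <= t -> measurable_fun setT (postX t).
Proof.
move=> t0; apply: measurable_path => u.
apply: measurable_funB; apply: levy_measurable => //.
by rewrite addr_ge0// le_max lexx orbT.
Qed.

Let seqT := pathT R nat.

(* cylinder events of the path become events on the sequence of increments over a grid *)
Let partial_sums (idx : nat -> nat) : seqT -> seqT :=
  fun y j => \sum_(i < idx j) y i.

Let measurable_partial_sums idx : measurable_fun setT (partial_sums idx).
Proof.
apply: measurable_path => j; rewrite /partial_sums.
by apply: measurable_sum => i; exact: measurable_coord.
Qed.

Let incr (tt : nat -> R) (i : nat) (w : Omega) := X (tt i.+1) w - X (tt i) w.

Let incr_indep tt : 0 <= tt 0%N -> (forall i, tt i <= tt i.+1) ->
  forall n, mutually_indep P n (incr tt).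
Proof. by case: levyX => _ _ _ _ + t0 ndt n; exact. Qed.

Let measurable_incr tt : (forall i, 0 <= tt i) ->
  forall i, measurable_fun setT (incr tt i).
Proof. by move=> tt0 i; apply: measurable_funB; exact: levy_measurable. Qed.

Let nd_ge0 (tt : nat -> R) : tt 0%N = 0 -> (forall i, tt i <= tt i.+1) ->
  forall i, 0 <= tt i.
Proof. by move=> t0 nd; elim=> [|i ih]; [rewrite t0|exact: le_trans (nd _)]. Qed.

Let sum_incr tt n w : \sum_(i < n) incr tt i w = X (tt n) w - X (tt 0%N) w.
Proof.
elim: n => [|n ih]; first by rewrite big_ord0 subrr.
by rewrite big_ord_recr/= ih /incr addrC addrA subrK.
Qed.

Let future_grid n (c : nat -> R) : exists (s : nat -> R) (idx : nat -> nat),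
  [/\ s 0%N = 0, (forall i, s i <= s i.+1) &
      forall j, (j < n)%N -> s (idx j) = Num.max (c j) 0].
Proof.
pose l := [seq Num.max (c j) 0 | j <- iota 0 n].
have [||p [s [s0 sp nds sl]]] := @exists_grid R l (\sum_(j < n) Num.max (c j) 0).
- move=> x /mapP[j]; rewrite mem_iota/= add0n => jn ->.
  rewrite le_max lexx orbT/= (bigD1 (Ordinal jn))//= lerDl sumr_ge0// => i _.
  by rewrite le_max lexx orbT.
- by apply: sumr_ge0 => i _; rewrite le_max lexx orbT.
have : forall j, exists i, (j < n)%N -> s i = Num.max (c j) 0.
  move=> j; have [jn|jn] := ltnP j n; last by exists 0%N.
  have [|i _ si] := sl (Num.max (c j) 0); last by exists i.
  by apply/mapP; exists j => //; rewrite mem_iota.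
by move=> /choice[idx sidx]; exists s, idx.
Qed.

Let past_grid n (c : nat -> R) t : 0 <= t -> exists (s : nat -> R) (p : nat) (idx : nat -> nat),
  [/\ s 0%N = 0, s p = t, (forall i, s i <= s i.+1) &
      forall j, (j < n)%N -> (idx j <= p)%N /\ s (idx j) = Num.min (Num.max (c j) 0) t].
Proof.
move=> t0; pose l := [seq Num.min (Num.max (c j) 0) t | j <- iota 0 n].
have [|//|p [s [s0 sp nds sl]]] := @exists_grid R l t.
  move=> x /mapP[j _ ->].
  by rewrite le_min t0 le_max lexx orbT/= ge_min lexx orbT.
have : forall j, exists i, (j < n)%N -> (i <= p)%N /\ s i = Num.min (Num.max (c j) 0) t.
  move=> j; have [jn|jn] := ltnP j n; last by exists 0%N.
  have [|i ip si] := sl (Num.min (Num.max (c j) 0) t); last by exists i.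
  by apply/mapP; exists j => //; rewrite mem_iota.
by move=> /choice[idx sidx]; exists s, p, idx.
Qed.

Let measurableE : (@measurable _ R : set (set R)) = <<s (@measurable _ R : set (set R)) >>.
Proof. by rewrite sigma_algebra_id//; exact: sigma_algebra_measurable. Qed.

(** A cylinder event reads finitely many times. Put on one grid containing [t], the two events
    become events on two disjoint blocks of increments. *)
Lemma levy_indep t : 0 <= t -> indep_maps P (preX t) (postX t).
Proof.
move=> t0.
apply: (indep_maps_pi (measurable_preX t0) (measurable_postX t0)
  (cylinders_gen measurableE) (@cylinders_setI _ _ _)
  (cylinders_gen measurableE) (@cylinders_setI _ _ _)).
move=> _ _ [n [c [A [mA ->]]]] [m [c' [B [mB ->]]]].
have [s [p [idx [s0 sp nds sidx]]]] := past_grid n c t0.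
have [s' [idx' [s'0 nds' sidx']]] := future_grid m c'.
(* One grid for both segments: the past grid up to index [p], where it reaches [t], continued by the
   future grid translated by [t]. *)
pose tt i := if (i <= p)%N then s i else t + s' (i - p)%N.
have ttp i : tt (p + i)%N = t + s' i.
  rewrite /tt; case: ifPn => [|_]; last by rewrite addKn.
  by rewrite -[leqRHS]addn0 leq_add2l leqn0 => /eqP->; rewrite addn0 s'0 addr0.
have ndtt i : tt i <= tt i.+1.
  have [ip|pi] := ltnP i p; first by rewrite /tt ip ltnW.
  by rewrite -(subnKC pi) -addnS !ttp lerD2l.
have tt0 : tt 0%N = 0 by rewrite /tt s0.
have tt_ge0 := nd_ge0 tt0 ndtt.
have X0 w : X 0 w = 0 by case: levyX => _ + _ _ _; exact.
have mI := measurable_incr tt_ge0.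
have preE : preX t @^-1` cylinder n c A =
    head_seq (incr tt) p @^-1` (partial_sums idx @^-1` cylinder n id A).
  apply/seteqP; split => w /= h j jn; have := h j jn; have [idxp sE] := sidx j jn;
  rewrite /preX /partial_sums -sE /head_seq;
  rewrite (eq_bigr (fun i : 'I_(idx j) => incr tt i w)) ?sum_incr ?tt0 ?X0 ?subr0;
  rewrite ?/tt ?idxp// => i _; by rewrite (leq_trans (ltn_ord i)).
have postE : postX t @^-1` cylinder m c' B =
    tail_seq (incr tt) p @^-1` (partial_sums idx' @^-1` cylinder m id B).
  have sumE j w : \sum_(i < j) incr tt (p + i)%N w = X (t + s' j) w - X t w.
    elim: j => [|j ih]; first by rewrite big_ord0 s'0 addr0 subrr.
    by rewrite big_ord_recr/= ih /incr -addnS !ttp addrC addrA subrK.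
  apply/seteqP; split => w /= h j jm; have := h j jm; have sE := sidx' j jm;
  by rewrite /postX /partial_sums -sE /tail_seq sumE.
rewrite preE postE; apply: seq_indep => //.
- by apply: incr_indep => //; rewrite tt0.
- by apply: preim_measurable => //; exact: measurable_cylinder.
- by apply: preim_measurable => //; exact: measurable_cylinder.
Qed.

Lemma levy_stationary t : 0 <= t -> forall C : set (pathT R R), measurable C ->
  P (postX t @^-1` C) = P (postX 0 @^-1` C).
Proof.
move=> t0 C mC.
have m1 := measurable_postX t0; have m2 := measurable_postX (lexx 0).
suff : push_measure P m1 C = push_measure P m2 C by [].
apply: (@pi_eq_measures R _ (pathT R R) (cylinders measurable)) => //.
- exact: cylinders_gen.
- exact: cylinders_setI.
- by apply: cylinders_setT; [exists setT|exact: (inhabits 0)].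
- by rewrite /= /pushforward preimage_setT probability_setT ltry.
move=> _ [n [c [B [mB ->]]]]; rewrite /= /pushforward.
have [s [idx [s0 nds sidx]]] := future_grid n c.
have s_ge0 := nd_ge0 s0 nds.
have cylE u : 0 <= u -> postX u @^-1` cylinder n c B =
  (fun w => (incr (fun i => u + s i)) ^~ w) @^-1` (partial_sums idx @^-1` cylinder n id B).
  move=> u0; apply/seteqP; split => w /= h j jm; have := h j jm; have sE := sidx j jm;
  by rewrite /postX /partial_sums -sE sum_incr s0 addr0.
rewrite !cylE//; apply: seq_law.
- by apply: measurable_incr => i; rewrite addr_ge0.
- by apply: measurable_incr => i; rewrite addr_ge0.
- by apply: incr_indep => [|i]; rewrite ?s0 ?addr0// lerD2l.
- by apply: incr_indep => [|i]; rewrite ?s0 ?addr0// lerD2l.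
- move=> i A mA; rewrite /incr.
  case: levyX => _ _ _ st _.
  rewrite !st// ?addr_ge0 ?lerD2l// ?nds//.
  by rewrite !opprD !(addrACA _ (s _)) !subrr !add0r.
- by apply: preim_measurable => //; exact: measurable_cylinder.
Qed.

End levy_paths.

(** * Approximation of random times by grids *)

Section grid.
Context {R : realType}.
Implicit Types (t : R) (n m : nat).

(** For [t > 0], the index of the cell of width [1/(n+1)], open on the left and closed on the right,
    that contains [t]. The lower end [gdn] is thus strictly before [t], as left limits and
    adaptedness require, and the upper end [gup] is at or after [t], as right-continuity
    requires. *)
Definition gidx n t : nat := `|Num.ceil (t * n.+1%:R)|%N.-1.
Definition gpt n m : R := m%:R / n.+1%:R.
Definition gdn n t : R := gpt n (gidx n t).
Definition gup n t : R := gpt n (gidx n t).+1.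

Lemma gpt_ge0 n m : 0 <= gpt n m.
Proof. by rewrite /gpt divr_ge0. Qed.

Lemma gptS n m : gpt n m.+1 = gpt n m + n.+1%:R^-1.
Proof. by rewrite /gpt -natr1 mulrDl mul1r. Qed.

Lemma gidxP n t m : 0 < t -> (gidx n t == m) = (gpt n m < t <= gpt n m.+1).
Proof.
move=> t0; rewrite /gpt ltr_pdivrMr// ler_pdivlMr//.
have : 0 < Num.ceil (t * n.+1%:R) by rewrite ceil_gt0 mulr_gt0.
have kE (k : nat) : (k.+1%:Z - 1)%:~R = k%:R :> R.
  by rewrite intrB -pmulrn -natr1 addrK.
rewrite /gidx; case cE : (Num.ceil _) => [[|k]|k]// _ /=.
apply/eqP/idP => [<-|h].
  by have := ceil_itv (t * n.+1%:R); rewrite cE kE -pmulrn.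
have : Num.ceil (t * n.+1%:R) = m.+1%:Z.
  by apply: ceil_def; rewrite kE -pmulrn.
by rewrite cE => -[].
Qed.

Lemma gdn_lt n t : 0 < t -> gdn n t < t.
Proof. by move=> t0; have := eqxx (gidx n t); rewrite gidxP// => /andP[]. Qed.

Lemma gup_ge n t : 0 <= t -> t <= gup n t.
Proof.
rewrite le_eqVlt => /orP[/eqP<-|t0]; first exact: gpt_ge0.
by have := eqxx (gidx n t); rewrite gidxP// => /andP[].
Qed.

Lemma gupE n t : gup n t = gdn n t + n.+1%:R^-1.
Proof. exact: gptS. Qed.

Lemma gup_le n t : 0 <= t -> gup n t <= t + n.+1%:R^-1.
Proof.
rewrite gupE lerD2r le_eqVlt => /orP[/eqP<-|/(gdn_lt n)/ltW//].
by rewrite /gdn /gidx mul0r ceil0 /gpt mul0r.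
Qed.

Lemma cvg_gup t : 0 <= t -> gup n t @[n --> \oo] --> t.
Proof.
move=> t0; apply: (@squeeze_cvgr _ _ _ _ (fun=> t) (fun n => t + n.+1%:R^-1)).
- by apply: nearW => n; rewrite gup_ge// gup_le.
- exact: cvg_cst.
- rewrite -[X in _ --> X]addr0; apply: cvgD; first exact: cvg_cst.
  exact: cvg_harmonic.
Qed.

Lemma cvg_gdn t : 0 < t -> gdn n t @[n --> \oo] --> t.
Proof.
move=> t0; rewrite (_ : (fun n => _) = (fun n => gup n t - n.+1%:R^-1)).
  rewrite -[X in _ --> X]subr0; apply: cvgB; first exact: cvg_gup (ltW t0).
  exact: cvg_harmonic.
by apply/funext => n; rewrite gupE addrK.
Qed.

Lemma cvg_right_ge (f : R -> R) t (u : R^nat) :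
  f @ t^'+ --> f t -> (forall n, t <= u n) -> u n @[n --> \oo] --> t ->
  f (u n) @[n --> \oo] --> f t.
Proof.
move=> /cvgrPdist_lt ft tu /cvgrPdist_lt ut; apply/cvgrPdist_lt => e e0.
have [r /= r0 fr] := ft e e0.
have [N _ hN] := ut r r0; exists N => // n /= Nn.
have := tu n; rewrite le_eqVlt => /orP[/eqP<-|tun]; first by rewrite subrr normr0.
by apply: fr => //=; exact: hN.
Qed.

Lemma cvg_gup_right (f : R -> R) t : 0 <= t ->
  f @ t^'+ --> f t -> f (gup n t) @[n --> \oo] --> f t.
Proof. by move=> t0 ft; apply: cvg_right_ge => // [n|]; [exact: gup_ge|exact: cvg_gup]. Qed.

Lemma cvg_gdn_left (f : R -> R) t (l : R) : 0 < t ->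
  f @ t^'- --> l -> f (gdn n t) @[n --> \oo] --> l.
Proof.
move=> t0 /cvg_at_leftP; apply; split; last exact: cvg_gdn.
by move=> n; exact: gdn_lt.
Qed.

End grid.

Lemma measurable_nat_comp {R : realType} d (T : measurableType d) d' (T' : measurableType d')
  (N : T -> nat) (Y : nat -> T -> T') :
  (forall m, measurable [set w | N w = m]) -> (forall m, measurable_fun setT (Y m)) ->
  measurable_fun setT (fun w => Y (N w) w).
Proof.
move=> mN mY _ B mB; rewrite setTI.
rewrite (_ : _ @^-1` B = \bigcup_m ([set w | N w = m] `&` Y m @^-1` B)).
  apply: bigcupT_measurable => m; apply: measurableI => //.
  by rewrite -[X in measurable X]setTI; exact: mY.
apply/seteqP; split => w /=; first by move=> Bw; exists (N w).
by move=> [m _ [/= ->]].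
Qed.

Lemma measurable_ler_set {R : realType} d (T : measurableType d) (f g : T -> R) :
  measurable_fun setT f -> measurable_fun setT g -> measurable [set w | f w <= g w].
Proof.
move=> mf mg; rewrite -[X in measurable X]setTI.
by apply: (measurable_fun_ler mf mg measurableT (Y := [set true])).
Qed.

Lemma measurable_ltr_set {R : realType} d (T : measurableType d) (f g : T -> R) :
  measurable_fun setT f -> measurable_fun setT g -> measurable [set w | f w < g w].
Proof.
move=> mf mg; rewrite -[X in measurable X]setTI.
by apply: (measurable_fun_ltr mf mg measurableT (Y := [set true])).
Qed.

Section measurable_at_random_time.
Context {R : realType} d (T : measurableType d).
Variables (tau : T -> R) (mtau : measurable_fun setT tau).

Lemma measurable_gidx n m : measurable [set w | gidx n (tau w) = m].
Proof.
pose g x : R := x * n.+1%:R.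
rewrite (_ : [set _ | _] = tau @^-1` [set x | gidx n x = m]); last by [].
have mc : forall z : int, measurable [set x : R | Num.ceil (g x) = z].
  move=> z; rewrite (_ : [set _ | _] = [set x | (z - 1)%:~R < g x] `&` [set x | g x <= z%:~R]).
    by apply: measurableI; [apply: measurable_ltr_set|apply: measurable_ler_set] => //;
      apply: measurable_funM.
  apply/seteqP; split => x /=; first by move=> <-; apply/andP; exact: ceil_itv.
  by move=> [h1 h2]; apply: ceil_def; rewrite h1 h2.
apply: preim_measurable => //.
rewrite (_ : [set _ | _] = \bigcup_(z : int) [set x : R | Num.ceil (g x) = z /\ `|z|%N.-1 = m]).
  apply: countable_bigcupT_measurable => [|z]; first exact: countableP.
  have [zm|zm] := pselect (`|z|%N.-1 = m).
    by rewrite (_ : [set _ | _] = [set x | Num.ceil (g x) = z])//; apply/seteqP; split => x /= => [[]|].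
  by rewrite (_ : [set _ | _] = set0)//; apply/seteqP; split => x /= => [[]|].
by apply/seteqP; split => x /=; [move=> <-; exists (Num.ceil (g x))|move=> [z _ [<- <-]]].
Qed.

Variable Y : R -> T -> R.
Hypothesis mY : forall t, 0 <= t -> measurable_fun setT (Y t).

Lemma measurable_at_gup n : measurable_fun setT (fun w => Y (gup n (tau w)) w).
Proof.
apply: (@measurable_nat_comp R _ _ _ _ (fun w => gidx n (tau w)) (fun m => Y (gpt n m.+1))).
  exact: measurable_gidx.
by move=> m; apply: mY; exact: gpt_ge0.
Qed.

Lemma measurable_at_gdn n : measurable_fun setT (fun w => Y (gdn n (tau w)) w).
Proof.
apply: (@measurable_nat_comp R _ _ _ _ (fun w => gidx n (tau w)) (fun m => Y (gpt n m))).
  exact: measurable_gidx.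
by move=> m; apply: mY; exact: gpt_ge0.
Qed.

Lemma measurable_at_right : (forall w, 0 <= tau w) ->
  (forall t w, 0 <= t -> Y ^~ w @ t^'+ --> Y t w) ->
  measurable_fun setT (fun w => Y (tau w) w).
Proof.
move=> tau0 rcY; apply: (measurable_fun_cvg (h := fun n w => Y (gup n (tau w)) w)).
  exact: measurable_at_gup.
by move=> w _; apply: (cvg_gup_right (f := Y ^~ w)) => //; exact: rcY.
Qed.

End measurable_at_random_time.

Lemma bounded_cvg_integral {R : realType} d (T : measurableType d) (P : probability T R)
    (f_ : (T -> R)^nat) (f : T -> R) :
  (forall n, measurable_fun setT (f_ n)) ->
  (forall n w, 0 <= f_ n w <= 1) -> (forall w, f_ n w @[n --> \oo] --> f w) ->
  (\int[P]_w (f_ n w)%:E @[n --> \oo] --> \int[P]_w (f w)%:E)%E.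
Proof.
move=> mf_ f01 ff.
have mf : measurable_fun setT f by apply: (measurable_fun_cvg mf_) => w _; exact: ff.
apply: (@dominated_cvg _ _ _ P setT _ (fun n => EFin \o f_ n) (EFin \o f) (cst 1%E)) => //.
- by move=> n; apply/measurable_EFinP; exact: mf_.
- by move=> w _; apply: cvg_EFin; [exact: nearW|exact: ff].
- exact: finite_measure_integrable_cst.
- by move=> n w _ /=; rewrite lee_fin ger0_norm//; case/andP: (f01 n w).
Qed.

Lemma borel_gen {R : realType} :
  (@measurable _ R : set (set R)) = <<s (@measurable _ R : set (set R)) >>.
Proof. by rewrite sigma_algebra_id//; exact: sigma_algebra_measurable. Qed.

(** * Markov property of path and clock at a deterministic time *)

Section grid_markov.
Context {R : realType} {d : measure_display} {Omega : measurableType d}.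
Variables (P : probability Omega R) (X : R -> Omega -> R) (E : nat -> Omega -> R).
Hypothesis levyX : levy_process P X.
Hypothesis mE : forall k, measurable_fun setT (E k).
Hypothesis E_gt0 : forall k w, 0 < E k w.
Hypothesis E_law : forall k (B : set R), measurable B ->
  P (E k @^-1` B) = P (E 0%N @^-1` B).
Hypothesis E_indep : forall n, mutually_indep P n E.
Hypothesis XE : indep_sigma P (gen_X X) (gen_N E).

Lemma T_of0 w : T_of E 0 w = 0.
Proof. by rewrite /T_of /arrival big_ord0. Qed.

Lemma T_ofS k w : T_of E k.+1 w = T_of E k w + E k w.
Proof. by rewrite /T_of /arrival big_ord_recr. Qed.

Lemma T_of_lt k w : T_of E k w < T_of E k.+1 w.
Proof. by rewrite T_ofS ltrDl. Qed.

Lemma T_of_le k j w : (k <= j)%N -> T_of E k w <= T_of E j w.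
Proof.
move=> /subnKC <-; elim: (j - k)%N => [|n ih]; first by rewrite addn0.
by rewrite addnS (le_trans ih)// ltW// T_of_lt.
Qed.

Lemma T_of_ge0 k w : 0 <= T_of E k w.
Proof. by rewrite -(T_of0 w); exact: T_of_le. Qed.

Lemma T_of_gt0 k w : 0 < T_of E k.+1 w.
Proof. by rewrite (le_lt_trans (T_of_ge0 k w))// T_of_lt. Qed.

(** Path and interarrival times share one path space, indexed by [R + nat], so that the past (and
    likewise the future) is a single random element. The time [t] is deterministic and unrelated to
    the number [k] of arrivals counted as past. *)
Definition pre (t : R) (k : nat) : Omega -> pathT R (R + nat) :=
  fun w c => match c with inl u => preX X t w u | inr i => head_seq E k w i end.
Definition post_at (t : R) (k : nat) : Omega -> pathT R (R + nat) :=
  fun w c => match c with inl u => postX X t w u | inr i => tail_seq E k w i end.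

Lemma measurable_pre t k : 0 <= t -> measurable_fun setT (pre t k).
Proof.
move=> t0; apply: measurable_path => -[u|i].
  exact: (measurableT_comp (measurable_coord u) (measurable_preX levyX t0)).
exact: (measurableT_comp (measurable_coord i) (measurable_head_seq mE k)).
Qed.

Lemma measurable_post_at t k : 0 <= t -> measurable_fun setT (post_at t k).
Proof.
move=> t0; apply: measurable_path => -[u|i].
  exact: (measurableT_comp (measurable_coord u) (measurable_postX levyX t0)).
exact: (measurableT_comp (measurable_coord i) (measurable_tail_seq mE k)).
Qed.

(** These split a cylinder over [R + nat] into a path part and a clock part: a constraint of the
    other kind is replaced by [setT] at a dummy coordinate. *)
Let ctl (c : nat -> R + nat) i := if c i is inl u then u else 0.
Let ctr (c : nat -> R + nat) i := if c i is inr j then j else 0%N.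
Let bxl (c : nat -> R + nat) (B : nat -> set R) i := if c i is inl _ then B i else setT.
Let bxr (c : nat -> R + nat) (B : nat -> set R) i := if c i is inr _ then B i else setT.

Let pre_cyl t k n c B : pre t k @^-1` cylinder n c B =
  preX X t @^-1` cylinder n (ctl c) (bxl c B) `&` head_seq E k @^-1` cylinder n (ctr c) (bxr c B).
Proof.
apply/seteqP; split => w /=.
  move=> h; split => i ni; have := h i ni; rewrite /bxl /bxr /ctl /ctr /=;
  by case: (c i).
move=> [h1 h2] i ni; have := h1 i ni; have := h2 i ni; rewrite /bxl /bxr /ctl /ctr /=.
by case: (c i).
Qed.

Let post_cyl t k n c B : post_at t k @^-1` cylinder n c B =
  postX X t @^-1` cylinder n (ctl c) (bxl c B) `&` tail_seq E k @^-1` cylinder n (ctr c) (bxr c B).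
Proof.
apply/seteqP; split => w /=.
  move=> h; split => i ni; have := h i ni; rewrite /bxl /bxr /ctl /ctr /=;
  by case: (c i).
move=> [h1 h2] i ni; have := h1 i ni; have := h2 i ni; rewrite /bxl /bxr /ctl /ctr /=.
by case: (c i).
Qed.

(** [Omega] with the sigma-algebra of [X] alone; membership in [<<s gen_X X >>] then follows from
    ordinary measurability lemmas. *)
Let OX := g_sigma_algebraType (gen_X X).
Let ON := g_sigma_algebraType (gen_N E).

Let mX_OX t : 0 <= t -> measurable_fun setT (X t : OX -> R).
Proof.
move=> t0 _ B mB; rewrite setTI; apply: sub_sigma_algebra.
by exists t => //; exists B.
Qed.

Let mT_ON k : measurable_fun setT (T_of E k : ON -> R).
Proof.
apply: (measurability _ (RGenOInfty.measurableE R)) => //.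
move=> _ [_ [x ->] <-]; rewrite setTI.
rewrite (_ : _ @^-1` _ = ~` ([set w | T_of E k w <= x] : set ON)); last first.
  apply/seteqP; split => w /=; rewrite in_itv/= andbT ltNge; first by move/negP.
  by move=> /negP.
apply: measurableC; have [x0|x0] := leP 0 x.
  by apply: sub_sigma_algebra; exists k; exists x.
rewrite (_ : [set w | _] = set0)//; apply/seteqP; split => // w /=.
by rewrite leNgt (lt_le_trans x0 (T_of_ge0 k w)).
Qed.

Let mE_ON k : measurable_fun setT (E k : ON -> R).
Proof.
rewrite (_ : E k = fun w => T_of E k.+1 w - T_of E k w).
  exact: measurable_funB.
by apply/funext => w; rewrite T_ofS addrC addrA addNr add0r.
Qed.

Let mpreX t A : 0 <= t -> measurable A -> <<s gen_X X >> (preX X t @^-1` A).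
Proof.
move=> t0 mA; apply: (@preim_measurable _ OX _ _ (preX X t) A) => //.
apply: measurable_path => u; apply: mX_OX.
by rewrite le_min t0 andbT le_max lexx orbT.
Qed.

Let mpostX t A : 0 <= t -> measurable A -> <<s gen_X X >> (postX X t @^-1` A).
Proof.
move=> t0 mA; apply: (@preim_measurable _ OX _ _ (postX X t) A) => //.
apply: measurable_path => u; apply: measurable_funB; apply: mX_OX => //.
by rewrite addr_ge0// le_max lexx orbT.
Qed.

Let mhead k A : measurable A -> <<s gen_N E >> (head_seq E k @^-1` A).
Proof.
move=> mA; apply: (@preim_measurable _ ON _ _ (head_seq E k) A) => //.
apply: measurable_path => i; rewrite /head_seq; case: (i < k)%N => //.
Qed.

Let mtail k A : measurable A -> <<s gen_N E >> (tail_seq E k @^-1` A).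
Proof.
move=> mA; apply: (@preim_measurable _ ON _ _ (tail_seq E k) A) => //.
by apply: measurable_path => i; exact: mE_ON.
Qed.

Let sI (G : set (set Omega)) A B : <<s G >> A -> <<s G >> B -> <<s G >> (A `&` B).
Proof. exact: (@measurableI _ (g_sigma_algebraType G)). Qed.

(** Three independences are combined on cylinders: the two path segments, the two blocks of
    interarrival times, and path against clock. *)
Lemma grid_indep t k : 0 <= t -> indep_maps P (pre t k) (post_at t k).
Proof.
move=> t0.
apply: (indep_maps_pi (measurable_pre k t0) (measurable_post_at k t0)
  (cylinders_gen borel_gen) (@cylinders_setI _ _ _)
  (cylinders_gen borel_gen) (@cylinders_setI _ _ _)).
move=> _ _ [n [c [A [mA ->]]]] [m [c' [B [mB ->]]]].
rewrite pre_cyl post_cyl.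
have mcyl1 i : measurable (bxl c A i) by rewrite /bxl; case: (c i).
have mcyl2 i : measurable (bxr c A i) by rewrite /bxr; case: (c i).
have mcyl3 i : measurable (bxl c' B i) by rewrite /bxl; case: (c' i).
have mcyl4 i : measurable (bxr c' B i) by rewrite /bxr; case: (c' i).
rewrite setIACA XE; last 2 first.
- by apply: sI; [apply: mpreX|apply: mpostX] => //; apply: measurable_cylinder.
- by apply: sI; [apply: mhead|apply: mtail] => //; apply: measurable_cylinder.
rewrite levy_indep//; [|exact: measurable_cylinder..].
rewrite (seq_indep mE E_indep); [|exact: measurable_cylinder..].
rewrite !XE; first by rewrite muleACA.
- by apply: mpostX => //; exact: measurable_cylinder.
- by apply: mtail => //; exact: measurable_cylinder.
- by apply: mpreX => //; exact: measurable_cylinder.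
- by apply: mhead => //; exact: measurable_cylinder.
Qed.

Lemma grid_law t k : 0 <= t -> forall C, measurable C ->
  P (post_at t k @^-1` C) = P (post_at 0 0 @^-1` C).
Proof.
move=> t0 C mC.
have m1 := measurable_post_at k t0; have m2 := measurable_post_at 0 (lexx 0).
suff : push_measure P m1 C = push_measure P m2 C by [].
apply: (@pi_eq_measures R _ (pathT R (R + nat)) (cylinders measurable)) => //.
- exact/cylinders_gen/borel_gen.
- exact: cylinders_setI.
- by apply: cylinders_setT; [exists setT|exact: (inhabits (inr 0%N))].
- by rewrite /= /pushforward preimage_setT probability_setT ltry.
move=> _ [n [c [A [mA ->]]]]; rewrite /= /pushforward !post_cyl.
have mcyl1 i : measurable (bxl c A i) by rewrite /bxl; case: (c i).
have mcyl2 i : measurable (bxr c A i) by rewrite /bxr; case: (c i).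
rewrite !XE; last 4 first.
- by apply: mpostX => //; exact: measurable_cylinder.
- by apply: mtail => //; exact: measurable_cylinder.
- by apply: mpostX => //; exact: measurable_cylinder.
- by apply: mtail => //; exact: measurable_cylinder.
rewrite (levy_stationary levyX t0); last exact: measurable_cylinder.
congr (_ * _)%E; apply: seq_law => //.
- exact: mutually_indep_shift.
- by move=> i B mB; rewrite E_law// [RHS]E_law.
- exact: measurable_cylinder.
Qed.

End grid_markov.

(** * The strong Markov property at the arrival times *)

Lemma integral_partition {R : realType} d (T : measurableType d)
    (P : {measure set T -> \bar R}) (N : T -> nat) (f : T -> \bar R) :
  (forall m, measurable [set w | N w = m]) -> measurable_fun setT f ->
  (forall w, (0 <= f w)%E) ->
  (\int[P]_w f w = \sum_(m <oo) \int[P]_(w in [set w | N w = m]) f w)%E.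
Proof.
move=> mN mf f0.
have UD : \bigcup_m [set w | N w = m] = setT.
  by apply/seteqP; split => // w _; exists (N w).
rewrite -[X in (\int[P]_(_ in X) _)%E]UD; apply: ge0_integral_bigcup => //.
- by rewrite UD.
- by apply/trivIsetP => i j _ _ ij; apply/seteqP; split => // w [/= Ni Nj]; rewrite -Ni -Nj eqxx in ij.
Qed.

Section markov.
Context {R : realType} {d : measure_display} {Omega : measurableType d}.
Variables (P : probability Omega R) (X : R -> Omega -> R) (E : nat -> Omega -> R).
Hypothesis levyX : levy_process P X.
Hypothesis mE : forall k, measurable_fun setT (E k).
Hypothesis E_gt0 : forall k w, 0 < E k w.
Hypothesis E_law : forall k (B : set R), measurable B ->
  P (E k @^-1` B) = P (E 0%N @^-1` B).
Hypothesis E_indep : forall n, mutually_indep P n E.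
Hypothesis XE : indep_sigma P (gen_X X) (gen_N E).

Lemma levy_right t w : 0 <= t -> X ^~ w @ t^'+ --> X t w.
Proof. by move=> t0; case: levyX => _ _ + _ _ => /(_ w)[+ _]; exact. Qed.

Lemma levy0 w : X 0 w = 0.
Proof. by case: levyX => _ + _ _ _; exact. Qed.

Lemma measurable_T_of k : measurable_fun setT (T_of E k).
Proof.
rewrite (_ : T_of E k = fun w => \sum_(i < k) E i w); last by [].
exact: measurable_sum.
Qed.

(** [Omega] with the information of the path up to [t] and of the first [k] interarrival times. *)
Let preO t k := g_sigma_algebra_preimageType (pre X E t k).

Let preO_coord t k c : measurable_fun setT ((fun w => pre X E t k w c) : preO t k -> R).
Proof.
move=> _ B mB; rewrite setTI; exists ((fun f : pathT R (R + nat) => f c) @^-1` B).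
  by apply: preim_measurable => //; exact: measurable_coord.
by rewrite setTI.
Qed.

Let preO_X t k s : 0 <= s <= t -> measurable_fun setT (X s : preO t k -> R).
Proof.
move=> /andP[s0 st]; have := @preO_coord t k (inl s).
by rewrite /pre /preX /= (max_l s0) (min_l st).
Qed.

Let preO_T t k j : (j <= k)%N -> measurable_fun setT (T_of E j : preO t k -> R).
Proof.
move=> jk; rewrite (_ : T_of E j = fun w => \sum_(i < j) pre X E t k w (inr (i : nat))).
  by apply: (@measurable_sum _ (preO t k)) => i; exact: preO_coord.
apply/funext => w; apply: eq_bigr => i _.
by rewrite /pre /head_seq (leq_trans (ltn_ord i)).
Qed.

(* before time T_k, an event of F_s only depends on the path up to s and on the first k interarrival times *)
Lemma adapted_restrict s t k A : 0 <= s <= t -> <<s gen_F X E s >> A ->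
  measurable ([set w | s < T_of E k w] `&` A : set (preO t k)).
Proof.
move=> st; pose D : set (preO t k) := [set w | s < T_of E k w].
have mD : measurable D.
  by apply: measurable_ltr_set => //; exact: preO_T.
pose H := [set A : set Omega | measurable (D `&` A : set (preO t k))].
suff : <<s gen_F X E s >> `<=` H by exact.
apply: smallest_sub.
  split.
  - by rewrite /H /= setI0.
  - move=> B HB; rewrite /H /= setTD -setDE (_ : D `\` B = D `\` (D `&` B)).
      exact: measurableD.
    by rewrite setDIr setDv set0U.
  - by move=> F HF; rewrite /H /= setI_bigcupr; exact: bigcupT_measurable.
move=> B [[u [/andP[u0 us] [C mC ->]]]|[j [u [/andP[u0 us] ->]]]]; rewrite /H /=.
  apply: measurableI => //; apply: (@preim_measurable _ (preO t k)) => //.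
  by apply: preO_X; case/andP: st => s0 st; rewrite u0 (le_trans us).
have [jk|kj] := leqP j k.
  by apply: measurableI => //; apply: measurable_ler_set => //; exact: preO_T.
rewrite (_ : _ `&` _ = set0)//; apply/seteqP; split => // w [/= h1 h2].
have := lt_le_trans h1 (le_trans (T_of_le E_gt0 w (ltnW kj)) h2).
by rewrite ltNge us.
Qed.

Variables (q : R) (rho : R -> Omega -> R).
Hypothesis adapt_rho : adapted X E rho.

Lemma adapted_measurable (Y : R -> Omega -> R) t : adapted X E Y ->
  0 <= t -> measurable_fun setT (Y t).
Proof.
move=> aY t0 _ B mB; rewrite setTI; have := aY t t0 B mB.
have : sigma_algebra setT (@measurable _ Omega) by exact: sigma_algebra_measurable.
move=> sm; move: (Y t @^-1` B); apply: smallest_sub => //.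
move=> _ [[u [/andP[u0 us] [C mC ->]]]|[j [u [/andP[u0 us] ->]]]].
  by apply: preim_measurable => //; exact: (levy_measurable levyX).
by apply: measurable_ler_set => //; exact: measurable_T_of.
Qed.

Definition post (k : nat) : Omega -> pathT R (R + nat) :=
  fun w => post_at X E (T_of E k w) k w.

Lemma post0 w : post 0 w = post_at X E 0 0 w.
Proof. by rewrite /post T_of0. Qed.

(** Grid version of the discounted dividend. The integrand is read at the lower end of the cell of
    [T_k], where it is known before [T_k]; left-continuity recovers its value at [T_k] in the
    limit. *)
Let Zn k n w := expR (- q * gup n (T_of E k w)) * rho (gdn n (T_of E k w)) w.

Let measurable_Zn k n : measurable_fun setT (Zn k n).
Proof.
pose Y m w := expR (- q * gpt n m.+1) * rho (gpt n m) w.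
apply: (@measurable_nat_comp R _ _ _ _ (fun w => gidx n (T_of E k w)) Y).
  by move=> m; apply: measurable_gidx; exact: measurable_T_of.
move=> m; apply: measurable_funM => //.
by apply: adapted_measurable => //; exact: gpt_ge0.
Qed.

Lemma measurable_post_coord k c : measurable_fun setT (fun w => post k w c).
Proof.
case: c => [u|j]; rewrite /post /post_at; last exact: mE.
rewrite /postX; apply: measurable_funB.
  apply: (@measurable_at_right R _ Omega (fun w => T_of E k w + Num.max u 0) _ X).
  - by apply: measurable_funD => //; exact: measurable_T_of.
  - exact: (levy_measurable levyX).
  - by move=> w; rewrite addr_ge0 ?T_of_ge0// le_max lexx orbT.
  - by move=> t w t0; exact: levy_right.
apply: (@measurable_at_right R _ Omega (T_of E k) _ X).
- exact: measurable_T_of.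
- exact: (levy_measurable levyX).
- by move=> w; rewrite T_of_ge0.
- by move=> t w t0; exact: levy_right.
Qed.

Lemma measurable_post k : measurable_fun setT (post k).
Proof. by apply: measurable_path => c; exact: measurable_post_coord. Qed.

Let measurable_post_grid k n : measurable_fun setT
  (fun w => post_at X E (gup n (T_of E k w)) k w).
Proof.
apply: (@measurable_nat_comp R _ _ _ _ (fun w => gidx n (T_of E k w))
  (fun m => post_at X E (gpt n m.+1) k)).
  by move=> m; apply: measurable_gidx; exact: measurable_T_of.
by move=> m; apply: (measurable_post_at levyX mE k); exact: gpt_ge0.
Qed.

(** When [T_of E k.+1] lies in the cell []s, t]], the dividend read at [s], restricted to this
    event, depends only on the path up to [t] and on the first [k.+1] interarrival times, by
    [adapted_restrict]. It is thus independent of the future after [t], whose law is the same for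
    every cell, so summing over the cells factors the integral. *)
Let grid_markov k n (chi : R -> R) (Phi : pathT R (R + nat) -> R) :
  measurable_fun setT chi -> (forall y, 0 <= chi y <= 1) ->
  measurable_fun setT Phi -> (forall y, 0 <= Phi y <= 1) ->
  (\int[P]_w (chi (Zn k.+1 n w) * Phi (post_at X E (gup n (T_of E k.+1 w)) k.+1 w))%:E =
   (\int[P]_w (chi (Zn k.+1 n w))%:E) * \int[P]_w (Phi (post_at X E 0 0 w))%:E)%E.
Proof.
move=> mchi chi01 mPhi Phi01.
have chi0 y : 0 <= chi y by case/andP: (chi01 y).
have Phi0 y : 0 <= Phi y by case/andP: (Phi01 y).
pose N w := gidx n (T_of E k.+1 w).
have mN m : measurable [set w | N w = m] by apply: measurable_gidx; exact: measurable_T_of.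
rewrite (@integral_partition _ _ _ P N)//; last 2 first.
- apply/measurable_EFinP/measurable_funM; first exact: measurableT_comp (measurable_Zn _ _).
  exact: measurableT_comp (measurable_post_grid _ _).
- by move=> w; rewrite lee_fin mulr_ge0.
rewrite [in RHS](@integral_partition _ _ _ P N)//; last 2 first.
- by apply/measurable_EFinP; exact: measurableT_comp (measurable_Zn _ _).
- by move=> w; rewrite lee_fin.
have [c c0 cE] : exists2 c : R, 0 <= c & (\int[P]_w (Phi (post_at X E 0 0 w))%:E = c%:E)%E.
  exists (fine (\int[P]_w (Phi (post_at X E 0 0 w))%:E)).
    by apply/fine_ge0/integral_ge0 => w _; rewrite lee_fin.
  rewrite fineK// ge0_fin_numE; last by apply: integral_ge0 => w _; rewrite lee_fin.
  apply: (@le_lt_trans _ _ (\int[P]_w (cst 1) w)%E).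
    apply: ge0_le_integral => //.
    - by move=> w _; rewrite lee_fin.
    - apply/measurable_EFinP; apply: measurableT_comp mPhi _.
      exact: (measurable_post_at levyX mE 0 (lexx 0)).
    - by move=> w _; rewrite lee_fin; case/andP: (Phi01 (post_at X E 0 0 w)).
  by rewrite integral_cst//= ?mule1 ?probability_setT ?mule1 ?ltry.
rewrite cE muleC -nneseriesZl//; last first.
  by move=> m _; apply: integral_ge0 => w _; rewrite lee_fin.
apply: eq_eseriesr => m _.
pose s : R := gpt n m; pose t : R := gpt n m.+1.
have s0 : 0 <= s by exact: gpt_ge0.
have t0 : 0 <= t by exact: gpt_ge0.
have st : 0 <= s <= t by rewrite s0 andTb /s /t gptS lerDl invr_ge0.
pose D : set Omega := [set w | N w = m].
have DE : D = [set w | s < T_of E k.+1 w] `&` [set w | T_of E k.+1 w <= t].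
  apply/seteqP; split => w /=.
    by move=> /eqP; rewrite gidxP ?T_of_gt0// => /andP[].
  by move=> [h1 h2]; apply/eqP; rewrite gidxP ?T_of_gt0// h1 h2.
pose g w := (chi (expR (- q * t) * rho s w))%:E.
pose h := g \_ D.
have mD : measurable (D : set (preO t k.+1)).
  rewrite DE; apply: measurableI.
    by apply: measurable_ltr_set => //; exact: preO_T.
  by apply: measurable_ler_set => //; exact: preO_T.
have mh : measurable_fun setT (h : preO t k.+1 -> \bar R).
  apply: ((@measurable_restrictT _ _ (preO t k.+1) (\bar R) D g mD).1 _) => _ B mB.
   rewrite DE -setIA (setIC [set w | T_of E k.+1 w <= t]) setIA.
  apply: measurableI; last by apply: measurable_ler_set => //; exact: preO_T.
  apply: adapted_restrict => //.
  rewrite (_ : g @^-1` B = rho s @^-1` ((fun y => (chi (expR (- q * t) * y))%:E) @^-1` B))//.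
  apply: adapt_rho => //; apply: preim_measurable => //.
  apply/measurable_EFinP; apply: measurableT_comp mchi _.
  exact: measurable_funM.
(* The past enters [indep_integral] as the identity map towards [Omega] with the smaller
   sigma-algebra, so [h] need not be written as a function of the stopped path. *)
have idm : measurable_fun setT (id : Omega -> preO t k.+1).
  move=> _ A [B mB <-]; rewrite !setTI.
  exact: (preim_measurable (measurable_pre levyX mE k.+1 t0) mB).
have h0 w : (0 <= h w)%E by rewrite /h patchE; case: ifP => // _; rewrite lee_fin.
have ind : indep_maps P (id : Omega -> preO t k.+1) (post_at X E t k.+1).
  by move=> _ B [C mC <-] mB; rewrite setTI; exact: grid_indep.
have mpost := measurable_post_at levyX mE k.+1 t0.
have := @indep_integral _ _ _ P _ (preO t k.+1) _ _ _ _ h (EFin \o Phi) idm mpost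
  ind mh ((measurable_EFinP _ _).2 mPhi) h0 (fun y => Phi0 y).
move=> hE; rewrite integral_mkcond [in RHS]integral_mkcond.
transitivity (\int[P]_w (h w * (Phi (post_at X E t k.+1 w))%:E))%E.
  apply: eq_integral => w _; rewrite /h !patchE; case: ifPn => [/set_mem Dw|_].
    rewrite /g -EFinM /Zn /gup /gdn.
    by have -> : gidx n (T_of E k.+1 w) = m by exact: Dw.
  by rewrite mul0e.
rewrite [LHS]hE muleC; congr (_ * _)%E.
  rewrite -cE.
  transitivity (\int[push_measure P mpost]_f (Phi f)%:E)%E.
    rewrite ge0_integral_pushforward//; first exact/measurable_EFinP.
    by move=> y _; rewrite lee_fin.
  have mp0 := measurable_post_at levyX mE 0 (lexx (0:R)).
  transitivity (\int[push_measure P mp0]_f (Phi f)%:E)%E.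
    by apply: eq_measure_integral => A mA _; exact: grid_law.
  rewrite ge0_integral_pushforward//; first exact/measurable_EFinP.
  by move=> y _; rewrite lee_fin.
apply: eq_integral => w _; rewrite /h !patchE; case: ifPn => [/set_mem Dw|//].
rewrite /g /Zn /gup /gdn.
by have -> : gidx n (T_of E k.+1 w) = m by exact: Dw.
Qed.

Hypothesis caglad_rho : forall w, caglad (rho ^~ w).

Definition disc_div (k : nat) w := expR (- q * T_of E k w) * rho (T_of E k w) w.

Let cvg_Zn k w : Zn k.+1 n w @[n --> \oo] --> disc_div k.+1 w.
Proof.
have T0 : 0 < T_of E k.+1 w by exact: T_of_gt0.
apply: cvgM.
  apply: (@continuous_cvg _ _ _ _ _ _ expR); first exact: continuous_expR.
  by apply: cvgM; [exact: cvg_cst|exact: cvg_gup (ltW T0)].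
apply: (cvg_gdn_left (f := rho ^~ w)) => //.
by case: (caglad_rho w) => + _; exact.
Qed.

Let cvg_post_grid k w c :
  post_at X E (gup n (T_of E k w)) k w c @[n --> \oo] --> post k w c.
Proof.
have T0 : 0 <= T_of E k w by exact: T_of_ge0.
case: c => [u|j]; rewrite /post /=; last exact: cvg_cst.
have u0 : 0 <= Num.max u 0 by rewrite le_max lexx orbT.
apply: cvgB; last by apply: (cvg_gup_right (f := X ^~ w)) => //; exact: levy_right.
apply: (cvg_right_ge (f := X ^~ w)).
- by apply: levy_right; rewrite addr_ge0.
- by move=> n; rewrite lerD2r; exact: gup_ge.
- by apply: cvgD; [exact: cvg_gup|exact: cvg_cst].
Qed.

Lemma measurable_disc_div k : measurable_fun setT (disc_div k.+1).
Proof. by apply: (measurable_fun_cvg (measurable_Zn k.+1)) => w _; exact: cvg_Zn. Qed.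

Let prod01 n (F : 'I_n -> R) : (forall i, 0 <= F i <= 1) -> 0 <= \prod_i F i <= 1.
Proof.
move=> F01; apply/andP; split; first by apply: prodr_ge0 => i _; case/andP: (F01 i).
by apply: Num.Theory.prodr_ile1 => i _; exact: F01.
Qed.

Let Phi n (c : nat -> R + nat) (psi : nat -> R -> R) (f : pathT R (R + nat)) : R :=
  \prod_(i < n) psi i (f (c i)).

Let measurable_Phi n c psi : (forall i, measurable_fun setT (psi i)) ->
  measurable_fun setT (Phi n c psi).
Proof.
move=> mpsi; apply: measurable_prod => i _.
exact: measurableT_comp (mpsi i) (measurable_coord _).
Qed.

(** The grid quantities converge only pointwise, coordinate by coordinate, so the limit is taken for
    products of continuous functions of finitely many coordinates. *)
Let markov_cont k n c (psi : nat -> R -> R) (chi : R -> R) :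
  (forall i, continuous (psi i)) -> (forall i y, 0 <= psi i y <= 1) ->
  continuous chi -> (forall y, 0 <= chi y <= 1) ->
  (\int[P]_w (chi (disc_div k.+1 w) * Phi n c psi (post k.+1 w))%:E =
   (\int[P]_w (chi (disc_div k.+1 w))%:E) * \int[P]_w (Phi n c psi (post 0 w))%:E)%E.
Proof.
move=> cpsi psi01 cchi chi01.
have mpsi i : measurable_fun setT (psi i) by exact: continuous_measurable_fun.
have mchi : measurable_fun setT chi by exact: continuous_measurable_fun.
have mPhi := measurable_Phi n c mpsi.
have Phi01 f : 0 <= Phi n c psi f <= 1 by exact: prod01.
have p0E : (\int[P]_w (Phi n c psi (post 0 w))%:E = \int[P]_w (Phi n c psi (post_at X E 0 0 w))%:E)%E.
  by apply: eq_integral => w _; rewrite post0.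
pose I0 := (\int[P]_w (Phi n c psi (post 0 w))%:E)%E.
have I0fin : I0 \is a fin_num.
  rewrite ge0_fin_numE; last first.
    by apply: integral_ge0 => w _; rewrite lee_fin; case/andP: (Phi01 (post 0 w)).
  apply: (@le_lt_trans _ _ (\int[P]_w (cst 1) w)%E).
    apply: ge0_le_integral => //.
    - by move=> w _; rewrite lee_fin; case/andP: (Phi01 (post 0 w)).
    - by apply/measurable_EFinP; exact: measurableT_comp mPhi (measurable_post 0).
    - by move=> w _; rewrite lee_fin; case/andP: (Phi01 (post 0 w)).
  by rewrite integral_cst//= ?mule1 ?probability_setT ?mule1 ?ltry.
pose L m := (\int[P]_w (chi (Zn k.+1 m w) *
  Phi n c psi (post_at X E (gup m (T_of E k.+1 w)) k.+1 w))%:E)%E.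
have L1 : L m @[m --> \oo] --> (\int[P]_w (chi (disc_div k.+1 w) * Phi n c psi (post k.+1 w))%:E)%E.
  apply: bounded_cvg_integral.
  - move=> m; apply: measurable_funM; first exact: measurableT_comp mchi (measurable_Zn _ _).
    exact: measurableT_comp mPhi (measurable_post_grid _ _).
  - move=> m w; have /andP[a0 a1] := chi01 (Zn k.+1 m w).
    have /andP[b0 b1] := Phi01 (post_at X E (gup m (T_of E k.+1 w)) k.+1 w).
    by rewrite mulr_ge0// mulr_ile1.
  - move=> w; apply: cvgM.
      by apply: (@continuous_cvg _ _ _ _ _ _ chi); [exact: cchi|exact: cvg_Zn].
    apply: cvg_big => [|i _]; first exact: mul_continuous.
    by apply: (@continuous_cvg _ _ _ _ _ _ (psi i)); [exact: cpsi|exact: cvg_post_grid].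
have L2 : L m @[m --> \oo] --> ((\int[P]_w (chi (disc_div k.+1 w))%:E) * I0)%E.
  rewrite (_ : L = fun m => (\int[P]_w (chi (Zn k.+1 m w))%:E * I0)%E); last first.
    by apply/funext => m; rewrite /L /I0 p0E grid_markov.
  apply: cvgeZr => //; apply: bounded_cvg_integral => //.
  - by move=> m; exact: measurableT_comp mchi (measurable_Zn _ _).
  - by move=> w; apply: (@continuous_cvg _ _ _ _ _ _ chi); [exact: cchi|exact: cvg_Zn].
exact: (cvg_unique _ L1 L2).
Qed.

(** Continuous ramps decreasing, as [j] grows, to the indicator of [[b, +oo[]. *)
Let hat (b : R) (j : nat) (y : R) : R := Num.max 0 (Num.min 1 (1 + (y - b) * j%:R)).

Let hat01 b j y : 0 <= hat b j y <= 1.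
Proof. by rewrite /hat le_max lexx/= ge_max ler01/= ge_min lexx. Qed.

Let hat_continuous b j : continuous (hat b j).
Proof.
move=> y; apply: (@continuous_max R R (cst 0) (fun y => Num.min 1 (1 + (y - b) * j%:R))).
  exact: cst_continuous.
apply: (@continuous_min R R (cst 1) (fun y => 1 + (y - b) * j%:R)).
  exact: cst_continuous.
apply: cvgD; first exact: cvg_cst.
apply: cvgM; last exact: cvg_cst.
by apply: cvgB; [exact: cvg_id|exact: cvg_cst].
Qed.

Let hat_cvg b y : hat b j y @[j --> \oo] --> ((b <= y)%R%:R : R).
Proof.
have [yb|by_] := leP b y.
  rewrite (_ : (fun j => _) = fun=> 1); first exact: cvg_cst.
  apply/funext => j; rewrite /hat min_l ?max_r//.
  by rewrite lerDl mulr_ge0// subr_ge0.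
apply: cvg_near_cst; exists (Num.bound (b - y)^-1) => // j /= bj.
rewrite /hat max_l//; rewrite ge_min; apply/orP; right.
have h : (b - y)^-1 < j%:R.
  apply: (lt_le_trans (archi_boundP _)); first by rewrite invr_ge0 subr_ge0 ltW.
  by rewrite ler_nat.
rewrite -lerBrDl sub0r -opprB mulNr lerN2.
by rewrite -ler_pdivrMl ?subr_gt0// mulr1 ltW.
Qed.

(** The function [chi] of the dividend is left general for two uses: the constant 1 gives the law of
    the future, the indicator of a half-line gives its independence from the dividend. *)
Let markov_rays k n c (b : nat -> R) (chi_ : nat -> R -> R) (chi : R -> R) :
  (forall j, continuous (chi_ j)) -> (forall j y, 0 <= chi_ j y <= 1) ->
  (forall y, chi_ j y @[j --> \oo] --> chi y) -> (forall y, 0 <= chi y <= 1) ->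
  (\int[P]_w (chi (disc_div k.+1 w) * Phi n c (fun i y => (b i <= y)%R%:R) (post k.+1 w))%:E =
   (\int[P]_w (chi (disc_div k.+1 w))%:E) *
   \int[P]_w (Phi n c (fun i y => (b i <= y)%R%:R) (post 0 w))%:E)%E.
Proof.
move=> cchi chi_01 chiE chi01.
pose psi j i := hat (b i) j.
have cpsi j i : continuous (psi j i) by exact: hat_continuous.
have psi01 j i y : 0 <= psi j i y <= 1 by exact: hat01.
have mpsi j i : measurable_fun setT (psi j i) by exact: continuous_measurable_fun.
have mchi j : measurable_fun setT (chi_ j) by exact: continuous_measurable_fun.
have cvgPhi f : Phi n c (psi j) f @[j --> \oo] --> Phi n c (fun i y => (b i <= y)%R%:R) f.
  apply: cvg_big => [|i _]; first exact: mul_continuous.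
  exact: hat_cvg.
have L1 : (\int[P]_w (chi_ j (disc_div k.+1 w) * Phi n c (psi j) (post k.+1 w))%:E @[j --> \oo] -->
    \int[P]_w (chi (disc_div k.+1 w) * Phi n c (fun i y => (b i <= y)%R%:R) (post k.+1 w))%:E)%E.
  apply: bounded_cvg_integral.
  - move=> j; apply: measurable_funM; first exact: measurableT_comp (mchi j) (measurable_disc_div k).
    exact: measurableT_comp (measurable_Phi n c (mpsi j)) (measurable_post _).
  - move=> j w; have /andP[a0 a1] := chi_01 j (disc_div k.+1 w).
    have /andP[b0 b1] : 0 <= Phi n c (psi j) (post k.+1 w) <= 1 by exact: prod01.
    by rewrite mulr_ge0// mulr_ile1.
  - by move=> w; apply: cvgM; [exact: chiE|exact: cvgPhi].
have L2 : (\int[P]_w (chi_ j (disc_div k.+1 w))%:E @[j --> \oo] -->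
    \int[P]_w (chi (disc_div k.+1 w))%:E)%E.
  apply: bounded_cvg_integral => // j.
  exact: measurableT_comp (mchi j) (measurable_disc_div k).
have L3 : (\int[P]_w (Phi n c (psi j) (post 0 w))%:E @[j --> \oo] -->
    \int[P]_w (Phi n c (fun i y => (b i <= y)%R%:R) (post 0 w))%:E)%E.
  apply: bounded_cvg_integral => [j|j w|w]; [|exact: prod01|exact: cvgPhi].
  exact: measurableT_comp (measurable_Phi n c (mpsi j)) (measurable_post _).
have fin1 (F : Omega -> R) : measurable_fun setT F -> (forall w, 0 <= F w <= 1) ->
    (\int[P]_w (F w)%:E)%E \is a fin_num.
  move=> mF F01; rewrite ge0_fin_numE; last first.
    by apply: integral_ge0 => w _; rewrite lee_fin; case/andP: (F01 w).
  apply: (@le_lt_trans _ _ (\int[P]_w (cst 1) w)%E).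
    apply: ge0_le_integral => //.
    - by move=> w _; rewrite lee_fin; case/andP: (F01 w).
    - exact/measurable_EFinP.
    - by move=> w _; rewrite lee_fin; case/andP: (F01 w).
  by rewrite integral_cst//= ?mule1 ?probability_setT ?mule1 ?ltry.
pose L j := (\int[P]_w (chi_ j (disc_div k.+1 w) * Phi n c (psi j) (post k.+1 w))%:E)%E.
have LE : L = fun j => ((\int[P]_w (chi_ j (disc_div k.+1 w))%:E) *
    \int[P]_w (Phi n c (psi j) (post 0 w))%:E)%E.
  by apply/funext => j; exact: markov_cont.
move: L1; rewrite -/L -[X in X @ _]/L LE => L1.
apply: (cvg_unique _ L1) => //.
apply: (cvgeM _ L2 L3); apply: mule_def_fin; apply: fin1.
- apply: (measurable_fun_cvg (h := fun j w => chi_ j (disc_div k.+1 w))) => [j|w _].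
    exact: measurableT_comp (mchi j) (measurable_disc_div k).
  exact: chiE.
- by move=> w; exact: chi01.
- apply: (measurable_fun_cvg (h := fun j w => Phi n c (psi j) (post 0 w))) => [j|w _].
    exact: measurableT_comp (measurable_Phi n c (mpsi j)) (measurable_post _).
  exact: cvgPhi.
- by move=> w; apply: prod01 => i; rewrite ler0n lern1 leq_b1.
Qed.

Let rays : set (set R) := @RGenCInfty.G R.

Let Phi_indic n c (b : nat -> R) f :
  Phi n c (fun i y => (b i <= y)%R%:R) f =
  \1_(cylinder n c (fun i => `[b i, +oo[%classic) : set (pathT R (R + nat))) f.
Proof.
rewrite /Phi indicE; have [h|h] := boolP (f \in _).
  rewrite big1// => i _; move/set_mem: h => /(_ i (ltn_ord i)) /=.
  by rewrite in_itv/= andbT => ->.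
have [i bi] : exists i : 'I_n, ~~ (b i <= f (c i)).
  apply/existsP; rewrite -negb_forall; apply: contra h => /forallP h.
  by apply/mem_set => i ni; rewrite /= in_itv/= andbT; exact: (h (Ordinal ni)).
by rewrite (bigD1 i)//= (negbTE bi) mul0r.
Qed.

Let integral_preim d' (T' : measurableType d') (Y : Omega -> T') A :
  measurable_fun setT Y -> measurable A ->
  (\int[P]_w (\1_A (Y w))%:E = P (Y @^-1` A))%E.
Proof.
move=> mY mA; rewrite -[in RHS](setIT (Y @^-1` A)) -integral_indic//.
exact: preim_measurable.
Qed.

Let ray_cylinders : cylinders rays `<=` (fun A => exists n c b,
  A = cylinder n c (fun i => `[b i, +oo[%classic) :> set (pathT R (R + nat))).
Proof.
move=> _ [n [c [B [GB ->]]]]; have /choice[b Bb] := GB.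
by exists n, c, b; congr cylinder; apply/funext.
Qed.

Lemma post_law k C : measurable C -> P (post k.+1 @^-1` C) = P (post 0 @^-1` C).
Proof.
move=> mC; have m1 := measurable_post k.+1; have m2 := measurable_post 0.
suff : push_measure P m1 C = push_measure P m2 C by [].
have mrays := cylinders_gen (I := R + nat) (RGenCInfty.measurableE R).
apply: (@pi_eq_measures R _ (pathT R (R + nat)) (cylinders rays)) => //.
- exact: cylinders_setI.
- apply: cylinders_setT; first by exists `[0, +oo[%classic; exists 0.
  exact: (inhabits (inr 0%N)).
- by rewrite /= /pushforward preimage_setT probability_setT ltry.
move=> A rA; have mA : measurable (A : set (pathT R (R + nat))).
  by rewrite mrays; exact: sub_sigma_algebra.
move/ray_cylinders: rA mA => [n [c [b ->]]] mA.
rewrite /= /pushforward.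
rewrite -!integral_preim//; try exact: measurable_post.
under eq_integral do rewrite -Phi_indic.
under [RHS]eq_integral do rewrite -Phi_indic.
have c1 (j : nat) : continuous (cst 1 : R -> R) by exact: cst_continuous.
have h01 (y : R) : 0 <= (cst 1 y : R) <= 1 by rewrite /= ler01 lexx.
have H := markov_rays k n c b c1 (fun=> h01) (fun y => cvg_cst _) h01.
have H1 : (\int[P]_w ((cst 1 : R -> R) (disc_div k.+1 w))%:E = 1)%E.
  rewrite -[RHS](probability_setT P) -[RHS]mul1e -integral_cst//.
transitivity (\int[P]_w ((cst 1 : R -> R) (disc_div k.+1 w) *
    Phi n c (fun i y => (b i <= y)%R%:R) (post k.+1 w))%:E)%E.
  by apply: eq_integral => w _; rewrite /= mul1r.
by rewrite H H1 mul1e.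
Qed.

Lemma post_indep k : indep_maps P (disc_div k.+1) (post k.+1).
Proof.
have mrays := cylinders_gen (I := R + nat) (RGenCInfty.measurableE R).
have mD := measurable_disc_div k; have mp := measurable_post k.+1.
apply: (indep_maps_pi mD mp (RGenCInfty.measurableE R) _ mrays (@cylinders_setI _ _ _)).
  move=> _ _ [x ->] [y ->]; exists (Num.max x y).
  by apply/seteqP; split => z /=; rewrite !in_itv/= !andbT ge_max; [move=> [-> ->]|move=> /andP[]].
move=> _ A [b0 ->] rA; have mA : measurable (A : set (pathT R (R + nat))).
  by rewrite mrays; exact: sub_sigma_algebra.
rewrite (post_law _ mA).
move/ray_cylinders: rA mA => [n [c [b ->]]] mA.
have h01 (y : R) : 0 <= ((b0 <= y)%R%:R : R) <= 1 by rewrite ler0n lern1 leq_b1.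
have H := markov_rays k n c b (@hat_continuous b0) (hat01 b0) (@hat_cvg b0) h01.
have cb (y : R) : ((b0 <= y)%R%:R : R) = \1_(`[b0, +oo[%classic : set R) y.
  rewrite indicE (_ : (y \in _) = (b0 <= y))//.
  by apply/idP/idP => [/set_mem|h]; last apply/mem_set; rewrite /= in_itv/= andbT.
pose ray : set R := `[b0, +oo[%classic.
pose cyl : set (pathT R (R + nat)) := cylinder n c (fun i => `[b i, +oo[%classic).
rewrite -/ray -/cyl.
have mray : measurable ray by exact: measurable_itv.
have mcyl : measurable cyl by exact: mA.
transitivity (\int[P]_w ((b0 <= disc_div k.+1 w)%R%:R *
    Phi n c (fun i y => (b i <= y)%R%:R) (post k.+1 w))%:E)%E.
  have mI : measurable (disc_div k.+1 @^-1` ray `&` post k.+1 @^-1` cyl).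
    by apply: measurableI; exact: preim_measurable.
  rewrite -[X in P X]setIT -(integral_indic P measurableT mI).
  by apply: eq_integral => w _; rewrite Phi_indic cb indicI.
rewrite H -(integral_preim mD mray) -(integral_preim (measurable_post 0) mcyl).
congr (_ * _)%E; first by apply: eq_integral => w _; rewrite cb.
by apply: eq_integral => w _; rewrite Phi_indic.
Qed.

End markov.

Lemma cadlag_left_lim {R : realType} (f : R -> R) t : cadlag f -> 0 < t ->
  f @ t^'- --> left_lim f t.
Proof. by move=> [_ +] t0 => /(_ t t0)[l fl]; rewrite /left_lim (cvg_lim _ fl). Qed.

(** * Consequences of the Markov property: geometric discounting, locally finite arrivals, no jump
    at arrivals *)

Section markov_consequences.
Context {R : realType} {d : measure_display} {Omega : measurableType d}.
Variables (P : probability Omega R) (X : R -> Omega -> R) (E : nat -> Omega -> R).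
Hypothesis levyX : levy_process P X.
Hypothesis mE : forall k, measurable_fun setT (E k).
Hypothesis E_gt0 : forall k w, 0 < E k w.
Hypothesis E_law : forall k (B : set R), measurable B ->
  P (E k @^-1` B) = P (E 0%N @^-1` B).
Hypothesis E_indep : forall n, mutually_indep P n E.
Hypothesis XE : indep_sigma P (gen_X X) (gen_N E).

Lemma markov_integral q (rho : R -> Omega -> R) (Psi : pathT R (R + nat) -> \bar R) k :
  adapted X E rho -> (forall w, caglad (rho ^~ w)) ->
  (forall t w, 0 <= t -> 0 <= rho t w) ->
  measurable_fun setT Psi -> (forall f, (0 <= Psi f)%E) ->
  (\int[P]_w ((disc_div E q rho k.+1 w)%:E * Psi (post X E k.+1 w)) =
   (\int[P]_w (disc_div E q rho k.+1 w)%:E) * \int[P]_w Psi (post X E 0 w))%E.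
Proof.
move=> arho crho rho0 mPsi Psi0.
have mD := measurable_disc_div levyX mE E_gt0 q arho crho k.
have mp := measurable_post levyX mE E_gt0 k.+1.
have ind := post_indep levyX mE E_gt0 E_law E_indep XE q arho crho k.
have D0 w : 0 <= disc_div E q rho k.+1 w.
  by rewrite mulr_ge0 ?expR_ge0// rho0// ltW// T_of_gt0.
(* [indep_integral] wants a function that is nonnegative on all of [R]; the positive part agrees
   with the identity on dividends. *)
have mf : measurable_fun setT (fun y : R => (Num.max y 0)%:E).
  by apply/measurable_EFinP; exact: measurable_maxr.
have f0 (y : R) : (0 <= (Num.max y 0)%:E)%E by rewrite lee_fin le_max lexx orbT.
have := indep_integral mD mp ind mf mPsi f0 Psi0.
under eq_integral do rewrite (max_l (D0 _)).
under [in X in _ = X -> _]eq_integral do rewrite (max_l (D0 _)).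
move=> ->; congr (_ * _)%E.
have m0 := measurable_post levyX mE E_gt0 0.
transitivity (\int[push_measure P mp]_f Psi f)%E.
  by rewrite ge0_integral_pushforward.
transitivity (\int[push_measure P m0]_f Psi f)%E.
  apply: eq_measure_integral => A mA _.
  exact: (post_law levyX mE E_gt0 E_law E_indep XE q arho crho k).
by rewrite ge0_integral_pushforward.
Qed.

Lemma adapted_cst (c : R) : adapted X E (fun _ _ => c).
Proof.
move=> t t0 B mB; rewrite (_ : _ @^-1` B = if c \in B then setT else set0); last first.
  case: ifPn => [/set_mem cB|/negP cB]; apply/seteqP; split => // w /= cB'.
  by apply: cB; exact/mem_set.
case: ifPn => _.
  exact: (@measurableT _ (g_sigma_algebraType (gen_F X E t))).
exact: (@measurable0 _ (g_sigma_algebraType (gen_F X E t))).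
Qed.

Lemma caglad_cst (c : R) : caglad (fun=> c).
Proof. by split=> [t t0|t t0]; [exact: cvg_cst|exists c; exact: cvg_cst]. Qed.

Section discount.
Variable q : R.
Hypothesis q_gt0 : 0 < q.

Definition disc_ratio : \bar R := (\int[P]_w (expR (- q * E 0 w))%:E)%E.

Let mexp (f : Omega -> R) : measurable_fun setT f -> measurable_fun setT (fun w => (expR (- q * f w))%:E).
Proof.
move=> mf; apply/measurable_EFinP; apply: measurableT_comp => //.
exact: measurable_funM.
Qed.

Lemma disc_ratio_ge0 : (0 <= disc_ratio)%E.
Proof. by apply: integral_ge0 => w _; rewrite lee_fin expR_ge0. Qed.

Lemma disc_ratio_lt1 : (disc_ratio < 1)%E.
Proof.
rewrite lt_neqAle; apply/andP; split; last first.
  rewrite -[X in (_ <= X)%E](probability_setT P) -[X in (_ <= X)%E]mul1e -integral_cst//.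
  apply: ge0_le_integral => //.
  - exact: mexp.
  - by move=> w _; rewrite lee_fin /= -[leRHS]expR0 ler_expR mulNr oppr_le0 mulr_ge0 ?ltW.
(* With ratio 1, the nonnegative function [1 - expR (- q * E 0 w)] would have integral 0 and vanish
   almost everywhere, although it is positive everywhere. *)
apply/eqP => D1.
have int1 : P.-integrable setT (fun w => (expR (- q * E 0 w))%:E).
  apply/integrableP; split; first exact: mexp.
  under eq_integral do rewrite gee0_abs ?lee_fin ?expR_ge0//.
  by rewrite -/disc_ratio D1 ltry.
have : (\int[P]_w `|(1 - expR (- q * E 0 w))%:E| = 0)%E.
  transitivity (\int[P]_w ((cst 1) w - (expR (- q * E 0 w))%:E))%E.
    apply: eq_integral => w _; rewrite gee0_abs// lee_fin subr_ge0.
    by rewrite -[leRHS]expR0 ler_expR mulNr oppr_le0 mulr_ge0 ?ltW.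
  rewrite integralB//; last exact: finite_measure_integrable_cst.
  rewrite -/disc_ratio D1 integral_cst//= probability_setT mul1e.
  by rewrite subee.
have m1 : measurable_fun setT (fun w => (1 - expR (- q * E 0 w))%:E).
  apply/measurable_EFinP; apply: measurable_funB => //.
  exact/measurable_EFinP/mexp.
move=> /(ae_eq_integral_abs P measurableT m1) [N [mN N0 hN]].
have NT : N = setT.
  apply/seteqP; split => // w _; apply: hN => /= /(_ I) [] /eqP.
  rewrite subr_eq0 eq_sym => /eqP h.
  have : expR (- q * E 0 w) < 1 by rewrite -expR0 ltr_expR mulNr oppr_lt0 mulr_gt0.
  by rewrite h ltxx.
have := probability_setT P; rewrite -[setT]NT N0 => /eqP; by rewrite eq_sym onee_eq0.
Qed.

Lemma disc_ratioE : disc_ratio = (fine disc_ratio)%:E.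
Proof.
rewrite fineK// ge0_fin_numE ?disc_ratio_ge0//.
by rewrite (lt_le_trans disc_ratio_lt1)// leey.
Qed.

(** The Markov property for the constant dividend 1 and the next interarrival time splits off one
    factor. The exponents 0 and 1 are handled directly because that property starts at the first
    arrival. *)
Lemma integral_disc k :
  (\int[P]_w (expR (- q * T_of E k w))%:E = (fine disc_ratio ^+ k)%:E)%E.
Proof.
elim: k => [|[|k] ih].
- rewrite (eq_integral (cst 1%E)) ?integral_cst//= ?probability_setT ?mul1e//.
  by move=> w _; rewrite T_of0 mulr0 expR0.
- rewrite expr1 -disc_ratioE.
  by apply: eq_integral => w _; rewrite T_ofS T_of0 add0r.
pose Psi (f : pathT R (R + nat)) := (expR (- q * f (inr 0%N)))%:E.
have mPsi : measurable_fun setT Psi.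
  apply/measurable_EFinP; apply: measurableT_comp => //.
  apply: measurable_funM => //; exact: measurable_coord.
have Psi0 f : (0 <= Psi f)%E by rewrite lee_fin expR_ge0.
have H := @markov_integral q (fun _ _ => 1) Psi k (adapted_cst 1) (fun=> caglad_cst 1)
  (fun _ _ _ => ler01) mPsi Psi0.
transitivity (\int[P]_w ((disc_div E q (fun _ _ => 1) k.+1 w)%:E * Psi (post X E k.+1 w)))%E.
  apply: eq_integral => w _; rewrite /disc_div /Psi /post /= /tail_seq addn0 mulr1.
  by rewrite -EFinM -expRD -mulrDr -T_ofS.
rewrite H (_ : (\int[P]_w (disc_div _ _ _ _ w)%:E)%E = (\int[P]_w (expR (- q * T_of E k.+1 w))%:E)%E); last first.
  by apply: eq_integral => w _; rewrite /disc_div mulr1.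
rewrite ih (exprSr _ k.+1) EFinM; congr (_ * _)%E; rewrite -disc_ratioE.
by apply: eq_integral => w _; rewrite /Psi /post /= /tail_seq addn0.
Qed.

(** If all arrivals are at most [n], every discount factor is at least [e^{-qn}], while the expected
    discount factor at the k-th arrival decays geometrically. *)
Lemma T_of_unbounded : exists N : set Omega, [/\ measurable N, P N = 0%E &
  forall w, ~ N w -> forall t, exists k, t < T_of E k w].
Proof.
pose B n := [set w | forall k, T_of E k.+1 w <= n%:R].
have mB n : measurable (B n).
  rewrite (_ : B n = \bigcap_k [set w | T_of E k.+1 w <= n%:R]).
    apply: bigcapT_measurable => k; apply: measurable_ler_set => //.
    exact: measurable_T_of.
  by apply/seteqP; split => w h k => [_|]; exact: h.
have B0 n : P (B n) = 0%E.
  pose c := fine disc_ratio.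
  have c0 : 0 <= c by exact/fine_ge0/disc_ratio_ge0.
  have c1 : c < 1 by have := disc_ratio_lt1; rewrite disc_ratioE lte_fin.
  have h k : ((expR (- q * n%:R))%:E * P (B n) <= (c ^+ k.+1)%:E)%E.
    rewrite -integral_disc -integral_cst//.
    apply: (@le_trans _ _ (\int[P]_(w in B n) (expR (- q * T_of E k.+1 w))%:E)%E).
      apply: ge0_le_integral => //.
      - by move=> w _; rewrite lee_fin expR_ge0.
      - apply: measurable_funTS; apply: mexp; exact: measurable_T_of.
      - move=> w Bw; rewrite lee_fin /= ler_expR !mulNr lerN2 ler_wpM2l ?(ltW q_gt0)//.
    apply: ge0_subset_integral => //.
    - by apply: mexp; exact: measurable_T_of.
  have Bfin : P (B n) \is a fin_num by exact: fin_num_measure.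
  apply/eqP; rewrite eq_le measure_ge0 andbT.
  rewrite -(fineK Bfin) lee_fin -(ler_pM2l (expR_gt0 (- q * n%:R))) mulr0.
  have cvg0 : c ^+ k.+1 @[k --> \oo] --> (0 : R).
    have : c ^+ k @[k --> \oo] --> (0 : R) by apply: cvg_expr; rewrite ger0_norm.
    by rewrite -cvg_shiftS.
  have := cvgr_to_ge cvg0; apply.
  apply: nearW => k; have := h k; rewrite -{1}(fineK Bfin).
  by rewrite -EFinM lee_fin.
exists (\bigcup_n B n); split.
- exact: bigcupT_measurable.
- apply/(negligibleP P (bigcupT_measurable _ mB)).
  by apply: negligible_bigcup => n; apply/(negligibleP P (mB n)); exact: B0.
move=> w NB t; apply: contrapT => h; apply: NB; exists (Num.truncn t).+1 => // k.
rewrite leNgt; apply/negP => tT; apply: h; exists k.+1.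
have := truncnS_gt t.
by move=> /lt_trans; apply.
Qed.

End discount.

(* a Levy process has no fixed discontinuity, and T_k is independent of X *)
Lemma no_jump_at_T_of k : exists N : set Omega, [/\ measurable N, P N = 0%E &
  forall w, ~ N w -> left_lim (X ^~ w) (T_of E k.+1 w) = X (T_of E k.+1 w) w].
Proof.
have cX w : cadlag (X ^~ w) by case: levyX.
have mX := levy_measurable levyX.
pose T := T_of E k.+1.
have mT : measurable_fun setT T by exact: measurable_T_of.
have T0 w : 0 < T w by exact: T_of_gt0.
pose J w := X (T w) w - left_lim (X ^~ w) (T w).
(* Bounded and continuous, and zero only at 0: a vanishing integral of [phi (J w)] means that there
   is almost surely no jump. *)
pose phi (y : R) : R := Num.min 1 `|y|.
have phi01 y : 0 <= phi y <= 1 by rewrite /phi le_min ler01 normr_ge0 ge_min lexx.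
have cphi : continuous phi.
  move=> y; apply: (@continuous_min R R (cst 1) (fun y => `|y|)); first exact: cst_continuous.
  exact: norm_continuous.
have mphi : measurable_fun setT phi by exact: continuous_measurable_fun.
pose Jn n w := X (gup n (T w)) w - X (gdn n (T w)) w.
have mJn n : measurable_fun setT (Jn n).
  by apply: measurable_funB; [exact: measurable_at_gup|exact: measurable_at_gdn].
have cJ w : Jn n w @[n --> \oo] --> J w.
  apply: cvgB; first by apply: (cvg_gup_right (f := X ^~ w)); [exact: ltW|apply: (levy_right levyX); exact: ltW].
  by apply: (cvg_gdn_left (f := X ^~ w)) => //; exact: cadlag_left_lim.
have mJ : measurable_fun setT J by apply: (measurable_fun_cvg mJn) => w _; exact: cJ.
have L1 : (\int[P]_w (phi (Jn n w))%:E @[n --> \oo] --> \int[P]_w (phi (J w))%:E)%E.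
  apply: bounded_cvg_integral => //; first by move=> n; exact: measurableT_comp mphi (mJn n).
  by move=> w; apply: (@continuous_cvg _ _ _ _ _ _ phi); [exact: cphi|exact: cJ].
(* Given the cell of [T w], [Jn n] is the increment of [X] over a fixed interval of length
   [1/(n+1)], and that increment is independent of [T]; by stationarity its law does not depend on
   the cell. *)
have JnE n : (\int[P]_w (phi (Jn n w))%:E = \int[P]_w (phi (X (n.+1%:R^-1) w))%:E)%E.
  pose N w := gidx n (T w).
  have mN m : measurable [set w | N w = m] by apply: measurable_gidx.
  rewrite (@integral_partition _ _ _ P N)//; last 2 first.
  - by apply/measurable_EFinP; exact: measurableT_comp mphi (mJn n).
  - by move=> w; rewrite lee_fin; case/andP: (phi01 (Jn n w)).
  have hn : 0 <= n.+1%:R^-1 :> R by [].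
  pose I := (\int[P]_w (phi (X (n.+1%:R^-1) w))%:E)%E.
  have IE : I = (fine I)%:E.
    rewrite fineK// ge0_fin_numE; last first.
      by apply: integral_ge0 => w _; rewrite lee_fin; case/andP: (phi01 (X (n.+1%:R^-1) w)).
    apply: (@le_lt_trans _ _ (\int[P]_w (cst 1) w)%E).
      apply: ge0_le_integral => //.
      - by move=> w _; rewrite lee_fin; case/andP: (phi01 (X (n.+1%:R^-1) w)).
      - by apply/measurable_EFinP; exact: measurableT_comp mphi (mX _ hn).
      - by move=> w _; rewrite lee_fin; case/andP: (phi01 (X (n.+1%:R^-1) w)).
    by rewrite integral_cst//= ?mule1 ?probability_setT ?mule1 ?ltry.
  transitivity (\sum_(m <oo) (fine I)%:E * \int[P]_(w in [set w | N w = m]) cst 1 w)%E; last first.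
    rewrite nneseriesZl; last by move=> m _; exact: integral_ge0.
    rewrite -IE -(@integral_partition _ _ _ P N)// integral_cst//.
    by rewrite /= probability_setT !mule1.
  apply: eq_eseriesr => m _; rewrite -IE.
  pose s : R := gpt n m; pose t : R := gpt n m.+1.
  have s0 : 0 <= s by exact: gpt_ge0.
  have t0 : 0 <= t by exact: gpt_ge0.
  have st : 0 <= s <= t by rewrite s0 andTb /s /t gptS lerDl invr_ge0.
  pose D w := X t w - X s w.
  have mD : measurable_fun setT D by apply: measurable_funB; exact: mX.
  have ind : indep_maps P T D.
    move=> A B mA mB; rewrite setIC XE ?(muleC (P (D @^-1` B)))//.
      apply: (@preim_measurable _ (g_sigma_algebraType (gen_X X)) _ _ D B) => //.
      apply: measurable_funB => _ C mC; rewrite setTI; apply: sub_sigma_algebra.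
        by exists t => //; exists C.
      by exists s => //; exists C.
    apply: (@preim_measurable _ (g_sigma_algebraType (gen_N E)) _ _ T A) => //.
    apply: (measurability _ (RGenOInfty.measurableE R)) => //.
    move=> _ [_ [x ->] <-]; rewrite setTI.
    rewrite (_ : _ @^-1` _ = ~` ([set w | T w <= x] : set (g_sigma_algebraType (gen_N E)))); last first.
      apply/seteqP; split => w /=; rewrite in_itv/= andbT ltNge; first by move/negP.
      by move=> /negP.
    apply: measurableC; have [x0|x0] := leP 0 x.
      by apply: sub_sigma_algebra; exists k.+1; exists x.
    rewrite (_ : [set w | _] = set0)//; apply/seteqP; split => // w /=.
    by rewrite leNgt (lt_trans x0 (T0 w)).
  pose f (y : R) : \bar R := (\1_[set y : R | gidx n y = m] y)%:E.
  have mf : measurable_fun setT f.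
    by apply/measurable_EFinP; apply: measurable_indic; exact: (@measurable_gidx _ _ _ id).
  have f0 y : (0 <= f y)%E by rewrite lee_fin.
  have phi0 y : (0 <= (EFin \o phi) y)%E by rewrite lee_fin; case/andP: (phi01 y).
  have H := indep_integral mT mD ind mf ((measurable_EFinP _ _).2 mphi) f0 phi0.
  rewrite integral_mkcond.
  transitivity (\int[P]_w (f (T w) * (phi (D w))%:E))%E.
    apply: eq_integral => w _; rewrite patchE /f indicE; case: ifPn => [/set_mem/= Nw|Nw].
      rewrite mem_set// mul1e /Jn /D /gup /gdn.
      by have -> : gidx n (T w) = m by exact: Nw.
    by rewrite memNset ?mul0e// => h; move/negP: Nw; apply; exact/mem_set.
  rewrite [LHS]H muleC; congr (_ * _)%E.
    transitivity (\int[push_measure P mD]_y (phi y)%:E)%E.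
      rewrite ge0_integral_pushforward//; first exact/measurable_EFinP.
      by move=> y _; rewrite lee_fin; case/andP: (phi01 y).
    transitivity (\int[push_measure P (mX _ hn)]_y (phi y)%:E)%E.
      apply: eq_measure_integral => A mA _; rewrite /= /pushforward.
      case: levyX => _ _ _ stat _; rewrite (stat s t)//.
      by rewrite /s /t gptS addrAC subrr add0r.
    rewrite ge0_integral_pushforward//; [exact: mX|exact/measurable_EFinP|].
    by move=> y _; rewrite lee_fin; case/andP: (phi01 y).
  rewrite [RHS]integral_mkcond; apply: eq_integral => w _; rewrite patchE /f indicE.
  case: ifPn => [/set_mem/= Nw|Nw]; first by rewrite mem_set.
  by rewrite memNset// => h; move/negP: Nw; apply; exact/mem_set.
have L2 : (\int[P]_w (phi (Jn n w))%:E @[n --> \oo] --> (0 : \bar R))%E.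
  rewrite (_ : (fun n => _) = fun n => \int[P]_w (phi (X (n.+1%:R^-1) w))%:E)%E; last first.
    by apply/funext.
  rewrite [X in _ --> X](_ : _ = \int[P]_w (phi (X 0 w))%:E)%E; last first.
    rewrite integral0_eq// => w _; rewrite (levy0 levyX) /phi normr0 min_r//.
  apply: bounded_cvg_integral => //.
    by move=> n; exact: measurableT_comp mphi (mX _ _).
  move=> w; apply: (@continuous_cvg _ _ _ _ _ _ phi); first exact: cphi.
  apply: (cvg_right_ge (f := X ^~ w)) => //; first exact: (levy_right levyX).
  exact: cvg_harmonic.
have J0 : (\int[P]_w `|(phi (J w))%:E| = 0)%E.
  rewrite -(cvg_unique _ L1 L2)//; apply: eq_integral => w _; rewrite gee0_abs//.
  by rewrite lee_fin; case/andP: (phi01 (J w)).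
have mpJ : measurable_fun setT (fun w => (phi (J w))%:E).
  by apply/measurable_EFinP; exact: measurableT_comp mphi mJ.
have [N [mN N0 hN]] := (ae_eq_integral_abs P measurableT mpJ).1 J0.
exists N; split => // w Nw; apply: contrapT => h; apply: Nw; apply: hN => /= /(_ I)[].
rewrite /phi; have Jw : J w != 0.
  by rewrite subr_eq0; apply/eqP => /esym.
by case: leP => [_ /eqP|_ /eqP]; rewrite ?oner_eq0// normr_eq0 (negbTE Jw).
Qed.

(** The two properties of a path under which the blockwise description of the barrier strategy
    agrees with Skorokhod reflection at all times; everything after them is deterministic in [w]. *)
Definition good_path (w : Omega) := (forall t, exists k, t < T_of E k w) /\
  (forall k, left_lim (X ^~ w) (T_of E k.+1 w) = X (T_of E k.+1 w) w).

Lemma ae_good_path : exists N : set Omega, [/\ measurable N, P N = 0%E &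
  forall w, ~ N w -> good_path w].
Proof.
have [N1 [mN1 N10 hN1]] := T_of_unbounded ltr01.
have /choice[N2 hN2] := no_jump_at_T_of.
have mN2 k : measurable (N2 k) by case: (hN2 k).
have mU : measurable (N1 `|` \bigcup_k N2 k).
  by apply: measurableU => //; exact: bigcupT_measurable.
exists (N1 `|` \bigcup_k N2 k); split => //.
  apply/(negligibleP P mU); apply: negligibleU; first exact/(negligibleP P mN1).
  by apply: negligible_bigcup => k; apply/(negligibleP P (mN2 k)); case: (hN2 k).
move=> w Nw; split; first by apply: hN1 => h; apply: Nw; left.
by move=> k; case: (hN2 k) => _ _; apply => h; apply: Nw; right; exists k.
Qed.

End markov_consequences.

(** * Running suprema of cadlag functions *)

Section cadlag_functions.
Context {R : realType}.
Implicit Types (f g y : R -> R) (s t u l : R).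

Lemma at_right_epsP f t l : f @ t^'+ --> l <->
  forall e, 0 < e -> exists2 r, 0 < r & forall s, t < s -> s < t + r -> `|l - f s| < e.
Proof.
split=> [/cvgrPdist_lt ft e e0|h].
  have [r /= r0 fr] := ft e e0; exists r => // s ts str.
  by apply: fr => //=; rewrite ltr_distlC; apply/andP; split; lra.
apply/cvgrPdist_lt => e e0; have [r r0 hr] := h e e0.
exists r => //= s /=; rewrite ltr_distlC => /andP[_ str] ts; exact: hr.
Qed.

Lemma at_left_epsP f t l : f @ t^'- --> l <->
  forall e, 0 < e -> exists2 r, 0 < r & forall s, t - r < s -> s < t -> `|l - f s| < e.
Proof.
split=> [/cvgrPdist_lt ft e e0|h].
  have [r /= r0 fr] := ft e e0; exists r => // s ts str.
  by apply: fr => //=; rewrite ltr_distlC; apply/andP; split; lra.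
apply/cvgrPdist_lt => e e0; have [r r0 hr] := h e e0.
exists r => //= s /=; rewrite ltr_distlC => /andP[str _] ts; exact: hr.
Qed.

Lemma cadlagD f g : cadlag f -> cadlag g -> cadlag (fun t => f t + g t).
Proof.
move=> [f1 f2] [g1 g2]; split=> t t0; first by apply: cvgD; [exact: f1|exact: g1].
have [l fl] := f2 t t0; have [m gm] := g2 t t0.
by exists (l + m); exact: cvgD.
Qed.

Lemma cadlagN f : cadlag f -> cadlag (fun t => - f t).
Proof.
move=> [f1 f2]; split=> t t0; first by apply: cvgN; exact: f1.
by have [l fl] := f2 t t0; exists (- l); exact: cvgN.
Qed.

Lemma cadlagB f g : cadlag f -> cadlag g -> cadlag (fun t => f t - g t).
Proof. by move=> cf /cadlagN; exact: cadlagD. Qed.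

Lemma cadlag_cst (c : R) : cadlag (fun=> c).
Proof. by split=> t t0; [exact: cvg_cst|exists c; exact: cvg_cst]. Qed.

Lemma cadlag_step (u c : R) : cadlag (fun t => if u <= t then c else 0).
Proof.
split=> t t0.
  apply/at_right_epsP => e e0; have [ut|tu] := leP u t.
    exists 1 => // s ts _; rewrite ifT ?subrr ?normr0// (le_trans ut)//; exact: ltW.
  by exists (u - t) => [|s ts]; rewrite ?subr_gt0// addrC subrK => su; rewrite leNgt su/= subrr normr0.
have [ut|tu] := ltP u t.
  exists c; apply/at_left_epsP => e e0; exists (t - u); first by rewrite subr_gt0.
  by move=> s; rewrite opprB addrC subrK => us _; rewrite (ltW us) subrr normr0.
exists 0; apply/at_left_epsP => e e0; exists 1 => // s _ st.
by rewrite leNgt (lt_le_trans st tu)/= subrr normr0.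
Qed.

(** Let [c] be the supremum of the times up to which [f] is bounded. The left limit at [c] shows
    that [f] is bounded up to [c] included, and right-continuity at [c] pushes beyond [c] unless
    [c = t]. *)
Lemma cadlag_bounded f t : cadlag f ->
  exists M, forall s, 0 <= s -> s <= t -> `|f s| <= M.
Proof.
move=> [f1 f2]; have [t0|t0] := leP 0 t; last first.
  by exists 0 => s s0 st; have := le_lt_trans (le_trans s0 st) t0; rewrite ltxx.
pose B u := exists M, forall s, 0 <= s -> s <= u -> `|f s| <= M.
pose S := [set u | 0 <= u <= t /\ B u].
have S0 : S 0.
  split; first by rewrite lexx.
  by exists `|f 0| => s s0 s0'; rewrite (_ : s = 0)//; apply/eqP; rewrite eq_le s0 s0'.
have Sub : has_sup S.
  by split; [exists 0|exists t => u [/andP[_ ut] _]].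
pose c := sup S.
have c0 : 0 <= c by exact: sup_upper_bound.
have ct : c <= t by apply: ge_sup; [exists 0|move=> u; case=> /andP[]].
have Bc : B c.
  have [cE|cn0] := eqVneq c 0; first by rewrite cE; case: S0.
  have cp : 0 < c by rewrite lt_neqAle eq_sym cn0.
  have [l /at_left_epsP/(_ 1 ltr01)[r r0 hr]] := f2 c cp.
  have [u [u01 [M hM]] cu] := sup_adherent r0 Sub.
  exists (Num.max M (Num.max (`|l| + 1) `|f c|)) => s s0 sc.
  have [su|us] := leP s u; first by rewrite le_max hM.
  have [<-|snc] := eqVneq s c; first by rewrite !le_max lexx !orbT.
  have slt : s < c by rewrite lt_neqAle snc.
  have := hr s (lt_trans cu us) slt => h.
  rewrite !le_max; apply/orP; right; apply/orP; left.
  rewrite -[f s](subrK l) (le_trans (ler_normD _ _))// addrC lerD2l.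
  by rewrite distrC ltW.
have [->|cnt] := eqVneq t c; first exact: Bc.
have clt : c < t by rewrite lt_neqAle eq_sym cnt.
have /at_right_epsP/(_ 1 ltr01)[r r0 hr] := f1 c c0.
have [M hM] := Bc.
pose v := Num.min t (c + r / 2).
have vt : v <= t by rewrite /v ge_min lexx.
have vr : v <= c + r / 2 by rewrite /v ge_min lexx orbT.
have cv : c < v by rewrite /v lt_min clt/=; lra.
have Sv : S v.
  split; first by rewrite vt andbT (le_trans c0)// ltW.
  exists (Num.max M (`|f c| + 1)) => s s0 sv.
  have [sc|cs] := leP s c; first by rewrite le_max hM.
  rewrite le_max; apply/orP; right.
  rewrite -[f s](subrK (f c)) (le_trans (ler_normD _ _))// addrC lerD2l distrC ltW//.
  by apply: hr => //; lra.
by have := sup_upper_bound Sub Sv; rewrite leNgt cv.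
Qed.

(** The positive part is taken inside the supremum, and for negative [t] the set is empty with [sup]
    equal to 0. The result is therefore monotone on the whole line and 0 before time 0, as a
    Stieltjes integrator must be. *)
Definition rsup y t : R := sup [set Num.max 0 (y s) | s in [set s | 0 <= s <= t]].

Lemma rsup_neg y t : t < 0 -> rsup y t = 0.
Proof.
move=> t0; rewrite /rsup (_ : [set _ | _ in _] = set0) ?sup0//.
apply/seteqP; split => // u [s /andP[s0 st] _].
by have := le_lt_trans (le_trans s0 st) t0; rewrite ltxx.
Qed.

Lemma rsup_has_sup y t : cadlag y -> 0 <= t ->
  has_sup [set Num.max 0 (y s) | s in [set s | 0 <= s <= t]].
Proof.
move=> cy t0; split; first by exists (Num.max 0 (y 0)); exists 0 => //=; rewrite lexx.
have [M hM] := cadlag_bounded t cy.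
exists (Num.max 0 M) => _ [s /andP[s0 st] <-].
rewrite ge_max le_max lexx/= le_max; apply/orP; right.
by rewrite (le_trans (ler_norm _))// hM.
Qed.

Lemma le_rsup_max y t s : cadlag y -> 0 <= s -> s <= t -> Num.max 0 (y s) <= rsup y t.
Proof.
move=> cy s0 st; apply: (sup_upper_bound (rsup_has_sup cy (le_trans s0 st))).
by exists s => //=; rewrite s0.
Qed.

Lemma le_rsup y t s : cadlag y -> 0 <= s -> s <= t -> y s <= rsup y t.
Proof. by move=> cy s0 st; apply: le_trans (le_rsup_max cy s0 st); rewrite le_max lexx orbT. Qed.

Lemma rsup_ge0 y t : cadlag y -> 0 <= rsup y t.
Proof.
move=> cy; have [t0|t0] := leP 0 t; last by rewrite rsup_neg.
by apply: le_trans (le_rsup_max cy (lexx 0) t0); rewrite le_max lexx.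
Qed.

Lemma rsup_le y t c : 0 <= c -> (forall s, 0 <= s -> s <= t -> y s <= c) -> rsup y t <= c.
Proof.
move=> c0 h; have [t0|t0] := leP 0 t; last by rewrite rsup_neg.
apply: ge_sup; first by exists (Num.max 0 (y 0)); exists 0 => //=; rewrite lexx.
by move=> _ [s /andP[s0 st] <-]; rewrite ge_max c0 h.
Qed.

Lemma rsup_homo y : cadlag y -> {homo rsup y : s t / s <= t}.
Proof.
move=> cy s t st; apply: rsup_le; first exact: rsup_ge0.
by move=> u u0 us; apply: le_rsup => //; exact: le_trans st.
Qed.

Lemma rsup_adherent y t c : c < rsup y t -> 0 <= c -> exists s, [/\ 0 <= s, s <= t & c < y s].
Proof.
move=> ct c0; apply: contrapT => h; move: ct; rewrite ltNge => /negP; apply.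
apply: rsup_le => // s s0 st; rewrite leNgt; apply/negP => cs; apply: h; by exists s.
Qed.

Lemma rsup_right_continuous y : cadlag y -> right_continuous (rsup y).
Proof.
move=> cy t; apply/at_right_epsP => e e0; have [t0|t0] := leP 0 t; last first.
  exists (- t); first by rewrite oppr_gt0.
  by move=> s _; rewrite subrr => s0; rewrite !rsup_neg// subrr normr0.
have /at_right_epsP/(_ (e / 2))[|r r0 hr] := cy.1 t t0; first by rewrite divr_gt0.
exists r => // s ts str.
rewrite distrC ger0_norm ?subr_ge0; last by apply: rsup_homo => //; exact: ltW.
suff : rsup y s <= rsup y t + e / 2 by move=> h; lra.
apply: rsup_le; first by rewrite addr_ge0 ?rsup_ge0// divr_ge0// ltW.
move=> u u0 us; have [ut|tu] := leP u t.
  by rewrite ler_wpDr ?divr_ge0 ?(ltW e0)//; exact: le_rsup.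
have := hr u tu (le_lt_trans us str); rewrite ltr_distlC => /andP[_ h].
have := le_rsup cy t0 (lexx t) => h2; lra.
Qed.

Lemma rsup_cadlag y : cadlag y -> cadlag (rsup y).
Proof.
move=> cy; split=> t t0; first exact: rsup_right_continuous.
exists (lim (rsup y @ t^'-)); apply: nondecreasing_at_left_is_cvgr.
  by apply: nearW => x u v _ _ uv; exact: rsup_homo.
apply: nearW => x; exists (rsup y t) => z [u /=]; rewrite in_itv/= => /andP[_ ut] <-.
by apply: rsup_homo => //; exact: ltW.
Qed.

Lemma eq_rsup y z t : (forall s, 0 <= s -> s <= t -> y s = z s) -> rsup y t = rsup z t.
Proof.
move=> h; rewrite /rsup; congr sup; apply/seteqP.
by split=> _ [s /= /andP[s0 st] <-]; exists s; rewrite /= ?s0 ?st ?h.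
Qed.

Lemma left_lim_unique f t l : f @ t^'- --> l -> left_lim f t = l.
Proof. by move=> h; rewrite /left_lim (cvg_lim _ h). Qed.

Lemma eq_left_lim f g t : (exists2 r, 0 < r & forall s, t - r < s -> s < t -> f s = g s) ->
  (exists l, g @ t^'- --> l) -> left_lim f t = left_lim g t.
Proof.
move=> [r r0 fg] [l gl]; rewrite (left_lim_unique gl); apply: left_lim_unique.
apply/at_left_epsP => e e0; have /at_left_epsP/(_ e e0)[r' r'0 h] := gl.
exists (Num.min r r'); first by rewrite lt_min r0.
move=> s ts st; have := ge_min r r r'; have := ge_min r' r r'; rewrite !lexx orbT/= => h1 h2.
by rewrite fg//; [apply: h => //; lra|lra].
Qed.

Lemma left_limB f g t : (exists l, f @ t^'- --> l) -> (exists l, g @ t^'- --> l) ->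
  left_lim (fun s => f s - g s) t = left_lim f t - left_lim g t.
Proof.
move=> [l fl] [m gm]; rewrite (left_lim_unique fl) (left_lim_unique gm).
by apply: left_lim_unique; exact: cvgB.
Qed.

Lemma left_lim_caglad f : cadlag f -> caglad (left_lim f).
Proof.
move=> cf; split=> t t0.
  apply/at_left_epsP => e e0.
  have /at_left_epsP/(_ (e/2))[|r r0 hr] := cadlag_left_lim cf t0; first by rewrite divr_gt0.
  exists (Num.min r t); first by rewrite lt_min r0.
  move=> s ts st; have := ge_min r r t; have := ge_min t r t; rewrite !lexx orbT/= => h1 h2.
  have s0 : 0 < s by lra.
  have /at_left_epsP/(_ (e/2))[|r' r'0 hr'] := cadlag_left_lim cf s0; first by rewrite divr_gt0.
  (* A point just before [s], close enough for [f u] to approximate the left limit at [s], and still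
     within [r] of [t]. *)
  pose u := Num.max (s - r' / 2) ((t - r + s) / 2).
  have u1 : s - r' / 2 <= u by rewrite /u le_max lexx.
  have u2 : (t - r + s) / 2 <= u by rewrite /u le_max lexx orbT.
  have us : u < s by rewrite /u gt_max; apply/andP; split; lra.
  have : `|left_lim f t - f u| < e / 2 by apply: hr; lra.
  have : `|left_lim f s - f u| < e / 2 by apply: hr' => //; lra.
  by rewrite !ltr_distl => /andP[h3 h4] /andP[h5 h6]; apply/andP; split; lra.
exists (f t); apply/at_right_epsP => e e0.
have /at_right_epsP/(_ (e/2))[|r r0 hr] := cf.1 t t0; first by rewrite divr_gt0.
exists r => // s ts str; have s0 : 0 < s by exact: le_lt_trans ts.
have /at_left_epsP/(_ (e/2))[|r' r'0 hr'] := cadlag_left_lim cf s0; first by rewrite divr_gt0.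
pose u := Num.max (s - r' / 2) ((t + s) / 2).
have u1 : s - r' / 2 <= u by rewrite /u le_max lexx.
have u2 : (t + s) / 2 <= u by rewrite /u le_max lexx orbT.
have us : u < s by rewrite /u gt_max; apply/andP; split; lra.
have : `|f t - f u| < e / 2 by apply: hr; lra.
have : `|left_lim f s - f u| < e / 2 by apply: hr' => //; lra.
by rewrite !ltr_distl => /andP[h3 h4] /andP[h5 h6]; apply/andP; split; lra.
Qed.

End cadlag_functions.

(** * The barrier strategy as iterated Skorokhod reflection *)

Section skorokhod.
Context {R : realType}.
Variables (a x : R) (f : R -> R) (T : nat -> R).

(** The deficit before injections. Its running positive supremum [skR] is the least injection that
    keeps the surplus [skU] nonnegative. *)
Definition skY (L : R -> R) (t : R) : R := L t - x - f t.
Definition skR L t := rsup (skY L) t.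
Definition skU L t := skR L t - skY L t.
Definition skD L k := Num.max 0 (left_lim (skU L) (T k.+1) - a).

(* The dividend process of the barrier strategy stopped after [k] payments, with
   [skR] the minimal injection that goes with it. Unlike [pcb_inj], these are
   monotone and right-continuous for every path; the two descriptions agree on
   paths that do not jump at the dates [T k]. *)
Fixpoint skL (k : nat) : R -> R :=
  match k with
  | 0 => fun=> 0
  | k'.+1 => fun t => skL k' t + (if T k'.+1 <= t then skD (skL k') k' else 0)
  end.

Definition skdiv k := skD (skL k) k.

Lemma skdiv_ge0 k : 0 <= skdiv k.
Proof. by rewrite /skdiv /skD le_max lexx. Qed.

Lemma skLE k t : skL k t = \sum_(j < k) (if T j.+1 <= t then skdiv j else 0).
Proof. by elim: k => [|k ih]; [rewrite big_ord0|rewrite big_ord_recr/= -ih]. Qed.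

Hypothesis cf : cadlag f.

Lemma cadlag_skL k : cadlag (skL k).
Proof.
elim: k => [|k ih]; first exact: cadlag_cst.
by apply: cadlagD => //; exact: cadlag_step.
Qed.

Lemma cadlag_skY k : cadlag (skY (skL k)).
Proof.
apply: cadlagB => //; apply: cadlagB; [exact: cadlag_skL|exact: cadlag_cst].
Qed.

Lemma cadlag_skR k : cadlag (skR (skL k)).
Proof. exact/rsup_cadlag/cadlag_skY. Qed.

Lemma cadlag_skU k : cadlag (skU (skL k)).
Proof. by apply: cadlagB; [exact: cadlag_skR|exact: cadlag_skY]. Qed.

Lemma skU_ge0 k t : 0 <= t -> 0 <= skU (skL k) t.
Proof. by move=> t0; rewrite subr_ge0; apply: le_rsup => //; exact: cadlag_skY. Qed.

Hypotheses (a0 : 0 <= a) (x0 : 0 <= x) (f0 : f 0 = 0) (T0 : T 0%N = 0).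
Hypothesis ltT : forall k, T k < T k.+1.

Lemma leT k j : (k <= j)%N -> T k <= T j.
Proof.
move=> /subnKC <-; elim: (j - k)%N => [|n ih]; first by rewrite addn0.
by rewrite addnS (le_trans ih)// ltW.
Qed.

Lemma ltT_lt k j : T k < T j -> (k < j)%N.
Proof. by move=> h; rewrite ltnNge; apply/negP => /leT; rewrite leNgt h. Qed.

Lemma T_ge0 k : 0 <= T k. Proof. by rewrite -T0; exact: leT. Qed.

Lemma skL_before n k t : (k <= n)%N -> t < T k.+1 -> skL n t = skL k t.
Proof.
move=> /subnKC <-; elim: (n - k)%N => [|m ih] tT; first by rewrite addn0.
rewrite addnS /= ih// leNgt (lt_le_trans tT)/= ?addr0//.
by apply: leT; rewrite ltnS leq_addr.
Qed.

Lemma skL_after k t : T k <= t -> skL k t = \sum_(j < k) skdiv j.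
Proof.
move=> kt; rewrite skLE; apply: eq_bigr => j _; rewrite ifT//.
by apply: le_trans kt; apply: leT.
Qed.

Lemma skR_before n k t : (k <= n)%N -> t < T k.+1 -> skR (skL n) t = skR (skL k) t.
Proof.
move=> kn tT; apply: eq_rsup => s s0 st; rewrite /skY (skL_before kn)//.
exact: le_lt_trans tT.
Qed.

Lemma skL_homo n k t : (k <= n)%N -> skL k t <= skL n t.
Proof.
move=> /subnKC <-; elim: (n - k)%N => [|m ih]; first by rewrite addn0.
by rewrite addnS (le_trans ih)//= lerDl; case: ifP => // _; exact: skdiv_ge0.
Qed.

Lemma skR_homo n k t : (k <= n)%N -> skR (skL k) t <= skR (skL n) t.
Proof.
move=> kn; apply: rsup_le; first exact/rsup_ge0/cadlag_skY.
move=> s s0 st; apply: le_trans (le_rsup (cadlag_skY n) s0 st).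
by rewrite /skY !lerD2r; exact: skL_homo.
Qed.

Definition Rk k := skR (skL k) (T k).
Definition Uk k := skU (skL k) (T k).

Let Z k s := - (Uk k + f s - f (T k)).

Let ZE k s : T k <= s -> Z k s = skY (skL k) s - Rk k.
Proof.
move=> ks; rewrite /Z /Uk /skU -/(Rk k) /skY !skL_after//; lra.
Qed.

(** The running supremum restarted at [T k]: relative to the surplus [Uk k], only the later excess
    matters. This is the form in which [pcb_inj] describes injections. *)
Lemma block_skR k t : T k <= t -> skR (skL k) t =
  Rk k + Num.max 0 (sup [set - (Uk k + f s - f (T k)) | s in [set s | T k <= s <= t]]).
Proof.
move=> kt; have cY := cadlag_skY k; set S := [set _ | _ in _].
have S0 : S !=set0 by exists (Z k (T k)), (T k) => //=; rewrite lexx.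
have Sub : ubound S (skR (skL k) t - Rk k).
  move=> _ [s /= /andP[ks st] <-]; rewrite -/(Z k s) ZE// lerD2r.
  by apply: le_rsup => //; exact: le_trans (T_ge0 k) ks.
have hS : has_sup S by split => //; exists (skR (skL k) t - Rk k).
apply/eqP; rewrite eq_le; apply/andP; split; last first.
  rewrite -lerBrDl ge_max subr_ge0 (ge_sup S0 Sub) andbT.
  exact: (rsup_homo cY).
apply: rsup_le; first by rewrite addr_ge0 ?rsup_ge0// le_max lexx.
move=> s s0 st; have [sk|ks] := leP s (T k).
  by apply: (le_trans (le_rsup cY s0 sk)); rewrite lerDl le_max lexx.
rewrite -lerBlDl -(ZE (ltW ks)) le_max; apply/orP; right.
by apply: sup_upper_bound => //; exists s => //=; rewrite (ltW ks) st.
Qed.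

Let ml k := pcb_ml (Uk k) f T k.

Let ml_set k := [set - (Uk k + f s - f (T k)) | s in [set s | T k <= s < T k.+1]].

Let ml_has_sup k : has_sup (ml_set k).
Proof.
split; first by exists (Z k (T k)), (T k) => //=; rewrite lexx ltT.
exists (skR (skL k) (T k.+1) - Rk k) => _ [s /= /andP[ks st] <-].
rewrite -/(Z k s) ZE// lerD2r; apply: le_rsup (cadlag_skY k) _ (ltW st).
exact: le_trans (T_ge0 k) ks.
Qed.

Let ml_ub k s : T k <= s -> s < T k.+1 -> skY (skL k) s <= Rk k + ml k.
Proof.
move=> ks st; rewrite -lerBlDl -ZE// /ml /pcb_ml le_max; apply/orP; right.
by apply: (sup_upper_bound (ml_has_sup k)); exists s => //=; rewrite ks.
Qed.

Let ml_ge0 k : 0 <= ml k. Proof. by rewrite /ml /pcb_ml le_max lexx. Qed.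

Let ml_adh k c : 0 <= c -> c < ml k -> exists s, [/\ T k <= s, s < T k.+1 & Rk k + c < skY (skL k) s].
Proof.
rewrite /ml /pcb_ml lt_max => c0; rewrite ltNge c0/= => h.
have e0 : 0 < sup (ml_set k) - c by rewrite subr_gt0.
have [_ [s /= /andP[ks st] <-]] := sup_adherent e0 (ml_has_sup k).
rewrite -/(Z k s) ZE// => h2; exists s; split => //; lra.
Qed.

(** [pcb_ml] takes its supremum over the half-open block, which excludes the date itself; this
    corresponds to the left limit of the running supremum. *)
Lemma left_skR k : left_lim (skR (skL k)) (T k.+1) = Rk k + ml k.
Proof.
apply: left_lim_unique; apply/at_left_epsP => e e0.
have le_ub s : T k <= s -> s < T k.+1 -> skR (skL k) s <= Rk k + ml k.
  move=> ks sT; apply: rsup_le; first by rewrite addr_ge0 ?ml_ge0 ?rsup_ge0//; exact: cadlag_skY.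
  move=> u u0 us; have [uk|ku] := leP u (T k).
    by apply: (le_trans (le_rsup (cadlag_skY k) u0 uk)); rewrite lerDl ml_ge0.
  by apply: ml_ub; [exact: ltW|exact: le_lt_trans sT].
have [mle|eml] := leP (ml k) (e / 2).
  exists (T k.+1 - T k); first by rewrite subr_gt0.
  move=> s; rewrite opprB addrC subrK => ks sT.
  have h1 := le_ub s (ltW ks) sT.
  have h2 : Rk k <= skR (skL k) s by apply: (rsup_homo (cadlag_skY k)); exact: ltW.
  by rewrite ger0_norm; lra.
have [||u [ku uT hu]] := @ml_adh k (ml k - e / 2); [lra|lra|].
exists (T k.+1 - u); first by rewrite subr_gt0.
move=> s; rewrite opprB addrC subrK => us sT.
have h1 := le_ub s (le_trans ku (ltW us)) sT.
have u0 : 0 <= u by exact: le_trans (T_ge0 k) ku.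
have h2 := le_rsup (cadlag_skY k) u0 (ltW us).
have h3 : skY (skL k) u <= skR (skL k) s by exact: h2.
by rewrite ger0_norm; lra.
Qed.

Lemma left_skU k : left_lim (skU (skL k)) (T k.+1) = pcb_um (Uk k) f T k.
Proof.
have Tp : 0 < T k.+1 by exact: le_lt_trans (T_ge0 k) (ltT k).
have cY := (cadlag_skY k).2 _ Tp; have cR := (cadlag_skR k).2 _ Tp.
rewrite /skU left_limB// left_skR.
have -> : left_lim (skY (skL k)) (T k.+1) =
    left_lim (fun t => (\sum_(j < k) skdiv j - x) - f t) (T k.+1).
  apply: eq_left_lim.
    exists (T k.+1 - T k); first by rewrite subr_gt0.
    move=> s; rewrite opprB addrC subrK => ks sT.
    by rewrite /skY skL_after// ltW.
  by have [l fl] := cf.2 _ Tp; exists ((\sum_(j < k) skdiv j - x) - l);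
    apply: cvgB => //; exact: cvg_cst.
rewrite (@left_limB _ (fun=> \sum_(j < k) skdiv j - x) f); last 2 first.
- by exists (\sum_(j < k) skdiv j - x); exact: cvg_cst.
- exact: cf.2.
rewrite (@left_lim_unique _ (fun=> \sum_(j < k) skdiv j - x) _ (\sum_(j < k) skdiv j - x)); last exact: cvg_cst.
rewrite /pcb_um -/(ml k) /Uk /skU -/(Rk k) /skY skL_after//; lra.
Qed.

Lemma skdivE k : skdiv k = Num.max 0 (pcb_um (Uk k) f T k - a).
Proof. by rewrite /skdiv /skD left_skU. Qed.

Lemma um_ge0 k : 0 <= pcb_um (Uk k) f T k.
Proof.
rewrite -left_skU; have Tp : 0 < T k.+1 by exact: le_lt_trans (T_ge0 k) (ltT k).
have := cadlag_left_lim (cadlag_skU k) Tp => /at_left_epsP h.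
apply/ler_addgt0Pr => e e0; rewrite -lerBlDr sub0r.
have [r r0 hr] := h e e0; pose s := Num.max (T k.+1 - r / 2) 0.
have sT : s < T k.+1 by rewrite /s gt_max Tp andbT; lra.
have s0 : 0 <= s by rewrite /s le_max lexx orbT.
have rs : T k.+1 - r / 2 <= s by rewrite /s le_max lexx.
have := skU_ge0 k s0; have rs' : T k.+1 - r < s by lra.
have := hr s rs' sT; rewrite ltr_distl => /andP[h1 h2] h3; lra.
Qed.

Lemma RU0 : Rk 0 = 0 /\ Uk 0 = x.
Proof.
have R0 : Rk 0 = 0.
  apply/eqP; rewrite eq_le /Rk T0 rsup_ge0 ?andbT; last exact: cadlag_skY.
  apply: rsup_le => // s s0 s0'; have -> : s = 0 by apply/eqP; rewrite eq_le s0' s0.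
  rewrite /skY /= f0 !subr0 sub0r. by rewrite oppr_le0.
by split => //; rewrite /Uk /skU -/(Rk 0) R0 /skY /= T0 f0; lra.
Qed.

Hypothesis nojump : forall k, left_lim f (T k.+1) = f (T k.+1).

(** As [f] does not jump at [T k.+1], the surplus there before payment is its left limit. The
    payment brings it down to the minimum with [a], which is nonnegative, so no injection happens at
    the date itself. *)
Lemma RUS k : Rk k.+1 = Rk k + pcb_ml (Uk k) f T k /\
  Uk k.+1 = Num.min (pcb_um (Uk k) f T k) a.
Proof.
rewrite -/(ml k).
have YT : skY (skL k.+1) (T k.+1) = Rk k + ml k - Num.min (pcb_um (Uk k) f T k) a.
  have -> : Num.min (pcb_um (Uk k) f T k) a = pcb_um (Uk k) f T k - skdiv k.
    by rewrite skdivE /Num.min /Num.max; case: ifPn; case: ifPn; lra.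
  rewrite /skY /= lexx -/(skdiv k) skL_after; last exact/ltW.
  by rewrite /pcb_um -/(ml k) nojump /Uk /skU -/(Rk k) /skY skL_after//; lra.
have min0 : 0 <= Num.min (pcb_um (Uk k) f T k) a by rewrite le_min um_ge0 a0.
have R1 : Rk k.+1 = Rk k + ml k.
  apply/eqP; rewrite eq_le; apply/andP; split.
    apply: rsup_le; first by rewrite addr_ge0 ?ml_ge0 ?rsup_ge0//; exact: cadlag_skY.
    move=> s s0; rewrite le_eqVlt => /orP[/eqP->|sT]; first by rewrite YT; lra.
    rewrite /skY (@skL_before k.+1 k)// -/(skY (skL k) s).
    have [sk|ks] := leP s (T k); last by apply: ml_ub => //; exact: ltW.
    by apply: (le_trans (le_rsup (cadlag_skY k) s0 sk)); rewrite lerDl ml_ge0.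
  have RkS : Rk k <= Rk k.+1.
    apply: (@le_trans _ _ (skR (skL k) (T k.+1))).
      by apply: (rsup_homo (cadlag_skY k)); exact: ltW.
    exact: skR_homo.
  rewrite leNgt; apply/negP => h.
  have [||s [ks sT hs]] := @ml_adh k (Rk k.+1 - Rk k); [lra|lra|].
  have : skY (skL k.+1) s <= Rk k.+1.
    apply: (le_rsup (cadlag_skY k.+1)); last exact: ltW.
    exact: le_trans (T_ge0 k) ks.
  rewrite /skY (@skL_before k.+1 k)// -/(skY (skL k) s); lra.
by split => //; rewrite /Uk /skU -/(Rk k.+1) R1 YT; lra.
Qed.

Lemma pcb_stateE k : pcb_state a x f T k = (Uk k, Rk k).
Proof.
elim: k => [|k ih]; first by have [-> ->] := RU0.
by rewrite /= ih /=; have [-> ->] := RUS k.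
Qed.

Lemma pcb_divE k : pcb_div a x f T k = skdiv k.
Proof. by rewrite /pcb_div pcb_stateE skdivE. Qed.

Lemma pcb_injE n t : T n <= t -> t < T n.+1 -> pcb_inj a x f T t = skR (skL n) t.
Proof.
move=> nt tn; rewrite /pcb_inj; case: pselect => [h|]; last by case; exists n; rewrite nt.
set k := xget _ _; have /andP[kt tk] : T k <= t < T k.+1.
  by apply: (@xgetPex _ 0%N [set k | T k <= t < T k.+1]).
have -> : k = n.
  have kn : (k < n.+1)%N by apply: ltT_lt; exact: le_lt_trans kt tn.
  have nk : (n < k.+1)%N by apply: ltT_lt; exact: le_lt_trans nt tk.
  by apply/eqP; rewrite eqn_leq; apply/andP.
by rewrite pcb_stateE /= block_skR.
Qed.

Lemma pcb_inj_neg t : t < 0 -> pcb_inj a x f T t = 0.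
Proof.
move=> t0; rewrite /pcb_inj; case: pselect => // -[k /andP[kt _]].
by have := lt_le_trans t0 (T_ge0 k); rewrite ltNge kt.
Qed.

Lemma Uk_le k : Uk k.+1 <= a.
Proof. by have [_ ->] := RUS k; rewrite ge_min lexx orbT. Qed.

Lemma Uk_dvd k : 0 < skdiv k -> Uk k.+1 = a.
Proof.
rewrite skdivE lt_max ltxx/= subr_gt0 => h.
by have [_ ->] := RUS k; rewrite min_r// ltW.
Qed.

Lemma Rk_homo k j : (k <= j)%N -> Rk k <= Rk j.
Proof.
move=> /subnKC <-; elim: (j - k)%N => [|n ih]; first by rewrite addn0.
by rewrite addnS (le_trans ih)//; have [-> _] := RUS (k + n); rewrite lerDl ml_ge0.
Qed.

(* A jump of the injection process between the dates T_j and T_k is nearly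
   realised strictly before some dividend date T_(i+1), so that the dividend
   paid at T_(i+1) does not interfere. *)
Let Rk_increase k j e : (j <= k)%N -> Rk j < Rk k -> 0 < e -> exists i v,
  [/\ (j <= i < k)%N, T i <= v, v < T i.+1, Rk i < Rk k & Rk k < skY (skL i) v + e].
Proof.
move=> + + e0; elim: k => [|k ih] jk; first by move: jk; rewrite leqn0 => /eqP->; rewrite ltxx.
move=> jlt; have [kk|kk] := leP (Rk k.+1) (Rk k).
  have kE : Rk k.+1 = Rk k by apply/eqP; rewrite eq_le kk Rk_homo.
  have jk' : (j <= k)%N.
    move: jk; rewrite leq_eqVlt => /orP[/eqP jE|//].
    by move: jlt; rewrite jE ltxx.
  have [|i [v [/andP[ji ik] h1 h2 h3 h4]]] := ih jk'; first by rewrite -kE.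
  by exists i, v; rewrite kE; split => //; rewrite ji ltnW.
have jk' : (j <= k)%N.
  move: jk; rewrite leq_eqVlt => /orP[/eqP jE|//].
  by move: jlt; rewrite jE ltxx.
have [mE _] := RUS k.
have [||s [ks sT hs]] := @ml_adh k (Num.max 0 (ml k - e)).
- by rewrite le_max lexx.
- rewrite gt_max; apply/andP; split; last by lra.
  by move: kk; rewrite mE ltrDl.
exists k, s; split => //; first by rewrite jk' ltnSn.
have h : ml k - e <= Num.max 0 (ml k - e) by rewrite le_max lexx orbT.
rewrite mE -/(ml k); lra.
Qed.

(** Extends the preceding fact to the unfinished block at [s]: either the running supremum was
    already reached at [T n], or a near-maximiser exceeds that value and hence lies after [T n]. *)
Lemma skR_increase n s j e : T n <= s -> s < T n.+1 -> (j <= n)%N ->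
  Rk j < skR (skL n) s -> 0 < e -> exists i v,
  [/\ (j <= i <= n)%N, T i <= v, v <= s, Rk i < skR (skL n) s &
      skR (skL n) s < skY (skL i) v + e].
Proof.
move=> ns sn jn jR e0; have [h|h] := leP (skR (skL n) s) (Rk n).
  have RE : skR (skL n) s = Rk n.
    by apply/eqP; rewrite eq_le h; apply: (rsup_homo (cadlag_skY n)).
  have [|i [v [/andP[ji ik] h1 h2 h3 h4]]] := Rk_increase jn _ e0; first by rewrite -RE.
  exists i, v; rewrite RE; split => //; first by rewrite ji ltnW.
  by rewrite (le_trans (ltW h2))// (le_trans _ ns)//; exact: leT.
have c0 : 0 <= Num.max (Rk n) (skR (skL n) s - e).
  by rewrite le_max rsup_ge0//; exact: cadlag_skY.
have [|v [v0 vs hv]] := rsup_adherent (y := skY (skL n)) (t := s) _ c0.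
  by rewrite gt_max h/= -/(skR (skL n) s); lra.
move: hv; rewrite gt_max => /andP[h1 h2].
exists n, v; split => //; [by rewrite jn leqnn| |lra].
rewrite leNgt; apply/negP => vn.
by have := le_rsup (cadlag_skY n) v0 (ltW vn); rewrite leNgt -/(skR (skL n) (T n)) h1.
Qed.

(** This is ruin by time [s] of the process periodically reflected at [b] and restarted from [b] at
    [T k]: such a process is a minimum over dates of [b] plus the increment since that date, compare
    [prefl_lt0P]. *)
Definition hit (b : R) (k : nat) (s : R) := exists j u,
  [/\ (k <= j)%N, T j <= u, u <= s & f u - f (T j) < - b].

Lemma hit_le b k j s : (k <= j)%N -> hit b j s -> hit b k s.
Proof.
by move=> kj [i [u [ji h1 h2 h3]]]; exists i, u; split => //; exact: leq_trans ji.
Qed.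

(** Weak duality with near complementary slackness. Any strategy obeys the constraint [hR] at one
    date and time; for the barrier strategy the same relation is almost an equality, at a
    near-maximiser of its deficit if it injects after the last weighted date, and at the fall itself
    otherwise, where the surplus is at most [a] and the fall exceeds [b]. *)
Lemma duality n s b (l : nat -> R) (Rs : R) : T n <= s -> s < T n.+1 -> b <= a ->
  (forall k, 0 <= l k) -> 0 <= Rs ->
  (forall m u, (m <= n)%N -> T m <= u -> u <= s -> \sum_(k < m) l k - x - f u <= Rs) ->
  \sum_(k < n) (if `[< hit b k.+1 s >] then l k else 0) + skR (skL n) s <=
  Rs + \sum_(k < n) (if `[< hit b k.+1 s >] then skdiv k else 0) + (a - b).
Proof.
move=> ns sn ba l0 Rs0 hR; pose Rst := skR (skL n) s.
(* [hit] is nonincreasing in the date, so the weights are 1 exactly on the payments at [T 1], ...,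
   [T j], where [j] is the last date that is hit, or 0 if there is none. *)
have [j [jn jhit jmax]] : exists j, [/\ (j <= n)%N, (j = 0%N \/ hit b j s) &
    forall k, (j < k <= n)%N -> ~ hit b k s].
  elim: (n) => [|m [j [jm jhit jmax]]].
    by exists 0%N; split => //; [left|move=> k /andP[k0 k0']; move: k0; rewrite ltnNge k0'].
  have [h|h] := pselect (hit b m.+1 s).
    exists m.+1; split => //; first by right.
    by move=> k /andP[k1 k2]; move: k1; rewrite ltnNge k2.
  exists j; split => //; first exact: leqW.
  move=> k /andP[jk]; rewrite leq_eqVlt => /orP[/eqP->//|km].
  by apply: jmax; rewrite jk.
have sumE (F : nat -> R) : \sum_(k < n) (if `[< hit b k.+1 s >] then F k else 0) = \sum_(k < j) F k.
  rewrite (big_ord_widen n F jn) [RHS]big_mkcond/=; apply: eq_bigr => k _.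
  have [kj|jk] := ltnP k j.
    case: jhit => [jE|hj]; first by move: kj; rewrite jE.
    by case: asboolP => // -[]; exact: hit_le kj hj.
  by case: asboolP => // h; exfalso; apply: (jmax k.+1) => //; rewrite ltnS jk ltn_ord.
rewrite !sumE.
have cY := cadlag_skY.
(* In the first case the barrier strategy injects nothing after [T j]: the constraint is used at the
   time [u] of the fall, and [Uk j <= a] costs the slack [a - b]. *)
have [Rle|Rgt] := leP Rst (Rk j).
  case: jhit => [jE|[j' [u [jj' h1 h2 h3]]]].
    by rewrite jE !big_ord0 -/Rst; move: Rle; rewrite jE RU0.1; lra.
  have jE : j' = j.
    apply/eqP; rewrite eqn_leq jj' andbT leqNgt; apply/negP => jj.
    apply: (jmax j'); last by exists j', u; split.
    by rewrite jj -ltnS; apply: ltT_lt; exact: le_lt_trans (le_trans h1 h2) sn.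
  rewrite {}jE {jj'} in h1 h3.
  have hu := hR j u jn h1 h2.
  have UE : Uk j = Rk j - (\sum_(k < j) skdiv k - x - f (T j)).
    by rewrite /Uk /skU -/(Rk j) /skY skL_after.
  (* At date 0 the surplus is [x], which may exceed [a]; there the weighted sums are empty and
     [Rk 0 = 0], so nothing is to be shown beyond signs. *)
  case: j UE Rle h1 h3 hu {jn sumE jmax} => [|j] UE Rle h1 h3 hu.
    by rewrite !big_ord0 -/Rst; move: Rle; rewrite RU0.1; lra.
  have Ua := Uk_le j; rewrite -/Rst; move: UE Ua hu Rle h3; lra.
(* The smallest positive gap between the final injection and the injections at earlier dates.
   Approximating the supremum within [e0] keeps the fall below strictly larger than [a]. *)
have [e0 e0p he0] : exists2 e0, 0 < e0 & forall i, (i <= n)%N -> Rk i < Rst -> e0 <= Rst - Rk i.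
  elim: (n) => [|m [e ep he]].
    have [h|h] := ltP (Rk 0) Rst.
      by exists (Rst - Rk 0) => [|i]; rewrite ?subr_gt0// leqn0 => /eqP->.
    by exists 1 => // i; rewrite leqn0 => /eqP->; rewrite ltNge h.
  have [h|h] := ltP (Rk m.+1) Rst; last first.
    exists e => // i; rewrite leq_eqVlt => /orP[/eqP->|]; first by rewrite ltNge h.
    by rewrite ltnS; exact: he.
  exists (Num.min e (Rst - Rk m.+1)); first by rewrite lt_min ep subr_gt0.
  move=> i; rewrite leq_eqVlt => /orP[/eqP-> _|]; first by rewrite ge_min lexx orbT.
  by rewrite ltnS => im /(he i im) h'; rewrite ge_min h'.
apply/ler_addgt0Pr => e ep.
have mp : 0 < Num.min e e0 by rewrite lt_min ep.
have [i [v [/andP[ji iN] iv vs iR hv]]] := skR_increase ns sn jn Rgt mp.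
have mine : Num.min e e0 <= e by rewrite ge_min lexx.
have mine0 : Num.min e e0 <= e0 by rewrite ge_min lexx orbT.
(* Between [T m] and [T i] the barrier strategy pays nothing, or there is a last date [T k] at which
   it pays. *)
have dvd0 : forall m, (m <= i)%N -> \sum_(k < m) skdiv k = \sum_(k < i) skdiv k \/
    exists2 k, (m < k <= i)%N & 0 < skdiv k.-1 /\ \sum_(k' < k) skdiv k' = \sum_(k' < i) skdiv k'.
  move=> m mi; have [p pE] : exists p, (m + p)%N = i by exists (i - m)%N; rewrite subnKC.
  elim: p m mi pE => [|p ih] m mi pE; first by left; rewrite -pE addn0.
  have mi' : (m < i)%N by rewrite -pE addnS ltnS leq_addr.
  have pE' : (m.+1 + p)%N = i by rewrite -pE addSn addnS.
  have [h|[k /andP[mk ki] h]] := ih m.+1 mi' pE'; last first.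
    by right; exists k => //; rewrite ki andbT ltnW.
  have [d0|d0] := leP (skdiv m) 0.
    left; rewrite -h big_ord_recr/=.
    by have := skdiv_ge0 m; lra.
  by right; exists m.+1 => //; rewrite ltnSn mi'.
(* A barrier payment between [T j] and [T i] would leave the surplus at [a] at its date. The later
   increase of the injections then forces a fall of more than [a], hence of more than [b], from that
   date: a hit after [j]. *)
have sumi : \sum_(k < j) skdiv k = \sum_(k < i) skdiv k.
  have [//|[[//|k] /andP[jk ki] [/= dk sk]]] := dvd0 j ji.
  exfalso; apply: (jmax k.+1); first by rewrite jk (leq_trans ki).
  exists k.+1, v; split => //; first by rewrite (le_trans _ iv)//; exact: leT.
  have Ua := Uk_dvd dk.
  have UE : Uk k.+1 = Rk k.+1 - (\sum_(k' < k.+1) skdiv k' - x - f (T k.+1)).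
    by rewrite /Uk /skU -/(Rk k.+1) /skY skL_after.
  have h1 := he0 i iN iR; have h2 := Rk_homo ki.
  move: hv; rewrite /skY skL_after// -/Rst -sk; move: Ua UE h1 h2 mine0 ba; lra.
have hu := hR i v iN iv vs.
have hl : \sum_(k < j) l k <= \sum_(k < i) l k.
  by rewrite (big_ord_widen i l ji) [leLHS]big_mkcond/=; apply: ler_sum => k _; case: ifP.
move: hv; rewrite /skY skL_after// -sumi; rewrite -/Rst; move: hu hl mine ba; lra.
Qed.

End skorokhod.

(** * Adaptedness of the barrier strategy *)

Section caglad_functions.
Context {R : realType}.
Implicit Types (f g : R -> R).

Lemma cagladD f g : caglad f -> caglad g -> caglad (fun t => f t + g t).
Proof.
move=> [f1 f2] [g1 g2]; split=> t t0; first by apply: cvgD; [exact: f1|exact: g1].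
have [l fl] := f2 t t0; have [m gm] := g2 t t0.
by exists (l + m); exact: cvgD.
Qed.

Lemma caglad_sum n (F : nat -> R -> R) : (forall k, caglad (F k)) ->
  caglad (fun t => \sum_(k < n) F k t).
Proof.
move=> cF; elim: n => [|n ih].
  have -> : (fun t => \sum_(k < 0) F k t) = (fun=> 0) by apply/funext => t; rewrite big_ord0.
  exact: caglad_cst.
rewrite (_ : (fun t => _) = (fun t => \sum_(k < n) F k t + F n t)); last first.
  by apply/funext => t; rewrite big_ord_recr.
exact: cagladD.
Qed.

Lemma caglad_pos f a : caglad f -> caglad (fun t => Num.max 0 (f t - a)).
Proof.
have cm : continuous (fun y : R => Num.max 0 (y - a)).
  move=> y; apply: (@continuous_max R R (cst 0) (fun y => y - a)); first exact: cst_continuous.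
  by apply: cvgB; [exact: cvg_id|exact: cvg_cst].
move=> [f1 f2]; split=> t t0.
  by apply: (@continuous_cvg _ _ _ _ _ _ (fun y => Num.max 0 (y - a))); [exact: cm|exact: f1].
have [l fl] := f2 t t0; exists (Num.max 0 (l - a)).
by apply: (@continuous_cvg _ _ _ _ _ _ (fun y => Num.max 0 (y - a))); [exact: cm|].
Qed.

Lemma caglad_window f u v : u < v -> caglad f ->
  caglad (fun t => if (u < t) && (t <= v) then f t else 0).
Proof.
move=> uv [f1 f2]; split=> t t0.
  apply/at_left_epsP => e e0.
  have [ut|tu] := ltP u t; last first.
    exists 1 => // s _ st; have -> : (u < s) = false.
      by apply/negbTE; rewrite -leNgt (le_trans (ltW st) tu).
    by rewrite !andFb subrr normr0.
  have [tv|vt] := leP t v.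
    have /at_left_epsP/(_ e e0)[r r0 hr] := f1 t t0.
    exists (Num.min r (t - u)); first by rewrite lt_min r0 subr_gt0.
    move=> s rs st; have := ge_min r r (t - u); have := ge_min (t - u) r (t - u).
    rewrite !lexx orbT/= => h1 h2.
    rewrite ifT; last by apply/andP; split; lra.
    by apply: hr; lra.
  exists (t - v); first by rewrite subr_gt0.
  move=> s; rewrite opprB addrC subrK => vs st.
  have -> : (s <= v) = false by apply/negbTE; rewrite -ltNge.
  by rewrite !andbF subrr normr0.
have [ut|tu] := leP u t; last first.
  exists 0; apply/at_right_epsP => e e0; exists (u - t); first by rewrite subr_gt0.
  move=> s ts; rewrite addrC subrK => su; have -> : (u < s) = false.
    by apply/negbTE; rewrite -leNgt ltW.
  by rewrite !andFb subrr normr0.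
have [tv|vt] := ltP t v.
  have [l fl] := f2 t t0; exists l; apply/at_right_epsP => e e0.
  have /at_right_epsP/(_ e e0)[r r0 hr] := fl.
  exists (Num.min r (v - t)); first by rewrite lt_min r0 subr_gt0.
  move=> s ts sr; have := ge_min r r (v - t); have := ge_min (v - t) r (v - t).
  rewrite !lexx orbT/= => h1 h2.
  rewrite ifT; last by apply/andP; split; lra.
    by apply: hr; lra.
exists 0; apply/at_right_epsP => e e0; exists 1 => // s ts _.
have -> : (s <= v) = false by apply/negbTE; rewrite -ltNge (le_lt_trans vt ts).
by rewrite !andbF subrr normr0.
Qed.

End caglad_functions.

Section adapted_strategy.
Context {R : realType} {d : measure_display} {Omega : measurableType d}.
Variables (P : probability Omega R) (X : R -> Omega -> R) (E : nat -> Omega -> R).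
Hypothesis levyX : levy_process P X.
Hypothesis E_gt0 : forall k w, 0 < E k w.
Variables (a x : R).

Let FT t := g_sigma_algebraType (gen_F X E t).

Let FT_le s t : 0 <= s -> s <= t -> measurable_fun setT (id : FT t -> FT s).
Proof.
move=> s0 st _ A mA; rewrite setTI; move: A mA; apply: sub_smallest2r.
  exact: smallest_sigma_algebra.
move=> A [[u [/andP[u0 us] h]]|[k [u [/andP[u0 us] h]]]].
  by left; exists u; split => //; rewrite u0 (le_trans us).
by right; exists k, u; split => //; rewrite u0 (le_trans us).
Qed.

Definition cad_adapted (Y : R -> Omega -> R) :=
  adapted X E Y /\ forall w, cadlag (Y ^~ w).

Let ad_measurable Y s t : adapted X E Y -> 0 <= s -> s <= t ->
  measurable_fun setT (Y s : FT t -> R).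
Proof.
move=> aY s0 st; have mY : measurable_fun setT (Y s : FT s -> R).
  by move=> _ B mB; rewrite setTI; exact: aY.
exact: (measurableT_comp mY (FT_le s0 st)).
Qed.

Let ad_of (Y : R -> Omega -> R) : (forall t, 0 <= t -> measurable_fun setT (Y t : FT t -> R)) ->
  adapted X E Y.
Proof. by move=> mY t t0 B mB; have := mY t t0 measurableT B mB; rewrite setTI. Qed.

Lemma cad_adapted_levy : cad_adapted X.
Proof.
split; last by case: levyX.
move=> t t0 B mB; apply: sub_sigma_algebra; left; exists t; rewrite t0 lexx; split => //.
by exists B.
Qed.

Lemma cad_adaptedD Y Z : cad_adapted Y -> cad_adapted Z ->
  cad_adapted (fun t w => Y t w + Z t w).
Proof.
move=> [aY cY] [aZ cZ]; split; last by move=> w; exact: cadlagD.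
by apply: ad_of => t t0; apply: measurable_funD; apply: ad_measurable.
Qed.

Lemma cad_adaptedB Y Z : cad_adapted Y -> cad_adapted Z ->
  cad_adapted (fun t w => Y t w - Z t w).
Proof.
move=> [aY cY] [aZ cZ]; split; last by move=> w; exact: cadlagB.
by apply: ad_of => t t0; apply: measurable_funB; apply: ad_measurable.
Qed.

Lemma cad_adapted_cst (c : R) : cad_adapted (fun _ _ => c).
Proof. by split; [exact: adapted_cst|move=> w; exact: cadlag_cst]. Qed.

(** By right-continuity, exceeding [c] by time [t] is visible at a rational time before [t] or at
    [t] itself. Clamping the rationals to [[0, t]] includes the endpoint, since any rational beyond
    [t] reads it. *)
Lemma cad_adapted_rsup Y : cad_adapted Y -> cad_adapted (fun t w => rsup (Y ^~ w) t).
Proof.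
move=> [aY cY]; split; last by move=> w; exact: rsup_cadlag.
apply: ad_of => t t0; apply: (measurability _ (RGenOInfty.measurableE R)) => //.
move=> _ [_ [c ->] <-]; rewrite setTI.
have [c0|c0] := leP 0 c; last first.
  rewrite (_ : _ @^-1` _ = setT); first exact: measurableT.
  apply/seteqP; split => // w _ /=; rewrite in_itv/= andbT (lt_le_trans c0)//.
  exact: rsup_ge0.
rewrite (_ : _ @^-1` _ = \bigcup_(r : rat)
    [set w | c < Y (Num.min (Num.max (ratr r) 0) t) w]).
  apply: bigcupT_measurable_rat => r; apply: measurable_ltr_set => //.
  apply: ad_measurable => //; last by rewrite ge_min lexx orbT.
  by rewrite le_min t0 andbT le_max lexx orbT.
apply/seteqP; split => w /=; rewrite in_itv/= andbT; last first.
  move=> [r _ /= /lt_le_trans]; apply; apply: (le_rsup (y := Y ^~ w)) => //.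
    by rewrite le_min t0 andbT le_max lexx orbT.
  by rewrite ge_min lexx orbT.
move=> /(@rsup_adherent _ (Y ^~ w))/(_ c0)[s [s0 st cs]].
move: st; rewrite le_eqVlt => /orP[/eqP sE|st].
  have [r] : exists r : rat, ratr r \in `]t, (t + 1)[ by apply: rat_in_itvoo; rewrite ltrDl.
  rewrite in_itv/= => /andP[tr _]; exists r => //=.
  by rewrite max_l ?(ltW (le_lt_trans t0 tr))// min_r ?(ltW tr)// -sE.
have /at_right_epsP/(_ (Y s w - c))[|r r0 hr] := (cY w).1 s s0; first by rewrite subr_gt0.
have [p] : exists p : rat, ratr p \in `]s, (Num.min t (s + r))[.
  by apply: rat_in_itvoo; rewrite lt_min st ltrDl.
rewrite in_itv/= lt_min => /and3P[sp pt pr]; exists p => //=.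
rewrite max_l ?(ltW (le_lt_trans s0 sp))// min_l ?(ltW pt)//.
by have := hr _ sp pr; rewrite ltr_distlC => /andP[h _]; lra.
Qed.

Let mT_ler k s t : 0 <= t -> s <= t -> measurable ([set w | T_of E k w <= s] : set (FT t)).
Proof.
move=> t0 st; have [s0|s0] := leP 0 s.
  by apply: sub_sigma_algebra; right; exists k, s; rewrite s0 st.
rewrite (_ : [set w | _] = set0)//; apply/seteqP; split => // w /=.
by rewrite leNgt (lt_le_trans s0 (T_of_ge0 E_gt0 k w)).
Qed.

Let mT_min k t : 0 <= t -> measurable_fun setT ((fun w => Num.min (T_of E k w) t) : FT t -> R).
Proof.
move=> t0; apply: (measurability _ (RGenOInfty.measurableE R)) => //.
move=> _ [_ [c ->] <-]; rewrite setTI.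
have [tc|ct] := leP t c.
  rewrite (_ : _ @^-1` _ = set0)//; apply/seteqP; split => // w /=.
  by rewrite in_itv/= andbT lt_min => /andP[_]; rewrite ltNge tc.
rewrite (_ : _ @^-1` _ = ~` ([set w | T_of E k w <= c] : set (FT t))); last first.
  apply/seteqP; split => w /=; rewrite in_itv/= andbT lt_min ct andbT ltNge; first by move/negP.
  by move=> /negP.
by apply: measurableC; apply: mT_ler => //; exact: ltW.
Qed.

Lemma adapted_left_lim Y t : cad_adapted Y -> 0 < t ->
  measurable_fun setT ((fun w => left_lim (Y ^~ w) t) : FT t -> R).
Proof.
move=> [aY cY] t0.
apply: (@measurable_fun_cvg _ (FT t) R setT (fun n w => Y (gdn n t) w)).
  by move=> n; apply: ad_measurable => //; [exact: gpt_ge0|exact/ltW/gdn_lt].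
move=> w _; apply: (cvg_gdn_left (f := Y ^~ w)) => //; exact: cadlag_left_lim.
Qed.

Lemma cad_adapted_payment Y k : cad_adapted Y ->
  cad_adapted (fun t w => if T_of E k.+1 w <= t
    then Num.max 0 (left_lim (Y ^~ w) (T_of E k.+1 w) - a) else 0).
Proof.
move=> [aY cY]; split; last by move=> w; exact: cadlag_step.
apply: ad_of => t t0.
(* Only the arrival time capped at [t] is known at [t]. On the event that the payment has occurred,
   capping changes neither the time nor the left limit read there. *)
pose tau w := Num.min (T_of E k.+1 w) t.
pose Ys s w := Y (Num.min s t) w.
have mb : measurable_fun setT ((fun w => T_of E k.+1 w <= t) : FT t -> bool).
  apply: (@measurable_fun_bool _ (FT t) setT _ true) => //.
  by rewrite setTI; apply: mT_ler.
apply: (@measurable_fun_cvg _ (FT t) R setT (fun n w =>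
  if T_of E k.+1 w <= t then Num.max 0 (Ys (gdn n (tau w)) w - a) else 0)).
  move=> n; apply: measurable_fun_ifT => //.
  apply: measurable_maxr => //; apply: measurable_funB => //.
  apply: (@measurable_at_gdn R _ (FT t) tau (mT_min k.+1 t0) Ys) => s s0.
  by apply: (@ad_measurable Y (Num.min s t) t) => //; rewrite ?le_min ?s0 ?t0 ?ge_min ?lexx ?orbT.
move=> w _; case: ifPn => [Tt|_]; last exact: cvg_cst.
have T0 : 0 < T_of E k.+1 w by exact: T_of_gt0.
have tauE : tau w = T_of E k.+1 w by rewrite /tau min_l.
have cm : continuous (fun y : R => Num.max 0 (y - a)).
  move=> y; apply: (@continuous_max R R (cst 0) (fun y => y - a)); first exact: cst_continuous.
  by apply: cvgB; [exact: cvg_id|exact: cvg_cst].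
apply: (@continuous_cvg _ _ _ _ _ _ (fun y => Num.max 0 (y - a))); first exact: cm.
rewrite tauE (_ : (fun n => _) = fun n => Y (gdn n (T_of E k.+1 w)) w); last first.
  apply/funext => n; rewrite /Ys min_l//.
  by rewrite (le_trans (ltW (gdn_lt n T0))).
by apply: (cvg_gdn_left (f := Y ^~ w)) => //; exact: cadlag_left_lim.
Qed.

Definition sL k t w := skL a x (X ^~ w) (T_of E ^~ w) k t.
Definition sR k t w := skR x (X ^~ w) (sL k ^~ w) t.
Definition sU k t w := skU x (X ^~ w) (sL k ^~ w) t.

Lemma cad_adapted_sLRU k :
  [/\ cad_adapted (sL k), cad_adapted (sR k) & cad_adapted (sU k)].
Proof.
have LtoR Lk : cad_adapted Lk ->
    cad_adapted (fun t w => skR x (X ^~ w) (Lk ^~ w) t) /\ cad_adapted (fun t w => skU x (X ^~ w) (Lk ^~ w) t).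
  move=> cL; have cY : cad_adapted (fun t w => Lk t w - x - X t w).
    apply: cad_adaptedB; last exact: cad_adapted_levy.
    by apply: cad_adaptedB => //; exact: cad_adapted_cst.
  have cR := cad_adapted_rsup cY.
  by split => //; exact: (cad_adaptedB cR cY).
elim: k => [|k [cL cR cU]].
  have c0 : cad_adapted (sL 0) by exact: cad_adapted_cst.
  by have [? ?] := LtoR _ c0; split.
have cS : cad_adapted (sL k.+1).
  exact: (cad_adaptedD cL (cad_adapted_payment k cU)).
by have [? ?] := LtoR _ cS; split.
Qed.

(** Windows open on the left and closed on the right make the integrand caglad. In the k-th window
    it is what would be paid if the next arrival were now, so its value at [T_of E k.+1] is the
    actual payment. *)
Definition rho_trunc n t w : R := \sum_(k < n)
  (if (T_of E k w < t) && (t <= T_of E k.+1 w)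
   then Num.max 0 (left_lim (sU k ^~ w) t - a) else 0).

Lemma adapted_rho_trunc n : adapted X E (rho_trunc n).
Proof.
apply: ad_of => t t0; apply: (@measurable_sum _ (FT t)) => k.
move: t0; rewrite le_eqVlt => /orP[/eqP<-|t0].
  rewrite (_ : (fun w => _) = cst 0)//; apply/funext => w.
  by rewrite ltNge T_of_ge0.
have t0' := ltW t0.
apply: measurable_fun_ifT => //; last first.
  apply: measurable_maxr => //; apply: measurable_funB => //.
  by apply: adapted_left_lim => //; have [] := cad_adapted_sLRU k.
apply: (@measurable_fun_bool _ (FT t) setT _ true) => //.
rewrite setTI (_ : _ @^-1` _ = [set w | Num.min (T_of E k w) t < t] `&`
    [set w | t <= Num.min (T_of E k.+1 w) t]).
  apply: measurableI.
    by apply: (@measurable_ltr_set _ _ (FT t)) => //; exact: mT_min.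
  by apply: (@measurable_ler_set _ _ (FT t)) => //; exact: mT_min.
apply/seteqP; split => w /=; rewrite le_min lexx andbT gt_min ltxx orbF; first by move=> /andP[].
by move=> [-> ->].
Qed.

Lemma caglad_rho_trunc n w : caglad (rho_trunc n ^~ w).
Proof.
apply: (@caglad_sum _ n (fun k t => if (T_of E k w < t) && (t <= T_of E k.+1 w)
   then Num.max 0 (left_lim (sU k ^~ w) t - a) else 0)) => k.
apply: (@caglad_window _ (fun t => Num.max 0 (left_lim (sU k ^~ w) t - a))); first exact: T_of_lt.
apply: caglad_pos; apply: left_lim_caglad.
by have [_ _ [_ ]] := cad_adapted_sLRU k.
Qed.

Lemma rho_trunc_ge0 n t w : 0 <= rho_trunc n t w.
Proof. by apply: sumr_ge0 => k _; case: ifP => // _; rewrite le_max lexx. Qed.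

Lemma rho_trunc_T n m w : rho_trunc n (T_of E m.+1 w) w =
  if (m < n)%N then skdiv a x (X ^~ w) (T_of E ^~ w) m else 0.
Proof.
have out k : k != m -> (T_of E k w < T_of E m.+1 w) && (T_of E m.+1 w <= T_of E k.+1 w) = false.
  move=> km; apply/negP => /andP[h1 h2].
  have {}h1 : (k < m.+1)%N by rewrite ltnNge; apply/negP => /(T_of_le E_gt0 w); rewrite leNgt h1.
  have {}h2 : (m.+1 <= k.+1)%N.
    rewrite leqNgt; apply/negP => h; move: h2; rewrite leNgt => /negP; apply.
    by apply: lt_le_trans (T_of_lt E_gt0 k.+1 w) _; exact: T_of_le.
  by move: km; rewrite eqn_leq -ltnS h1/= -ltnS h2.
rewrite /rho_trunc; case: ifPn => [mn|].
  rewrite (bigD1 (Ordinal mn))//= T_of_lt// lexx/= big1 ?addr0//.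
  by move=> k km; rewrite out.
rewrite -leqNgt => nm; rewrite big1// => k _; rewrite out//.
by rewrite ltn_eqF// (leq_trans (ltn_ord k)).
Qed.

End adapted_strategy.

(** * Discounting as an exponential time *)

Section exponential_discount.
Context {R : realType}.
Variables (q : R) (q0 : 0 < q).

Definition expo0 : probability (measurableTypeR R) R.
Proof. by refine (exponential_prob q). Defined.

Lemma measurable_idR : measurable_fun setT (id : measurableTypeR R -> R).
Proof. by move=> _ B mB; rewrite setTI. Qed.

(** The exponential law, transported by the identity to the measurable structure on [R] over which
    the other integrals are taken. *)
Definition expo : probability R R :=
  distribution expo0 (HB.pack (id : measurableTypeR R -> R)
    (isMeasurableFun.Build _ _ _ _ _ measurable_idR) : {mfun _ >-> _}).

Lemma expo_set1 (t : R) : expo [set t] = 0%E.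
Proof. by rewrite /expo /= /distribution /pushforward /expo0 /= /exponential_prob integral_set1. Qed.

Lemma expo_lt0 : expo `]-oo, 0[%classic = 0%E.
Proof.
rewrite /expo /= /distribution /pushforward /expo0 /= /exponential_prob integral0_eq// => s /=; rewrite in_itv/= => s0.
by rewrite lt0_exponential_pdf.
Qed.

Lemma expo_gt (t : R) : 0 <= t -> expo `]t, +oo[%classic = (expR (- q * t))%:E.
Proof.
move=> t0.
have h : expo `]-oo, t]%classic = (1 - expR (- q * t))%:E.
  rewrite (_ : `]-oo, t]%classic = `]-oo, 0[%classic `|` `[0, t]%classic); last first.
    apply/seteqP; split => s /=; rewrite !in_itv/=.
      by move=> st; have [s0|s0] := ltP s 0; [left|right].
    by move=> [s0|/andP[]//]; rewrite ltW// (lt_le_trans s0).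
  rewrite measureU//; last first.
    apply/seteqP; split => // s [/=]; rewrite !in_itv/= => h /andP[].
    by rewrite leNgt h.
  rewrite [X in (X + _)%E](_ : _ = 0%E); last exact: expo_lt0.
  rewrite add0e; move: t0; rewrite le_eqVlt => /orP[/eqP<-|t0].
    rewrite set_itv1 mulr0 expR0 subrr; exact: expo_set1.
  exact: exponential_prob_itv0c.
rewrite -setCitvl probability_setC//.
by rewrite [X in (_ - X)%E](_ : _ = (1 - expR (- q * t))%:E)// -EFinB opprB addrC subrK.
Qed.

Lemma expo_ge (t : R) : 0 <= t -> expo `[t, +oo[%classic = (expR (- q * t))%:E.
Proof.
move=> t0; rewrite -expo_gt//.
have -> : `[t, +oo[%classic = [set t] `|` `]t, +oo[%classic.
  apply/seteqP; split => s /=; rewrite !in_itv/= !andbT.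
    by rewrite le_eqVlt => /orP[/eqP->|]; [left|right].
  by move=> [->|/ltW].
rewrite measureU//.
  by rewrite [X in (X + _)%E](_ : _ = 0%E) ?add0e//; exact: expo_set1.
by apply/seteqP; split => // s [/= ->]; rewrite in_itv/= ltxx.
Qed.

(** The closed interval includes the atom at 0, of mass [G 0]. It is computed as []-1, s]] minus
    []-1, 0[], the latter being null because [G] vanishes there. *)
Lemma stieltjes_cumulative_0c (G : cumulative R R) (s : R) : (forall t, t < 0 -> G t = 0) -> 0 <= s ->
  lebesgue_stieltjes_measure G (`[0, s]%classic : set R) = (G s)%:E.
Proof.
move=> Gneg s0.
have oc (u v : R) : u <= v -> lebesgue_stieltjes_measure G (`]u, v]%classic : set R) = (G v - G u)%:E.
  move=> uv; rewrite /lebesgue_stieltjes_measure/= /measure_extension/= measurable_mu_extE/=; last exact: is_ocitv.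
  by rewrite wlength_itv_bnd.
have neg : lebesgue_stieltjes_measure G (`]-1, 0[%classic : set R) = 0%E.
  rewrite (_ : `]-1, 0[%classic = \bigcup_n `]-1, (- n.+1%:R^-1)]%classic); last first.
    apply/seteqP; split => u /=; rewrite in_itv/=.
      move=> /andP[u1 un].
      have [n hn] := ltr_add_invr un; exists n => //=; rewrite in_itv/= u1/= -[leRHS]add0r lerBrDr ltW//.
    move=> [n _ /=]; rewrite in_itv/= => /andP[-> h] /=; apply: (le_lt_trans h).
    by rewrite oppr_lt0.
  apply/negligibleP; first exact: bigcupT_measurable.
  apply: negligible_bigcup => n; apply/negligibleP => //.
  transitivity (G (- n.+1%:R^-1) - G (- 1))%:E.
    by apply: oc; rewrite lerN2 invf_le1// ler1n.
  by rewrite !Gneg ?subrr// oppr_lt0.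
have -> : `[0, s]%classic = `]-1, s]%classic `\` `]-1, 0[%classic :> set R.
  apply/seteqP; split => u /=; rewrite !in_itv/=.
    move=> /andP[u0 us]; split; first by apply/andP; split => //; lra.
    by move=> /andP[_]; rewrite ltNge u0.
  by move=> [/andP[u1 ->]]; rewrite u1/= andbT => /negP; rewrite -leNgt.
have s1 : -1 <= s by lra.
have ocs : lebesgue_stieltjes_measure G (`]-1, s]%classic : set R) = (G s)%:E.
  by rewrite oc // (_ : G (- 1) = 0) ?subr0 //; apply: Gneg; lra.
rewrite measureD//=; last by apply: (@le_lt_trans _ _ (G s)%:E); rewrite ?ltry// -ocs.
rewrite (_ : _ `&` _ = `]-1, 0[%classic).
  by rewrite -[RHS]adde0 -oppe0 -neg -ocs.
apply/seteqP; split => u /=; rewrite !in_itv/=; first by move=> [].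
by move=> /andP[-> u0]; rewrite u0 (ltW (lt_le_trans u0 s0)).
Qed.

(** [e^{-qt}] is the probability that an exponential time is at least [t]; Tonelli exchanges this
    time with the integrator. *)
Lemma stieltjes_expE (F : R -> R) : {homo F : x y / x <= y} -> right_continuous F ->
  (forall t, t < 0 -> F t = 0) ->
  stieltjes_exp q F = (\int[expo]_s (F s)%:E)%E.
Proof.
move=> ndF rcF Fneg; rewrite /stieltjes_exp; case: pselect => [H|]; last by case.
set G := (X in lebesgue_stieltjes_measure X).
pose h (z : R * R) : \bar R := (\1_[set z : R * R | 0 <= z.1 /\ z.1 <= z.2] z)%:E.
have mh : measurable_fun setT h.
  apply/measurable_EFinP/measurable_indic.
  rewrite (_ : [set _ | _] = [set z : R * R | 0 <= z.1] `&` [set z | z.1 <= z.2]); last by [].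
  by apply: measurableI; apply: measurable_ler_set.
have h0 z : (0 <= h z)%E by rewrite lee_fin.
have HH := @fubini_tonelli _ _ _ _ R (lebesgue_stieltjes_measure G) expo h mh h0.
have sec1 (t : R) : (\int[expo]_s h (t, s) = if (0 <= t)%R then (expR (- q * t))%:E else 0)%E.
  rewrite /h; case: ifPn => t0.
    rewrite -expo_ge// -[X in expo X]setIT -integral_indic//.
    apply: eq_integral => s _; congr (_%:E); rewrite !indicE; congr ((_ : bool)%:R).
    by apply/idP/idP => /set_mem /= h1; apply/mem_set; move: h1; rewrite /= in_itv/= andbT => // -[].
  by rewrite integral0_eq// => s _; rewrite indicE memNset//= => -[]; rewrite (negbTE t0).
have sec2 (s : R) : (\int[lebesgue_stieltjes_measure G]_t h (t, s) = (F s)%:E)%E.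
  rewrite /h; have [s0|s0] := leP 0 s.
    rewrite -(@stieltjes_cumulative_0c G s Fneg s0).
    rewrite -[X in _ = lebesgue_stieltjes_measure G X]setIT -integral_indic//.
    apply: eq_integral => t _; congr (_%:E); rewrite !indicE; congr ((_ : bool)%:R).
    apply/idP/idP => /set_mem /= h1; apply/mem_set; move: h1; rewrite /= in_itv/=.
      by move=> [-> ->].
    by move=> /andP[-> ->].
  rewrite Fneg// integral0_eq// => t _; rewrite indicE memNset//= => -[t0 ts].
  by have := le_lt_trans (le_trans t0 ts) s0; rewrite ltxx.
transitivity (\int[lebesgue_stieltjes_measure G]_t \int[expo]_s h (t, s))%E.
  rewrite integral_mkcond; apply: eq_integral => t _; rewrite sec1 patchE.
  case: ifPn => [/set_mem/=|/negP nt]; first by rewrite in_itv/= andbT => ->.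
  by case: ifPn => // t0; exfalso; apply: nt; apply/mem_set; rewrite /= in_itv/= andbT.
by rewrite [LHS]HH; apply: eq_integral => s _; rewrite sec2.
Qed.

(** Memorylessness: on [[t, +oo[] the law shifted back by [t] is [e^{-qt}] times itself, which is
    checked on half-lines. *)
Lemma expo_shift (t : R) (g : R -> \bar R) : 0 <= t -> measurable_fun setT g ->
  (forall s, (0 <= g s)%E) ->
  (\int[expo]_s (if (t <= s)%R then g (s - t)%R else 0) =
   (expR (- q * t))%:E * \int[expo]_s g s)%E.
Proof.
move=> t0 mg g0.
have mshift : measurable_fun setT (fun s : R => s - t) by exact: measurable_funB.
pose D : set R := `[t, +oo[%classic.
have mD : measurable D by exact: measurable_itv.
have [p pE] : exists p : {nonneg R}, p%:num = expR (- q * t).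
  by exists (NngNum (expR_ge0 (- q * t))).
pose D0 : set R := `[0, +oo[%classic.
have mD0 : measurable D0 by exact: measurable_itv.
have DD0 : (fun s : R => s - t) @^-1` D0 = D.
  by apply/seteqP; split => s /=; rewrite /D0 /D /= !in_itv/= !andbT subr_ge0.
pose mp : {measure set R -> \bar R} := push_measure expo mshift.
pose m1 : {measure set R -> \bar R} := mrestr mp mD0.
pose m2 : {measure set R -> \bar R} := mscale p expo.
have m12 A : measurable A -> m1 A = m2 A.
  apply: (@pi_eq_measures R _ R ((@RGenOInfty.G R) `|` [set setT])) => {A}.
  - transitivity (<<s @RGenOInfty.G R >>); first exact: RGenOInfty.measurableE.
    apply/seteqP; split.
      by apply: sub_smallest2r; [exact: smallest_sigma_algebra|move=> C GC; left].
    apply: smallest_sub; first exact: smallest_sigma_algebra.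
    move=> C [GC|->]; first exact: sub_sigma_algebra.
    exact: (@measurableT _ (g_sigma_algebraType (@RGenOInfty.G R))).
  - move=> _ _ [[u ->]|->] [[v ->]|->]; rewrite ?setIT ?setTI; [left|left; by exists u|left; by exists v|by right].
    exists (Num.max u v); apply/seteqP; split => z /=; rewrite !in_itv/= !andbT gt_max.
      by move=> [-> ->].
    by move=> /andP[].
  - by right.
  - rewrite /m1 /= /pushforward /mrestr setTI /mp/= /pushforward DD0.
    by apply: (@le_lt_trans _ _ (expR (- q * t))%:E); rewrite ?ltry// expo_ge.
  move=> A mA.
  rewrite /m1 /m2 /= /mscale /= /pushforward /mrestr /mp/= /pushforward preimage_setI DD0 pE.
  case: mA => [[c ->]|->]; last first.
    rewrite preimage_setT setTI; transitivity (expR (- q * t))%:E; first exact: expo_ge.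
    rewrite -[LHS]mule1; congr (_ * _)%E; exact/esym/(probability_setT expo).
  have [c0|c0] := leP 0 c.
    transitivity (expo `]t + c, +oo[%classic).
      congr (expo _); apply/seteqP; split => u /=; rewrite !in_itv/= !andbT; last first.
        by move=> h; split; [rewrite ltrBrDl|rewrite /D /= in_itv/= andbT (le_trans _ (ltW h))// lerDl].
      by move=> [h h2]; rewrite -ltrBrDl.
    rewrite expo_gt ?addr_ge0// [X in (_ * X)%E](_ : _ = (expR (- q * c))%:E); last exact: expo_gt.
    by rewrite -EFinM -expRD mulrDr.
  transitivity (expo D).
    congr (expo _); apply/seteqP; split => u /=; first by case.
    move=> Du; split => //; move: Du; rewrite /D /= !in_itv/= !andbT => h.
    by rewrite ltrBrDl (lt_le_trans _ h)// gtrDl.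
  rewrite [LHS](_ : _ = (expR (- q * t))%:E); last exact: expo_ge.
  rewrite [X in (_ * X)%E](_ : _ = 1%E) ?mule1//.
  have h0 : expo D0 = 1%E by rewrite expo_ge// mulr0 expR0.
  have mc : measurable (`]c, +oo[%classic : set R) by exact: measurable_itv.
  apply/eqP; rewrite eq_le; apply/andP; split; first exact: probability_le1.
  rewrite -h0; apply: le_measure; rewrite ?inE// => u; rewrite /D0 /= !in_itv/= !andbT.
  exact: lt_le_trans.
transitivity (\int[mp]_(s in D0) g s)%E.
  rewrite (ge0_integral_pushforward mshift)//; last exact: measurable_funTS.
  rewrite DD0 integral_mkcond; apply: eq_integral => s _; rewrite patchE.
  case: ifPn => [ts|nts]; first by rewrite mem_set// /D /= in_itv/= andbT.
  by rewrite memNset// /D /= in_itv/= andbT; exact/negP.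
transitivity (\int[m2]_(s in D0) g s)%E.
  apply: eq_measure_integral => A mA AD; rewrite -m12// /m1 /= /mrestr.
  by rewrite setIidl.
rewrite ge0_integral_mscale//= ?pE; last exact: measurable_funTS.
congr (_ * _)%E; rewrite [RHS](@ge0_negligible_integral _ _ _ expo setT `]-oo, 0[%classic)//; last exact: expo_lt0.
  congr (\int[_]_(_ in _) _)%E; rewrite setTD /D0.
  by apply/seteqP; split => u /=; rewrite !in_itv/= ?andbT => h; [apply/negP; rewrite -leNgt|rewrite leNgt; exact/negP].
Qed.

End exponential_discount.

(** * Comparing integrals off a null set *)

Section integral_off_negligible.
Import HBNNSimple.

(** Stated for arbitrary nonnegative functions because [kappa_refl], [pcb_div] and [pcb_inj] are
    controlled only off a null set. The integral is a supremum over simple functions, and each of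
    these can be set to 0 on [N] without changing its integral. *)
Lemma ge0_integral_off {R : realType} d (T : measurableType d) (mu : {measure set T -> \bar R})
    (N : set T) (f g : T -> \bar R) : measurable N -> mu N = 0%E ->
  (forall w, (0 <= f w)%E) -> (forall w, (0 <= g w)%E) -> (forall w, ~ N w -> f w = g w) ->
  (\int[mu]_w f w = \int[mu]_w g w)%E.
Proof.
move=> mN N0; have mNC := measurableC mN.
wlog suff H : f g / (forall w, (0 <= f w)%E) -> (forall w, (0 <= g w)%E) ->
    (forall w, ~ N w -> f w = g w) -> (\int[mu]_w f w <= \int[mu]_w g w)%E.
  move=> f0 g0 fg; apply/eqP; rewrite eq_le !H// => w Nw.
  by rewrite fg.
move=> f0 g0 fg; rewrite !ge0_integralTE//; apply: ge_ereal_sup => _ [h /= hf <-].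
pose h' := proj_nnsfun h mNC.
have h'E w : h' w = (h \_ (~` N)) w by rewrite -(mrestrict h mNC).
have -> : sintegral mu h = sintegral mu h'.
  have sE (k : {nnsfun T >-> R}) : sintegral mu k = (\int[mu]_w (k w)%:E)%E.
    by rewrite integral_nnsfun// patch_setT.
  rewrite !sE; apply: ge0_ae_eq_integral => //.
  - by apply/measurable_EFinP; exact: measurable_funP.
  - by apply/measurable_EFinP; exact: measurable_funP.
  - by move=> w _; rewrite lee_fin.
  - by move=> w _; rewrite lee_fin.
  exists N; split => // w /= h1; apply: contrapT => Nw; apply: h1 => _.
  by congr EFin; apply: (etrans _ (esym (h'E w))); rewrite patchE mem_set.
apply: ereal_sup_ubound; exists h' => //= w; rewrite [X in (X%:E <= _)%E](h'E w) patchE.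
case: ifPn => [/set_mem Nw|_]; last exact: g0.
by rewrite -fg//; exact: hf.
Qed.

End integral_off_negligible.

(** * The discount factor of a hitting time as an exponential probability *)

Section discounted_sup.
Context {R : realType}.
Variables (q : R) (q0 : 0 < q).

Definition disc (t : \bar R) : \bar R := match t with EFin t => (expR (- q * t))%:E | _ => 0%E end.

(** The times by which [S] has been visited. Its exponential probability is the discount factor at
    the infimum of [S], whether or not the infimum is attained. *)
Definition upset (S : set R) : set R := [set s | exists2 u, S u & u <= s].

Let inf_cases (S : set R) : (forall u, S u -> 0 <= u) ->
  S = set0 \/ exists k, [/\ 0 <= k, ereal_inf [set t%:E | t in S] = k%:E,
    `]k, +oo[%classic `<=` upset S & upset S `<=` `[k, +oo[%classic].
Proof.
move=> S0; have [->|/set0P[u Su]] := eqVneq S set0; [by left|right].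
have hl : lbound [set t%:E | t in S] 0%E by move=> _ [t St <-]; rewrite lee_fin S0.
have i0 : (0 <= ereal_inf [set t%:E | t in S])%E by exact: le_ereal_inf_tmp.
have iu : (ereal_inf [set t%:E | t in S] <= u%:E)%E by apply: ereal_inf_lbound; exists u.
case iE : (ereal_inf _) i0 iu => [k| |] //; rewrite !lee_fin => k0 ku.
exists k; split => // [s|s]; rewrite /= in_itv/= andbT.
  move=> ks; apply: contrapT => h.
  suff : (s%:E <= k%:E)%E by rewrite lee_fin leNgt ks.
  rewrite -iE; apply: le_ereal_inf_tmp => _ [t St <-]; rewrite lee_fin leNgt; apply/negP => ts.
  by apply: h; exists t => //; exact: ltW.
move=> [t St ts]; rewrite -lee_fin -iE; apply: (@le_trans _ _ t%:E); last by rewrite lee_fin.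
by apply: ereal_inf_lbound; exists t.
Qed.

Lemma measurable_upset S : measurable (upset S).
Proof.
apply: is_interval_measurable => s t [u Su us] _ v /andP[sv _].
by exists u => //; exact: le_trans sv.
Qed.

Lemma expo_upset S : (forall u, S u -> 0 <= u) ->
  expo q0 (upset S) = disc (ereal_inf [set t%:E | t in S]).
Proof.
move=> S0; have [->|[k [k0 -> h1 h2]]] := inf_cases S0.
  rewrite image_set0 ereal_inf0 /= (_ : upset set0 = set0) ?measure0//.
  by apply/seteqP; split => // s [].
apply/eqP; rewrite eq_le; apply/andP; split; rewrite /disc.
  rewrite -(expo_ge q0 k0); apply: le_measure; rewrite ?inE//; exact: measurable_upset.
rewrite -(expo_gt q0 k0); apply: le_measure; rewrite ?inE//; exact: measurable_upset.
Qed.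

(** The form that yields measurability: for a countable family of candidate times it is a countable
    supremum. *)
Lemma expo_upset_sup S : (forall u, S u -> 0 <= u) ->
  expo q0 (upset S) = ereal_sup ([set 0%E] `|` [set (expR (- q * u))%:E | u in S]).
Proof.
move=> S0; apply/eqP; rewrite eq_le; apply/andP; split; last first.
  apply: ge_ereal_sup => _ [->|[u Su <-]]; first exact: measure_ge0.
  rewrite -(expo_ge q0 (S0 _ Su)); apply: le_measure; rewrite ?inE//; first exact: measurable_upset.
  by move=> s; rewrite /= in_itv/= andbT => us; exists u.
rewrite expo_upset//; have [->|[k [k0 kE _ _]]] := inf_cases S0.
  by rewrite image_set0 ereal_inf0 /=; apply: ereal_sup_ubound; left.
rewrite kE /disc; apply/lee_addgt0Pr => e e0.
pose M := expR (- q * k) - e; have [M0|M0] := leP M 0.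
  apply: (@le_trans _ _ (0 + e%:E)%E); first by rewrite add0e lee_fin -subr_le0.
  by apply: leeD2r; apply: ereal_sup_ubound; left.
(* [- ln M / q] is the time at which the discount factor equals [M]; since [M] is below the factor
   at [k], this time is later than [k]. *)
have kM : k < - ln M / q.
  rewrite ltr_pdivlMr// ltrNr -ltr_expR lnK ?posrE// -mulrN mulrC.
  by rewrite /M ltrBlDr ltrDl.
have [u Su uM] : exists2 u, S u & u < - ln M / q.
  apply: contrapT => h; suff : ((- ln M / q)%:E <= k%:E)%E by rewrite lee_fin leNgt kM.
  rewrite -kE; apply: le_ereal_inf_tmp => _ [u Su <-]; rewrite lee_fin leNgt; apply/negP => uM.
  by apply: h; exists u.
apply: (@le_trans _ _ ((expR (- q * u))%:E + e%:E)%E); last first.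
  by apply: leeD2r; apply: ereal_sup_ubound; right; exists u.
rewrite -EFinD lee_fin -lerBlDr -/M -[M]lnK ?posrE// ler_expR mulNr lerNr mulrC.
by rewrite -ler_pdivlMr// ltW.
Qed.

End discounted_sup.

Section discounted_measurability.
Context {R : realType} d (T : measurableType d).
Variables (q : R) (q0 : 0 < q).

Lemma expo_max0 (g : R -> \bar R) : measurable_fun setT g -> (forall s, (0 <= g s)%E) ->
  (\int[expo q0]_s g s = \int[expo q0]_s g (Num.max s 0)%R)%E.
Proof.
move=> mg g0; have mm : measurable_fun setT (fun s : R => Num.max s 0).
  exact: measurable_maxr.
apply: ge0_ae_eq_integral => //; first exact: (measurableT_comp mg mm).
exists `]-oo, 0[%classic; split => //; first exact: expo_lt0.
move=> s /= h; rewrite in_itv/= ltNge; apply/negP => s0; apply: h => _.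
by rewrite max_l.
Qed.

Lemma measurable_expo_integral (Y : R -> T -> R) :
  (forall t, 0 <= t -> measurable_fun setT (Y t)) ->
  (forall t w, 0 <= t -> Y ^~ w @ t^'+ --> Y t w) ->
  (forall t w, 0 <= t -> 0 <= Y t w) ->
  measurable_fun setT (fun w => \int[expo q0]_s (Y (Num.max s 0)%R w)%:E)%E.
Proof.
move=> mY rcY Y0.
have mj : measurable_fun setT (fun p : T * R => Y (Num.max p.2 0) p.1).
  apply: (@measurable_at_right R _ (T * R)%type (fun p => Num.max p.2 0) _ (fun t p => Y t p.1)).
  - by apply: measurable_maxr => //; exact: measurable_snd.
  - by move=> t t0; apply: (measurableT_comp (mY t t0)); exact: measurable_fst.
  - by move=> p; rewrite le_max lexx orbT.
  - by move=> t p t0; exact: rcY.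
apply: (measurable_fun_fubini_tonelli_F (m2 := expo q0) (fun p : T * R => (Y (Num.max p.2 0) p.1)%:E)).
  exact/measurable_EFinP.
by move=> p; rewrite lee_fin Y0// le_max lexx orbT.
Qed.

End discounted_measurability.

(** * Discounted fall times *)

Section hitting_functional.
Context {R : realType}.
Variables (J : pred nat) (q : R) (q0 : 0 < q) (b : R).

(** [J] selects the admissible dates, counted from [k]: all of them for the weights of the duality,
    only [k] itself when measuring the fall from one date. *)
Definition hitting (f : R -> R) (T : nat -> R) (k : nat) : set R :=
  [set u | exists j, [/\ (k <= j)%N, J (j - k)%N, T j <= u & f u - f (T j) < - b]].

Definition path_val (g : pathT R (R + nat)) (u : R) : R := g (inl u).

Definition arr (j : nat) (g : pathT R (R + nat)) : R := arrival (fun i => g (inr i)) j.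

Definition start_value (j : nat) (g : pathT R (R + nat)) : \bar R :=
  limn_esup (fun i => (path_val g (gup i (arr j g)))%:E).

Definition Psi_term (p : nat * nat * nat) (g : pathT R (R + nat)) : \bar R :=
  let: (j, n, m) := p in
  if J j && (arr j g <= gpt n m) then
    if ((path_val g (gpt n m) + b)%:E < start_value j g)%E
    then (expR (- q * gpt n m))%:E else 0%E
  else 0%E.

(* The discount factor at the first time at which the path [g] falls more than
   [b] below the value it had at an earlier arrival date with index in [J]; the supremum is
   over rational times and [start_value] is a limit along rationals, for the
   sake of measurability. *)
Definition Psi (g : pathT R (R + nat)) : \bar R :=
  ereal_sup (range (fun i : nat => oapp (Psi_term ^~ g) 0%E (unpickle i))).

Lemma measurable_arr j : measurable_fun setT (arr j).
Proof. by apply: measurable_sum => i; exact: measurable_coord. Qed.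

Lemma measurable_start_value j : measurable_fun setT (start_value j).
Proof.
apply: (@measurable_fun_limn_esup _ (pathT R (R + nat)) R setT
  (fun i (g : pathT R (R + nat)) => (path_val g (gup i (arr j g)))%:E)) => i.
apply/measurable_EFinP.
apply: (@measurable_at_gup R _ (pathT R (R + nat)) (arr j) (measurable_arr j) (fun t g => path_val g t)).
by move=> t _; exact: (measurable_coord (inl t)).
Qed.

Lemma measurable_Psi_term p : measurable_fun setT (Psi_term p).
Proof.
case: p => [[j n] m]; rewrite /Psi_term; case: (J j) => /=; last exact: measurable_cst.
apply: measurable_fun_ifT => //.
  apply: (@measurable_fun_bool _ _ setT _ true) => //; rewrite setTI.
  by apply: measurable_ler_set => //; exact: measurable_arr.
apply: measurable_fun_ifT => //; apply: measurable_fun_lte; last exact: measurable_start_value.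
by apply/measurable_EFinP; apply: measurable_funD => //; exact: (measurable_coord (inl _)).
Qed.

Lemma measurable_Psi : measurable_fun setT Psi.
Proof.
pose h (i : nat) g := oapp (Psi_term ^~ g) 0%E (unpickle i).
rewrite (_ : Psi = fun g => esups (h ^~ g) 0%N); last first.
  apply/funext => g; rewrite /esups/= /Psi /sdrop; congr ereal_sup.
  by apply/seteqP; split => y [i _ <-]; exists i.
apply: measurable_fun_esups => i; rewrite /h; case: (unpickle i) => [p|] //=.
exact: measurable_Psi_term.
Qed.

Lemma Psi_term_ge0 p g : (0 <= Psi_term p g)%E.
Proof. by case: p => [[j n] m]; rewrite /Psi_term; case: ifP => // _; case: ifP => // _; rewrite lee_fin expR_ge0. Qed.

Lemma Psi_ge0 g : (0 <= Psi g)%E.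
Proof.
apply: le_trans (ereal_sup_ubound _); last by exists 0%N.
by case: (unpickle _) => //= p; exact: Psi_term_ge0.
Qed.

(** The fall is defined by a strict inequality, so by right-continuity it persists at grid times
    just after it. Restricting to grid times therefore leaves the infimum unchanged. *)
Lemma PsiE g : (forall t, 0 <= t -> path_val g @ t^'+ --> path_val g t) ->
  (forall j, 0 <= arr j g) ->
  Psi g = expo q0 (upset (hitting (path_val g) (fun j => arr j g) 0)).
Proof.
move=> rg ag; pose S := hitting (path_val g) (fun j => arr j g) 0.
have VE j : start_value j g = (path_val g (arr j g))%:E.
  apply: (cvg_limn_einf_sup _).2; apply: cvg_EFin; first exact: nearW.
  by apply: (cvg_gup_right (f := path_val g)) => //; exact: rg.
have S0 u : S u -> 0 <= u by move=> [j [_ _ + _]]; exact: le_trans.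
pose Sd := [set u | S u /\ exists n m, u = gpt n m].
have Sd0 u : Sd u -> 0 <= u by move=> [/S0].
have -> : Psi g = expo q0 (upset Sd).
  rewrite expo_upset_sup//; apply/eqP; rewrite eq_le; apply/andP; split.
    apply: ge_ereal_sup => _ [i _ <-]; apply: ereal_sup_ubound.
    case: (unpickle i) => [[[j n] m]|]/=; last by left.
    case: ifPn => [/andP[Jj h1]|_]; last by left.
    case: ifPn => h2; last by left.
    right; exists (gpt n m) => //; split; last by exists n, m.
    by exists j; rewrite subn0; split => //; move: h2; rewrite VE lte_fin; lra.
  apply: ge_ereal_sup => y [->|[u [[j [_ Jj h1 h2]] [n [m uE]]] <-]]; first exact: Psi_ge0.
  apply: ereal_sup_ubound; exists (pickle (j, n, m)) => //.
  rewrite subn0 in Jj; rewrite pickleK/= -uE Jj h1 ifT//.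
  by rewrite VE lte_fin; lra.
rewrite !expo_upset//; congr (disc q _); apply/eqP; rewrite eq_le; apply/andP; split; last first.
  by apply: le_ereal_inf => _ [u [Su _] <-]; exists u.
apply: le_ereal_inf_tmp => _ [u Su <-]; apply/lee_addgt0Pr => e e0.
have u0 := S0 _ Su; case: Su => j [_ Jj h1 h2].
have /cvgrPdist_lt/(_ e e0)[n1 _ c1] := cvg_gup u0.
have d0 : 0 < - b - (path_val g u - path_val g (arr j g)) by lra.
have /cvgrPdist_lt/(_ _ d0)[n2 _ c2] := cvg_gup_right (f := path_val g) u0 (rg u u0).
pose n := maxn n1 n2; have {}c1 := c1 n (leq_maxl _ _); have {}c2 := c2 n (leq_maxr _ _).
have un := gup_ge n u0.
apply: (@le_trans _ _ (gup n u)%:E).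
  apply: ereal_inf_lbound; exists (gup n u) => //; split; last by exists n, (gidx n u).+1.
  exists j; split => //; first exact: le_trans un.
  by move: c2; rewrite /= ltr_distlC => /andP[_]; lra.
by move: c1; rewrite /= ltr_distlC => /andP[_ c1]; rewrite -EFinD lee_fin ltW.
Qed.

End hitting_functional.

Lemma hit_upset {R : realType} (b : R) f T k : [set s | hit f T b k s] = upset (hitting xpredT b f T k).
Proof.
apply/seteqP; split => s /= [].
  by move=> j [u [h1 h2 h3 h4]]; exists u => //; exists j.
by move=> u [j [h1 _ h2 h3]] us; exists j, u; split.
Qed.

Section expo_hit.
Context {R : realType} {d : measure_display} {Omega : measurableType d}.
Variables (P : probability Omega R) (X : R -> Omega -> R) (E : nat -> Omega -> R).
Hypothesis levyX : levy_process P X.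
Hypothesis E_gt0 : forall k w, 0 < E k w.
Variables (q : R) (q0 : 0 < q).

Lemma arr_post k j w : arr j (post X E k w) = T_of E (k + j) w - T_of E k w.
Proof.
elim: j => [|j ih]; first by rewrite addn0 subrr /arr /arrival big_ord0.
rewrite /arr /arrival big_ord_recr/= -[X in X + _]/(arr j (post X E k w)) ih.
by rewrite addnS T_ofS /post /post_at /tail_seq addrAC.
Qed.

Lemma post_inl k u w : 0 <= u -> path_val (post X E k w) u = X (T_of E k w + u) w - X (T_of E k w) w.
Proof. by move=> u0; rewrite /path_val /post /post_at /postX max_l. Qed.

Lemma cvg_post_inl k t w : 0 <= t -> path_val (post X E k w) @ t^'+ --> path_val (post X E k w) t.
Proof.
move=> t0; apply/at_right_epsP => e e0.
have T0 := T_of_ge0 E_gt0 k w.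
have /at_right_epsP/(_ e e0)[r r0 hr] := levy_right levyX (w := w) (addr_ge0 T0 t0).
exists r => // s ts st; rewrite !post_inl//; last exact: le_trans (ltW ts).
by rewrite opprB addrA subrK; apply: hr; lra.
Qed.

(** The bridge from the pathwise weight to the Markov property: by memorylessness, a fall counted
    from [T_k] costs the factor [e^{-q T_k}] and a functional of the path after [T_k] alone. *)
Lemma expo_hitting J b k w : expo q0 (upset (hitting J b (X ^~ w) (T_of E ^~ w) k)) =
  ((expR (- q * T_of E k w))%:E * Psi J q b (post X E k w))%E.
Proof.
have T0 := T_of_ge0 E_gt0 k w.
have mono j : T_of E k w <= T_of E (k + j) w by apply: (T_of_le E_gt0); exact: leq_addr.
rewrite (PsiE J q0); last 2 first.
- by move=> t t0; exact: cvg_post_inl.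
- by move=> j; rewrite arr_post subr_ge0.
set S := hitting J b (path_val _) _ 0%N.
have mS := measurable_upset S.
rewrite -[X in (_ * expo q0 X)%E]setIT -(integral_indic (expo q0) measurableT mS).
rewrite -(expo_shift q0 T0); last 2 first.
- by apply/measurable_EFinP; exact: measurable_indic.
- by move=> s; rewrite lee_fin.
rewrite -[X in expo q0 X]setIT -(integral_indic (expo q0) measurableT); last exact: measurable_upset.
apply: eq_integral => s _.
have SE u : 0 <= u -> S u <-> hitting J b (X ^~ w) (T_of E ^~ w) k (T_of E k w + u).
  move=> u0; split=> [[j [_ Jj h1 h2]]|[j [kj Jj h1 h2]]].
    rewrite subn0 in Jj; exists (k + j)%N; rewrite addKn; split => //; first exact: leq_addr.
      by move: h1; rewrite arr_post; lra.
    move: h2; rewrite arr_post !post_inl// ?subr_ge0//; have -> : T_of E k w + (T_of E (k + j) w - T_of E k w) = T_of E (k + j) w by lra.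
    by rewrite opprB addrA subrK.
  exists (j - k)%N; rewrite subn0 arr_post subnKC//; split => //; first lra.
  rewrite !post_inl//; last by rewrite subr_ge0 (T_of_le E_gt0).
  have -> : T_of E k w + (T_of E j w - T_of E k w) = T_of E j w by lra.
  by rewrite opprB addrA subrK.
have [sT|Ts] := ltP s (T_of E k w).
  rewrite indicE memNset// => -[u [j [kj _ h1 _]] us].
  by have := lt_le_trans sT (le_trans (T_of_le E_gt0 w kj) (le_trans h1 us)); rewrite ltxx.
congr (_%:E); rewrite !indicE; congr ((_ : bool)%:R).
apply/idP/idP => /set_mem[u Su us]; apply/mem_set.
  have uT : T_of E k w <= u.
    by case: Su => j [kj _ h1 _]; exact: le_trans (T_of_le E_gt0 w kj) h1.
  exists (u - T_of E k w); last by rewrite lerD2r.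
  by apply/SE; rewrite ?subr_ge0// addrC subrK.
have u0 : 0 <= u.
  by case: Su => j [_ _ + _]; rewrite arr_post; apply: le_trans; rewrite subr_ge0.
exists (T_of E k w + u); last by rewrite -lerBrDl.
exact/SE.
Qed.

End expo_hit.

(** * The duality in expectation *)

Section series.
Context {R : realType}.

Lemma measurable_nneseries d (T : measurableType d) (h : nat -> T -> \bar R) :
  (forall k w, (0 <= h k w)%E) -> (forall k, measurable_fun setT (h k)) ->
  measurable_fun setT (fun w => \sum_(0 <= k <oo) h k w)%E.
Proof.
move=> h0 mh; have := @ge0_emeasurable_sum _ _ R setT h xpredT (fun k w _ _ => h0 k w) (fun k _ => mh k).
by congr (measurable_fun _ _); apply/funext => w; apply: eq_eseriesl.
Qed.

Lemma nneseries_trunc (u : nat -> R) n : (forall k, 0 <= u k) -> (forall k, (n <= k)%N -> u k = 0) ->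
  (\sum_(0 <= k <oo) (u k)%:E = (\sum_(k < n) u k)%:E)%E.
Proof.
move=> u0 un; rewrite (nneseries_split 0 n); last by move=> k _; rewrite lee_fin.
rewrite add0n eseries0 ?adde0; last by move=> k nk _; rewrite un.
by rewrite big_mkord sumEFin.
Qed.

End series.

Section integrated_duality.
Context {R : realType} {d : measure_display} {Omega : measurableType d}.
Variables (P : probability Omega R) (X : R -> Omega -> R) (E : nat -> Omega -> R).
Hypothesis levyX : levy_process P X.
Hypothesis E_gt0 : forall k w, 0 < E k w.
Variables (q : R) (q0 : 0 < q) (a x : R) (a0 : 0 <= a) (x0 : 0 <= x).

Let cX w : cadlag (X ^~ w). Proof. by case: levyX. Qed.

Lemma T_of_bracket w t : (forall t, exists k, t < T_of E k w) -> 0 <= t ->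
  exists n, T_of E n w <= t /\ t < T_of E n.+1 w.
Proof.
move=> unb t0; have [k0 hk0] := unb t; have ex : exists k, t < T_of E k w by exists k0.
case: (ex_minnP ex) => -[|m]; first by rewrite T_of0 ltNge t0.
move=> tm mmin; exists m; split => //; rewrite leNgt; apply/negP => /mmin.
by rewrite ltnn.
Qed.

Lemma sR_homo N w : {homo sR X E a x N ^~ w : s t / s <= t}.
Proof. exact/rsup_homo/cadlag_skY. Qed.

Lemma sR_rc N w : right_continuous (sR X E a x N ^~ w).
Proof. exact/rsup_right_continuous/cadlag_skY. Qed.

Lemma sR_neg N w t : t < 0 -> sR X E a x N t w = 0.
Proof. by move=> t0; rewrite /sR /skR rsup_neg. Qed.

Lemma sR_ge0 N w t : 0 <= sR X E a x N t w.
Proof. exact/rsup_ge0/cadlag_skY. Qed.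

Lemma hit_neg b w k s : s < 0 -> ~ hit (X ^~ w) (T_of E ^~ w) b k s.
Proof.
move=> s0 [j [u [_ h1 h2 _]]].
by have := lt_le_trans s0 (le_trans (T_of_ge0 E_gt0 j w) (le_trans h1 h2)); rewrite ltxx.
Qed.

Let measurable_hit b w k c : measurable_fun setT
  (fun s => (if `[< hit (X ^~ w) (T_of E ^~ w) b k s >] then c else 0)%:E : \bar R).
Proof.
apply/measurable_EFinP; apply: measurable_fun_ifT => //.
apply: (@measurable_fun_bool _ _ setT _ true) => //; rewrite setTI.
rewrite (_ : _ @^-1` _ = [set s | hit (X ^~ w) (T_of E ^~ w) b k s]).
  by rewrite hit_upset; exact: measurable_upset.
by apply/seteqP; split => s /=; move/asboolP.
Qed.

Lemma integral_hit b w k c : 0 <= c ->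
  (\int[expo q0]_s (if `[< hit (X ^~ w) (T_of E ^~ w) b k s >] then c else 0)%:E =
   (expR (- q * T_of E k w) * c)%:E * Psi xpredT q b (post X E k w))%E.
Proof.
move=> c0; rewrite mulrC EFinM -muleA -(expo_hitting levyX E_gt0 q0) -hit_upset.
have mH : measurable [set s | hit (X ^~ w) (T_of E ^~ w) b k s].
  by rewrite hit_upset; exact: measurable_upset.
rewrite -[X in (_ * expo q0 X)%E]setIT -(integral_indic (expo q0) measurableT mH).
rewrite -ge0_integralZl//; last first.
  by apply/measurable_EFinP; exact: measurable_indic.
apply: eq_integral => s _; rewrite -EFinM indicE; congr (_%:E).
by case: asboolP => h; [rewrite mem_set// mulr1|rewrite memNset// mulr0].
Qed.

(** The barrier injections appear only in the version stopped after [N] payments, which is adapted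
    and right-continuous for every path; [N] goes to infinity once expectations are taken. *)
Lemma integrated_duality b N w (l : nat -> R) (F : R -> R) :
  b <= a -> good_path X E w -> (forall k, 0 <= l k) ->
  {homo F : s t / s <= t} -> right_continuous F -> (forall t, t < 0 -> F t = 0) ->
  (forall m u, T_of E m w <= u -> \sum_(k < m) l k - x - X u w <= F u) ->
  (\sum_(0 <= k <oo) (expR (- q * T_of E k.+1 w) * l k)%:E * Psi xpredT q b (post X E k.+1 w) +
     stieltjes_exp q (sR X E a x N ^~ w) <=
   stieltjes_exp q F +
   \sum_(0 <= k <oo) (expR (- q * T_of E k.+1 w) * skdiv a x (X ^~ w) (T_of E ^~ w) k)%:E *
     Psi xpredT q b (post X E k.+1 w) + (a - b)%:E)%E.
Proof.
move=> ba [unb nj] l0 ndF rcF Fneg hF.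
have F0 s : 0 <= F s.
  have [s0|s0] := leP 0 s; last by rewrite Fneg.
  by apply: (@le_trans _ _ (F (-1))); [rewrite Fneg ?oppr_lt0|apply: ndF; lra].
pose f := X ^~ w; pose T := T_of E ^~ w.
pose h (c : nat -> R) k s : R := if `[< hit f T b k.+1 s >] then c k else 0.
have h0 c k s : (forall k, 0 <= c k) -> 0 <= h c k s by move=> c0; rewrite /h; case: ifP.
have mh c k : measurable_fun setT (fun s => (h c k s)%:E) by exact: measurable_hit.
have sd0 k : 0 <= skdiv a x f T k by exact: skdiv_ge0.
have intE c : (forall k, 0 <= c k) ->
    (\sum_(0 <= k <oo) (expR (- q * T k.+1) * c k)%:E * Psi xpredT q b (post X E k.+1 w) =
     \int[expo q0]_s \sum_(0 <= k <oo) (h c k s)%:E)%E.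
  move=> c0; rewrite integral_nneseries//; last by move=> k s _; rewrite lee_fin h0.
  by apply: eq_eseriesr => k _; rewrite integral_hit.
rewrite !intE// (stieltjes_expE q0 (@sR_homo N w) (@sR_rc N w)); last exact: sR_neg.
rewrite (stieltjes_expE q0 ndF rcF Fneg).
have mono (G : R -> R) : {homo G : s t / s <= t} -> measurable_fun setT (fun s => (G s)%:E).
  by move=> ndG; apply/measurable_EFinP; exact: nondecreasing_measurable.
have ser0 c s : (forall k, 0 <= c k) -> (0 <= \sum_(0 <= k <oo) (h c k s)%:E)%E.
  by move=> c0; apply: nneseries_ge0 => k _ _; rewrite lee_fin h0.
have mser c : (forall k, 0 <= c k) -> measurable_fun setT (fun s => \sum_(0 <= k <oo) (h c k s)%:E)%E.
  by move=> c0; apply: measurable_nneseries => // k s; rewrite lee_fin h0.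
have ba0 : (0 <= (a - b)%:E :> \bar R)%E by rewrite lee_fin subr_ge0.
have mR := mono _ (@sR_homo N w); have mF := mono _ ndF.
have R0 s : (0 <= (sR X E a x N s w)%:E)%E by rewrite lee_fin sR_ge0.
have addE (f1 f2 : R -> \bar R) : measurable_fun setT f1 -> (forall s, (0 <= f1 s)%E) ->
    measurable_fun setT f2 -> (forall s, (0 <= f2 s)%E) ->
    (\int[expo q0]_s f1 s + \int[expo q0]_s f2 s = \int[expo q0]_s (f1 s + f2 s))%E.
  by move=> m1 p1 m2 p2; rewrite ge0_integralD.
have sl0 s := ser0 l s l0; have ss0 s := ser0 (skdiv a x f T) s sd0.
have ml := mser l l0; have ms := mser _ sd0.
have F0' s : (0 <= (F s)%:E)%E by rewrite lee_fin.
rewrite (addE _ _ ml sl0 mR R0) (addE _ _ mF F0' ms ss0).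
have cE : (\int[expo q0]_s (a - b)%:E = (a - b)%:E)%E.
  rewrite integral_cst// -[RHS]mule1; congr (_ * _)%E; exact: (probability_setT (expo q0)).
rewrite -[X in (_ <= _ + X)%E]cE.
have m1 := emeasurable_funD ml mR; have m2 := emeasurable_funD mF ms.
have p2 s : (0 <= (F s)%:E + \sum_(0 <= k <oo) (h (skdiv a x f T) k s)%:E)%E by rewrite adde_ge0.
rewrite (addE _ _ m2 p2 (measurable_cst _) (fun=> ba0)).
apply: ge0_le_integral => //.
- by move=> s _; rewrite adde_ge0.
- by apply: emeasurable_funD => //; exact: measurable_cst.
move=> s _; have [s0|s0] := leP 0 s; last first.
  rewrite sR_neg// Fneg// !eseries0; last 2 first.
  - by move=> k _ _; rewrite /h asboolF//; exact: hit_neg.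
  - by move=> k _ _; rewrite /h asboolF//; exact: hit_neg.
  by rewrite !add0e.
have [n [ns sn]] := T_of_bracket unb s0.
(* Term [k] is the payment at [T k.+1], which is after [s] for [k >= n]; its weight then vanishes
   and the series is the finite sum of [duality]. *)
have hn c k : (n <= k)%N -> h c k s = 0.
  move=> nk; rewrite /h asboolF// => -[j [u [kj h1 h2 _]]].
  have := lt_le_trans sn (T_of_le E_gt0 w (leq_trans (nk : (n.+1 <= k.+1)%N) kj)).
  by rewrite ltNge (le_trans h1).
  have trE c : (forall k, 0 <= c k) -> (\sum_(0 <= k <oo) (h c k s)%:E = (\sum_(k < n) h c k s)%:E)%E.
    by move=> c0; apply: nneseries_trunc => k; [exact: h0|exact: hn].
  rewrite (trE l)// (trE (skdiv a x f T))//.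
rewrite -!EFinD lee_fin.
have ltT k : T k < T k.+1 by exact: T_of_lt.
have D := @duality R a x f T (cX w) a0 x0 (levy0 levyX w) (T_of0 E w) ltT nj n s b l (F s)
  ns sn ba l0 (F0 s).
apply: le_trans (D _); last first.
  by move=> m u mn mu us; apply: (le_trans (hF m u mu)); exact: ndF.
rewrite lerD2l /sR -/f -/T.
(* With fewer payments less is injected; payments after [s] do not affect the injection up to
   [s]. *)
have [Nn|nN] := leqP N n; first by exact: (@skR_homo _ a x f T (cX w)).
by rewrite (@skR_before _ a x f T ltT N n)// ltnW.
Qed.

End integrated_duality.

Section expected_duality.
Context {R : realType} {d : measure_display} {Omega : measurableType d}.
Variables (P : probability Omega R) (X : R -> Omega -> R) (E : nat -> Omega -> R).
Hypothesis levyX : levy_process P X.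
Hypothesis mE : forall k, measurable_fun setT (E k).
Hypothesis E_gt0 : forall k w, 0 < E k w.
Hypothesis E_law : forall k (B : set R), measurable B ->
  P (E k @^-1` B) = P (E 0%N @^-1` B).
Hypothesis E_indep : forall n, mutually_indep P n E.
Hypothesis XE : indep_sigma P (gen_X X) (gen_N E).
Variables (q : R) (q0 : 0 < q).

(** One integrand per payment covers both a given strategy, as a constant family, and the barrier
    strategy through [rho_barrier]. *)
Definition payments (rhos : nat -> R -> Omega -> R) : \bar R :=
  (\sum_(0 <= k <oo) \int[P]_w (disc_div E q (rhos k) k.+1 w)%:E)%E.

Definition injections (F : R -> Omega -> R) : \bar R := (\int[P]_w stieltjes_exp q (F ^~ w))%E.

(** The constant [c_b], as a functional of the path from time 0; [ruin_ltE] identifies it with the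
    ruin transform of the statement started at the barrier. *)
Definition fall_lt (b : R) : R := fine (\int[P]_w Psi xpredT q b (post X E 0 w))%E.

Lemma Psi_post_le1 b k w : (Psi xpredT q b (post X E k w) <= 1)%E.
Proof.
rewrite (PsiE _ q0); first exact: probability_le1 (measurable_upset _).
- by move=> t t0; exact: (cvg_post_inl levyX E_gt0).
- by move=> j; rewrite arr_post subr_ge0; apply: (T_of_le E_gt0); exact: leq_addr.
Qed.

Lemma measurable_Psi_post b k : measurable_fun setT (fun w => Psi xpredT q b (post X E k w)).
Proof. exact: measurableT_comp (measurable_Psi xpredT q b) (measurable_post levyX mE E_gt0 k). Qed.

Lemma fall_ltE b : (\int[P]_w Psi xpredT q b (post X E 0 w) = (fall_lt b)%:E)%E.
Proof.
rewrite fineK// ge0_fin_numE; last by apply: integral_ge0 => w _; exact: Psi_ge0.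
apply: (@le_lt_trans _ _ (\int[P]_w 1)%E); last first.
  by rewrite integral_cst//= probability_setT mule1 ltry.
apply: ge0_le_integral => //; [by move=> w _; exact: Psi_ge0|exact: measurable_Psi_post|].
by move=> w _; exact: Psi_post_le1.
Qed.

Lemma fall_lt_ge0 b : 0 <= fall_lt b.
Proof. by apply: fine_ge0; apply: integral_ge0 => w _; exact: Psi_ge0. Qed.

Lemma measurable_stieltjes (Y : R -> Omega -> R) : (forall t, 0 <= t -> measurable_fun setT (Y t)) ->
  (forall w, {homo Y ^~ w : s t / s <= t}) -> (forall w, right_continuous (Y ^~ w)) ->
  (forall t w, t < 0 -> Y t w = 0) ->
  measurable_fun setT (fun w => stieltjes_exp q (Y ^~ w)) /\
  forall w, (0 <= stieltjes_exp q (Y ^~ w))%E.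
Proof.
move=> mY ndY rcY Yneg.
have Y0 t w : 0 <= Y t w.
  have [t0|t0] := leP 0 t; last by rewrite Yneg.
  by apply: (@le_trans _ _ (Y (-1) w)); [rewrite Yneg ?oppr_lt0|apply: ndY; lra].
split; last first.
  by move=> w; rewrite (stieltjes_expE q0)//; [apply: integral_ge0 => s _; rewrite lee_fin|move=> t; exact: Yneg].
have := measurable_expo_integral q0 mY (fun t w _ => rcY w t) (fun t w _ => Y0 t w).
congr (measurable_fun _ _); apply/funext => w; rewrite (stieltjes_expE q0)//; last first.
  by move=> t; exact: Yneg.
have mYw : measurable_fun setT (fun s => (Y s w)%:E).
  by apply/measurable_EFinP; apply: nondecreasing_measurable => //; exact: ndY.
by rewrite (expo_max0 q0 mYw)// => s; rewrite lee_fin.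
Qed.

Lemma markov_series (rhos : nat -> R -> Omega -> R) b : (forall k, adapted X E (rhos k)) ->
  (forall k w, caglad (rhos k ^~ w)) -> (forall k t w, 0 <= t -> 0 <= rhos k t w) ->
  (\int[P]_w \sum_(0 <= k <oo) (disc_div E q (rhos k) k.+1 w)%:E * Psi xpredT q b (post X E k.+1 w) =
   (fall_lt b)%:E * payments rhos)%E.
Proof.
move=> ar cr r0; have D0 k w : 0 <= disc_div E q (rhos k) k.+1 w.
  by rewrite mulr_ge0 ?expR_ge0// r0// T_of_ge0.
rewrite integral_nneseries//; last 2 first.
- move=> k; apply: emeasurable_funM; last exact: measurable_Psi_post.
  by apply/measurable_EFinP; exact: (measurable_disc_div levyX mE E_gt0).
- by move=> k w _; rewrite mule_ge0 ?lee_fin//; exact: Psi_ge0.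
rewrite /payments -nneseriesZl; last by move=> k _; apply: integral_ge0 => w _; rewrite lee_fin.
apply: eq_eseriesr => k _.
rewrite (markov_integral levyX mE E_gt0 E_law E_indep XE)//; last 2 first.
- exact: measurable_Psi.
- exact: Psi_ge0.
  by rewrite muleC fall_ltE.
exact: r0.
Qed.

Lemma le_Ldiv (rho : R -> Omega -> R) m u w : (forall t, 0 <= t -> 0 <= rho t w) -> T_of E m w <= u ->
  ((\sum_(k < m) rho (T_of E k.+1 w) w)%:E <= Ldiv E rho u w)%E.
Proof.
move=> rho0 mu; rewrite /Ldiv.
have h := @nneseries_lim_ge R (fun k => (rho (T_of E k.+1 w) w)%:E) (fun k => T_of E k.+1 w <= u) 0 m.
apply: le_trans (h _); last by move=> k _ _; rewrite lee_fin rho0// T_of_ge0.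
rewrite [leRHS]big_mkcond big_mkord -sumEFin; apply: lee_sum => k _.
by rewrite ifT// (le_trans _ mu)// (T_of_le E_gt0).
Qed.

Variables (a x : R) (a0 : 0 <= a) (x0 : 0 <= x).

(** Payment number [k] is already present after [k.+1] windows, so a finite sum of adapted caglad
    pieces suffices for each payment. *)
Definition rho_barrier (k : nat) := rho_trunc X E a x k.+1.

Lemma sR_properties N : [/\ forall t, 0 <= t -> measurable_fun setT (sR X E a x N t),
  forall w, {homo sR X E a x N ^~ w : s t / s <= t},
  forall w, right_continuous (sR X E a x N ^~ w) &
  forall t w, t < 0 -> sR X E a x N t w = 0].
Proof.
split=> [t t0|w|w|t w].
- have [_ [aR _] _] := cad_adapted_sLRU levyX E_gt0 a x N.
  exact: (adapted_measurable levyX mE aR t0).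
- by move=> s t; exact: (sR_homo E levyX).
- exact: (sR_rc levyX).
- exact: sR_neg.
Qed.

Lemma expected_duality b N (rho Rp : R -> Omega -> R) : b <= a -> admissible P q X E x rho Rp ->
  ((fall_lt b)%:E * payments (fun=> rho) + injections (sR X E a x N) <=
   injections Rp + (fall_lt b)%:E * payments rho_barrier + (a - b)%:E)%E.
Proof.
move=> ba [[ar [cr r0]] aR [ndR [rcR Rneg]] _ [N2 [mN2 N20 hN2]]].
have [N1 [mN1 N10 hN1]] := ae_good_path levyX mE E_gt0 E_law E_indep XE.
have [msR hsR rsR nsR] := sR_properties N.
have [mS S0] := measurable_stieltjes msR hsR rsR nsR.
have mRp t : 0 <= t -> measurable_fun setT (Rp t) by exact: (adapted_measurable levyX mE aR).
have [mF F0] := measurable_stieltjes mRp ndR rcR Rneg.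
have ab k : adapted X E (rho_barrier k) by exact: (adapted_rho_trunc levyX).
have cb k w : caglad (rho_barrier k ^~ w) by exact: (caglad_rho_trunc levyX).
have b0 k t w : 0 <= t -> 0 <= rho_barrier k t w by move=> _; exact: rho_trunc_ge0.
rewrite -(markov_series b (fun=> ar) (fun=> cr) (fun=> r0)) -(markov_series b ab cb b0).
pose g (rhos : nat -> R -> Omega -> R) w :=
  (\sum_(0 <= k <oo) (disc_div E q (rhos k) k.+1 w)%:E * Psi xpredT q b (post X E k.+1 w))%E.
have g0 rhos : (forall k t w, 0 <= t -> 0 <= rhos k t w) -> forall w, (0 <= g rhos w)%E.
  move=> r1 w; apply: nneseries_ge0 => k _ _; rewrite mule_ge0 ?Psi_ge0// lee_fin.
  by rewrite mulr_ge0 ?expR_ge0// r1// T_of_ge0.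
have mg rhos : (forall k, adapted X E (rhos k)) -> (forall k w, caglad (rhos k ^~ w)) ->
    (forall k t w, 0 <= t -> 0 <= rhos k t w) -> measurable_fun setT (g rhos).
  move=> a1 c1 r1; apply: measurable_nneseries => [k w|k].
    by rewrite mule_ge0 ?Psi_ge0// lee_fin mulr_ge0 ?expR_ge0// r1// T_of_ge0.
  apply: emeasurable_funM; last exact: measurable_Psi_post.
  by apply/measurable_EFinP; exact: (measurable_disc_div levyX mE E_gt0).
have m1 := mg _ (fun=> ar) (fun=> cr) (fun=> r0); have p1 := g0 _ (fun=> r0).
have m2 := mg _ ab cb b0; have p2 := g0 _ b0.
have ba0 : (0 <= (a - b)%:E :> \bar R)%E by rewrite lee_fin subr_ge0.
have cE : (\int[P]_w (a - b)%:E = (a - b)%:E)%E.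
  rewrite integral_cst// -[RHS]mule1; congr (_ * _)%E; exact: probability_setT.
have addE (f1 f2 : Omega -> \bar R) : measurable_fun setT f1 -> (forall s, (0 <= f1 s)%E) ->
    measurable_fun setT f2 -> (forall s, (0 <= f2 s)%E) ->
    (\int[P]_s f1 s + \int[P]_s f2 s = \int[P]_s (f1 s + f2 s))%E.
  by move=> h1 h2 h3 h4; rewrite ge0_integralD.
rewrite -[X in (_ <= _ + X)%E]cE /injections (addE _ _ m1 p1 mS S0) (addE _ _ mF F0 m2 p2).
have m3 := emeasurable_funD m1 mS; have m4 := emeasurable_funD mF m2.
rewrite (addE _ _ m4 _ (measurable_cst _) (fun=> ba0)); last by move=> w; rewrite adde_ge0.
apply: ae_ge0_le_integral => //.
- by move=> w _; rewrite adde_ge0.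
- by move=> w _; rewrite !adde_ge0.
- by apply: emeasurable_funD => //; exact: measurable_cst.
exists (N1 `|` N2); split; first exact: measurableU.
  apply/(negligibleP P (measurableU _ _ mN1 mN2)).
  by apply: negligibleU; [exact/(negligibleP P mN1)|exact/(negligibleP P mN2)].
move=> w; apply: contraPP => /not_orP[nN1 nN2] /=; apply; move=> _.
have gw := hN1 w nN1.
have con : forall t, 0 <= t -> (0 <= (x + X t w + Rp t w)%:E - Ldiv E rho t w)%E.
  by apply: contrapT => h; apply: nN2; exact: hN2.
rewrite /g /rho_barrier /disc_div.
have -> : (\sum_(0 <= k <oo) (expR (- q * T_of E k.+1 w) * rho_trunc X E a x k.+1 (T_of E k.+1 w) w)%:E * Psi xpredT q b (post X E k.+1 w) =
  \sum_(0 <= k <oo) (expR (- q * T_of E k.+1 w) * skdiv a x (X ^~ w) (T_of E ^~ w) k)%:E * Psi xpredT q b (post X E k.+1 w))%E.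
  by apply: eq_eseriesr => k _; rewrite (rho_trunc_T X E_gt0) ltnSn.
apply: (@integrated_duality _ _ _ P X E levyX E_gt0 q q0 a x a0 x0 b N w (fun k => rho (T_of E k.+1 w) w) (Rp ^~ w)) => //.
- by move=> k; rewrite r0// T_of_ge0.
- by move=> t; exact: Rneg.
move=> m u mu; have u0 := le_trans (T_of_ge0 E_gt0 m w) mu.
have := con u u0; rewrite sube_ge0 ?orbT// => h.
have := le_trans (le_Ldiv (fun t => r0 t w) mu) h; rewrite lee_fin; lra.
Qed.

End expected_duality.

Lemma stieltjes_exp_ge0 {R : realType} (q : R) F : (0 <= stieltjes_exp q F)%E.
Proof.
rewrite /stieltjes_exp; case: pselect => // H.
by apply: integral_ge0 => t _; rewrite lee_fin expR_ge0.
Qed.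

(** * The payoff of the barrier strategy as a limit of truncations *)

Section barrier_payoff.
Context {R : realType} {d : measure_display} {Omega : measurableType d}.
Variables (P : probability Omega R) (X : R -> Omega -> R) (E : nat -> Omega -> R).
Hypothesis levyX : levy_process P X.
Hypothesis mE : forall k, measurable_fun setT (E k).
Hypothesis E_gt0 : forall k w, 0 < E k w.
Hypothesis E_law : forall k (B : set R), measurable B ->
  P (E k @^-1` B) = P (E 0%N @^-1` B).
Hypothesis E_indep : forall n, mutually_indep P n E.
Hypothesis XE : indep_sigma P (gen_X X) (gen_N E).
Variables (q : R) (q0 : 0 < q) (a x : R) (a0 : 0 <= a) (x0 : 0 <= x).

Let cX w : cadlag (X ^~ w). Proof. by case: levyX. Qed.

Lemma pcb_inj_sR w n t : good_path X E w -> t < T_of E n.+1 w ->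
  pcb_inj a x (X ^~ w) (T_of E ^~ w) t = sR X E a x n t w.
Proof.
move=> [unb nj] tn; have ltT k : T_of E k w < T_of E k.+1 w by exact: T_of_lt.
have [t0|t0] := ltP t 0.
  rewrite sR_neg//; apply: pcb_inj_neg => //; first exact: T_of0.
have [m [mt tm]] := T_of_bracket unb t0.
rewrite (pcb_injE (cX w) a0 x0 (levy0 levyX w) (T_of0 E w) ltT nj mt tm).
have mn : (m <= n)%N.
  by rewrite -ltnS; apply: (ltT_lt (T := T_of E ^~ w)) => //; exact: le_lt_trans tn.
by rewrite /sR (skR_before _ _ _ ltT mn).
Qed.

Lemma pcb_inj_homo w : good_path X E w -> {homo pcb_inj a x (X ^~ w) (T_of E ^~ w) : s t / s <= t}.
Proof.
move=> gw s t st; have [n tn] := gw.1 t.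
have {}tn : t < T_of E n.+1 w by apply: (lt_trans tn); exact: T_of_lt.
rewrite (pcb_inj_sR gw tn) (pcb_inj_sR gw (le_lt_trans st tn)).
exact: (sR_homo E levyX).
Qed.

Lemma pcb_inj_rc w : good_path X E w -> right_continuous (pcb_inj a x (X ^~ w) (T_of E ^~ w)).
Proof.
move=> gw t; have [n tn] := gw.1 t.
have {}tn : t < T_of E n.+1 w by apply: (lt_trans tn); exact: T_of_lt.
apply/at_right_epsP => e e0.
have /at_right_epsP/(_ e e0)[r r0 hr] := @sR_rc _ _ _ P X E levyX a x n w t.
exists (Num.min r (T_of E n.+1 w - t)); first by rewrite lt_min r0 subr_gt0.
move=> s ts; rewrite -ltrBlDl lt_min => /andP[h1 h2].
rewrite !(@pcb_inj_sR w n)//; last by rewrite -subr_gt0; lra.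
by apply: hr => //; rewrite -ltrBlDl.
Qed.

Lemma sR_nd s w : {homo (fun n => sR X E a x n s w) : n m / (n <= m)%N >-> n <= m}.
Proof. by move=> n m nm; apply: (@skR_homo _ a x (X ^~ w) (T_of E ^~ w) (cX w)). Qed.

Lemma stieltjes_pcb_inj w : good_path X E w ->
  stieltjes_exp q (pcb_inj a x (X ^~ w) (T_of E ^~ w)) =
  limn (fun n => stieltjes_exp q (sR X E a x n ^~ w)).
Proof.
move=> gw; rewrite (stieltjes_expE q0 (pcb_inj_homo gw) (pcb_inj_rc gw)); last first.
  by move=> t t0; apply: pcb_inj_neg => //; [exact: T_of0|move=> k; exact: T_of_lt].
rewrite (_ : (fun n => _) = fun n => \int[expo q0]_s (sR X E a x n s w)%:E)%E; last first.
  apply/funext => n; rewrite (stieltjes_expE q0 (@sR_homo _ _ _ P X E levyX a x n w) (@sR_rc _ _ _ P X E levyX a x n w))//.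
  by move=> t; exact: sR_neg.
rewrite -monotone_convergence//.
- apply: eq_integral => s _; apply/esym/cvg_lim => //.
  have [n tn] := gw.1 s; apply: cvg_near_cst; exists n => // m /= nm.
  rewrite (@pcb_inj_sR w m)//; apply: (lt_le_trans tn).
  by apply: (T_of_le E_gt0); exact: leqW.
- move=> n; apply/measurable_EFinP; apply: nondecreasing_measurable => // s t.
  exact: (@sR_homo _ _ _ P X E levyX a x n w).
- by move=> n s _; rewrite lee_fin; exact: (sR_ge0 E levyX).
- by move=> s _ n m nm; rewrite lee_fin; exact: sR_nd.
Qed.

(** A monotone limit over the number of payments; by monotone convergence it is the expected
    discounted injection of the full barrier strategy, see [barrier_valueE]. *)
Definition barrier_injections : \bar R := limn (fun n => injections P q (sR X E a x n)).

Lemma stieltjes_sR_nd w : {homo (fun n => stieltjes_exp q (sR X E a x n ^~ w)) : n m / (n <= m)%N >-> (n <= m)%E}.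
Proof.
move=> n m nm.
have sE k : stieltjes_exp q (sR X E a x k ^~ w) = (\int[expo q0]_s (sR X E a x k s w)%:E)%E.
  rewrite (stieltjes_expE q0 (@sR_homo _ _ _ P X E levyX a x k w) (@sR_rc _ _ _ P X E levyX a x k w))//.
  by move=> t; exact: sR_neg.
have ms k : measurable_fun setT (fun s => (sR X E a x k s w)%:E).
  apply/measurable_EFinP; apply: nondecreasing_measurable => // s t.
  exact: (@sR_homo _ _ _ P X E levyX a x k w).
rewrite !sE; apply: ge0_le_integral => //.
- by move=> s _; rewrite lee_fin; exact: (sR_ge0 E levyX).
- by move=> s _; rewrite lee_fin; exact: sR_nd.
Qed.

Let msR n : measurable_fun setT (fun w => stieltjes_exp q (sR X E a x n ^~ w)).
Proof.
have [msR hsR rsR nsR] := sR_properties levyX mE E_gt0 a x n.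
by have [] := measurable_stieltjes q0 msR hsR rsR nsR.
Qed.

Lemma injections_nd : {homo (fun n => injections P q (sR X E a x n)) : n m / (n <= m)%N >-> (n <= m)%E}.
Proof.
move=> n m nm; apply: ge0_le_integral => //; first by move=> w _; exact: stieltjes_exp_ge0.
by move=> w _; exact: stieltjes_sR_nd.
Qed.

Let barrier_injectionsE : barrier_injections = ereal_sup (range (fun n => injections P q (sR X E a x n))).
Proof. by apply/cvg_lim => //; exact/ereal_nondecreasing_cvgn/injections_nd. Qed.

Lemma injections_le_barrier n : (injections P q (sR X E a x n) <= barrier_injections)%E.
Proof.
rewrite barrier_injectionsE; apply: ereal_sup_ubound; by exists n.
Qed.

Lemma barrier_injections_le M : (forall n, injections P q (sR X E a x n) <= M)%E ->
  (barrier_injections <= M)%E.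
Proof.
by move=> h; rewrite barrier_injectionsE; apply: ge_ereal_sup => _ [n _ <-].
Qed.

Lemma barrier_injections_ge0 : (0 <= barrier_injections)%E.
Proof.
apply: le_trans (injections_le_barrier 0).
by apply: integral_ge0 => w _; exact: stieltjes_exp_ge0.
Qed.

Lemma payments_ge0 (rhos : nat -> R -> Omega -> R) :
  (forall k t w, 0 <= t -> 0 <= rhos k t w) -> (0 <= payments P E q rhos)%E.
Proof.
move=> r0; apply: nneseries_ge0 => k _ _; apply: integral_ge0 => w _.
by rewrite lee_fin mulr_ge0 ?expR_ge0// r0// T_of_ge0.
Qed.

Lemma integral_payments (rhos : nat -> R -> Omega -> R) : (forall k, adapted X E (rhos k)) ->
  (forall k w, caglad (rhos k ^~ w)) -> (forall k t w, 0 <= t -> 0 <= rhos k t w) ->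
  (\int[P]_w \sum_(0 <= k <oo) (expR (- q * T_of E k.+1 w) * rhos k (T_of E k.+1 w) w)%:E =
   payments P E q rhos)%E.
Proof.
move=> ar cr r0; rewrite integral_nneseries//.
  by move=> k; apply/measurable_EFinP; exact: (measurable_disc_div levyX mE E_gt0 q (ar k) (cr k)).
by move=> k w _; rewrite lee_fin mulr_ge0 ?expR_ge0// r0// T_of_ge0.
Qed.

Lemma barrier_valueE beta : barrier_value P q beta X E a x =
  (payments P E q (rho_barrier X E a x) - beta%:E * barrier_injections)%E.
Proof.
have [N [mN N0 hN]] := ae_good_path levyX mE E_gt0 E_law E_indep XE.
rewrite /barrier_value /payoff; congr (_ - _ * _)%E.
  rewrite -integral_payments; last 3 first.
  - by move=> k; exact: (adapted_rho_trunc levyX).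
  - by move=> k w; exact: (caglad_rho_trunc levyX).
  - by move=> k t w _; exact: rho_trunc_ge0.
  apply: (ge0_integral_off mN N0) => w.
  - by apply: nneseries_ge0 => k _ _; rewrite lee_fin mulr_ge0 ?expR_ge0// /pcb_div le_max lexx.
  - by apply: nneseries_ge0 => k _ _; rewrite lee_fin mulr_ge0 ?expR_ge0//; exact: rho_trunc_ge0.
  move=> /hN[unb nj]; apply: eq_eseriesr => k _; congr (_ * _)%:E.
  rewrite /rho_barrier (rho_trunc_T X E_gt0) ltnSn.
  by apply: pcb_divE => //; [exact: levy0 levyX w|exact: T_of0|move=> j; exact: T_of_lt].
rewrite (ge0_integral_off mN N0 (g := fun w => limn (fun n => stieltjes_exp q (sR X E a x n ^~ w)))).
- rewrite monotone_convergence//; first by move=> n w _; exact: stieltjes_exp_ge0.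
  by move=> w _; exact: stieltjes_sR_nd.
- by move=> w; exact: stieltjes_exp_ge0.
- move=> w; apply: lime_ge; first exact/ereal_nondecreasing_is_cvgn/stieltjes_sR_nd.
  by apply: nearW => n; exact: stieltjes_exp_ge0.
- by move=> w /hN gw; exact: stieltjes_pcb_inj.
Qed.

Lemma barrier_duality b (rho Rp : R -> Omega -> R) : b <= a -> admissible P q X E x rho Rp ->
  ((fall_lt P X E q b)%:E * payments P E q (fun=> rho) + barrier_injections <=
   injections P q Rp + (fall_lt P X E q b)%:E * payments P E q (rho_barrier X E a x) + (a - b)%:E)%E.
Proof.
move=> ba adm; have D N := expected_duality levyX mE E_gt0 E_law E_indep XE q0 a0 x0 N ba adm.
move: D; set M := (X in forall N, (_ <= X)%E); set cA := (_ * _)%E => D.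
have cA0 : (0 <= cA)%E.
  apply: mule_ge0; first by rewrite lee_fin; exact: fall_lt_ge0.
  by apply: payments_ge0 => _ t w; case: adm => -[_ [_ +]] _ _ _ _; exact.
(* When the right side is infinite there is nothing to show; otherwise the weighted dividends are
   finite and can be subtracted, which leaves a bound uniform in the number of payments. *)
have [->|Mfin] := eqVneq M +oo%E; first by rewrite leey.
have cAfin : cA \is a fin_num.
  rewrite ge0_fin_numE//; apply: (@le_lt_trans _ _ M); last by rewrite ltey.
  apply: le_trans (D 0%N); rewrite leeDl//.
  by apply: integral_ge0 => w _; exact: stieltjes_exp_ge0.
rewrite addeC -leeBrDr//; apply: barrier_injections_le => n.
by rewrite leeBrDr// addeC; exact: D.
Qed.

End barrier_payoff.

(** * Finiteness of the injections *)

Section counting.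
Context {R : realType}.

(** A magnitude [z] is traded for the number of integers [m] with [m - 1 < z], which bounds it from
    above and exceeds it by at most 2. The events [B m] then have the form of falls below a level,
    for which discounting is known. *)
Definition count_series (B : nat -> Prop) : \bar R :=
  (\sum_(0 <= m <oo) (if `[< B m >] then 1 else 0)%:E)%E.

Let ind_ge0 (B : nat -> Prop) m : (0 <= (if `[< B m >] then 1 else 0 : R)%:E)%E.
Proof. by case: ifP. Qed.

Lemma count_series_ge0 B : (0 <= count_series B)%E.
Proof. by apply: nneseries_ge0 => m _ _; exact: ind_ge0. Qed.

Lemma le_count_series B (z : R) : (forall m, m%:R - 1 < z -> B m) -> (z%:E <= count_series B)%E.
Proof.
move=> zB; have [z0|z0] := leP z 0; first by rewrite (le_trans _ (count_series_ge0 B))// lee_fin.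
have z1 : 0 <= z + 1 by lra.
have /andP[n1 n2] := truncn_itv z1; set n := Num.truncn _ in n1 n2.
have := @nneseries_lim_ge R (fun m => (if `[< B m >] then 1 else 0)%:E) xpredT 0 n (fun m _ _ => ind_ge0 B m).
apply: le_trans; rewrite (eq_big_nat _ _ (F2 := fun=> 1%:E)); last first.
  move=> m /andP[_ mn]; rewrite asboolT//; apply: zB.
  have : m.+1%:R <= n%:R :> R by rewrite ler_nat.
  by rewrite -natr1; lra.
by rewrite big_mkord sumEFin sumr_const card_ord lee_fin; move: n2; rewrite -natr1; lra.
Qed.

Lemma count_series_le B (z : R) : 0 <= z -> (forall m, B m -> m%:R - 1 < z) ->
  (count_series B <= (z + 2)%:E)%E.
Proof.
move=> z0 Bz; have z1 : 0 <= z + 1 by lra.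
have /andP[n1 n2] := truncn_itv z1; set n := Num.truncn _ in n1 n2.
rewrite /count_series (@nneseries_trunc _ (fun m => if `[< B m >] then 1 else 0) n.+1).
- rewrite lee_fin (@le_trans _ _ (\sum_(m < n.+1) 1))//.
    by apply: ler_sum => m _; case: ifP.
  by rewrite sumr_const card_ord -natr1; lra.
- by move=> m; case: ifP.
move=> m nm; rewrite asboolF// => /Bz.
have : n.+1%:R <= m%:R :> R by rewrite ler_nat.
lra.
Qed.

End counting.

Section injection_bound.
Context {R : realType}.
Variables (a x : R) (f : R -> R) (T : nat -> R).
Hypotheses (cf : cadlag f) (a0 : 0 <= a) (x0 : 0 <= x) (f0 : f 0 = 0) (T0 : T 0%N = 0).
Hypothesis ltT : forall k, T k < T k.+1.
Hypothesis nojump : forall k, left_lim f (T k.+1) = f (T k.+1).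

(** The payment at [T k.+1] causes no injection at that date, so the extra injection it brings by
    time [s] is at most the fall of the path after that date. *)
Lemma skR_step k (s c : R) : T k.+1 <= s -> 0 <= c ->
  (forall u, T k.+1 <= u -> u <= s -> f (T k.+1) - f u <= c) ->
  skR x f (skL a x f T k.+1) s <= skR x f (skL a x f T k) s + c.
Proof.
move=> Ts c0 hc; have Tp : 0 < T k.+1 by exact: le_lt_trans (T_ge0 T0 ltT k) (ltT k).
have cY n := cadlag_skY a x T cf n.
have RT : Rk a x f T k.+1 <= skR x f (skL a x f T k) (T k.+1).
  have [-> _] := @RUS _ a x f T cf a0 T0 ltT nojump k.
  rewrite -(@left_skR _ a x f T cf T0 ltT).
  have := cadlag_left_lim (cadlag_skR a x T cf k) Tp => /at_left_epsP h.
  apply/ler_addgt0Pr => e e0; have [r r0 hr] := h e e0.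
  have h1 : T k.+1 - r < T k.+1 - r / 2 by lra.
  have h2 : T k.+1 - r / 2 < T k.+1 by lra.
  have : skR x f (skL a x f T k) (T k.+1 - r / 2) <= skR x f (skL a x f T k) (T k.+1).
    by apply: (rsup_homo (cY k)); lra.
  by move=> h3; have := hr _ h1 h2; rewrite ltr_distl => /andP[h4 h5]; lra.
have YT : skY x f (skL a x f T k.+1) (T k.+1) <= Rk a x f T k.+1.
  by apply: le_rsup => //; exact: ltW.
have Rs : skR x f (skL a x f T k) (T k.+1) <= skR x f (skL a x f T k) s by exact: (rsup_homo (cY k)).
apply: rsup_le; first by rewrite addr_ge0// rsup_ge0.
move=> v v0 vs; have [vT|Tv] := ltP v (T k.+1).
  rewrite /skY (skL_before a x f ltT (leqnSn k) vT).
  apply: (@le_trans _ _ (skR x f (skL a x f T k) s)); last by rewrite lerDl.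
  exact: (le_rsup (cY k)).
have := hc v Tv vs; move: YT; rewrite /skY !skL_after//; lra.
Qed.

Lemma skR0_le (s c : R) : 0 <= c -> (forall u, 0 <= u -> u <= s -> - f u <= c) ->
  skR x f (skL a x f T 0) s <= c.
Proof.
move=> c0 hc; apply: rsup_le => // u u0 us; have := hc u u0 us.
by apply: le_trans; rewrite /skY /= -[leRHS]add0r lerD2r sub0r oppr_le0.
Qed.

(* [drops k s] counts, up to an additive constant, the depth of the fall of
   the path below its value at [T k] on the interval [T k, s]. *)
Definition drops (k : nat) (s : R) : \bar R :=
  count_series (fun m => upset (hitting (pred1 0%N) (m%:R - 1) f T k) s).

Let dropsP k s m : upset (hitting (pred1 0%N) (m%:R - 1) f T k) s <->
  exists2 u, T k <= u <= s & m%:R - 1 < f (T k) - f u.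
Proof.
split=> [[u [j [kj /eqP jk h1 h2]] us]|[u /andP[h1 us] h2]].
  have jE : j = k by apply/eqP; rewrite eqn_leq kj andbT -subn_eq0 jk.
  by exists u; [rewrite -jE h1|rewrite -jE; lra].
by exists u => //; exists k; split => //; rewrite ?subnn//; lra.
Qed.

(** Each payment adds at most the fall after its date; if the level [m - 1] below the added
    injection were not reached, [skR_step] would be violated. *)
Lemma skR_le_drops n s : ((skR x f (skL a x f T n) s)%:E <= \sum_(j < n.+1) drops j s)%E.
Proof.
elim: n => [|n ih].
  rewrite big_ord1; have [s0|s0] := ltP s 0.
    by rewrite /skR rsup_neg//; exact: count_series_ge0.
  apply: le_count_series => m hm; apply/dropsP; apply: contrapT => h.
  have hc u : 0 <= u -> u <= s -> - f u <= m%:R - 1.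
    move=> u0 us; rewrite leNgt; apply/negP => h'; apply: h; exists u; rewrite T0 ?u0// f0; lra.
  have c0 : 0 <= m%:R - 1 :> R by have := hc 0 (lexx 0) s0; rewrite f0; lra.
  by have := skR0_le c0 hc; rewrite leNgt hm.
rewrite big_ord_recr/=; have [sT|Ts] := ltP s (T n.+1).
  rewrite (skR_before a x f ltT (leqnSn n) sT) (le_trans ih)// leeDl//.
  exact: count_series_ge0.
apply: (@le_trans _ _ ((skR x f (skL a x f T n) s)%:E + drops n.+1 s)%E); last exact: leeD2r.
rewrite -leeBlDl// -EFinB; apply: le_count_series => m hm; apply/dropsP; apply: contrapT => h.
have hc u : T n.+1 <= u -> u <= s -> f (T n.+1) - f u <= m%:R - 1.
  by move=> u0 us; rewrite leNgt; apply/negP => h'; apply: h; exists u; rewrite ?u0.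
have c0 : 0 <= m%:R - 1 :> R by have := hc _ (lexx _) Ts; rewrite subrr.
have := skR_step Ts c0 hc; lra.
Qed.

(** Conversely, the fall from time 0 is at most the initial capital [x] plus what must be injected
    when no dividend is paid; the 2 is the rounding of [count_series]. *)
Lemma drops0_le s : (drops 0 s <= (skR x f (skL a x f T 0) s + (x + 2))%:E)%E.
Proof.
have cY := cadlag_skY a x T cf 0.
rewrite addrA; apply: count_series_le; first by rewrite addr_ge0// rsup_ge0.
move=> m /dropsP[u]; rewrite T0 f0 => /andP[u0 us] h.
have := le_rsup cY u0 us; rewrite -/(skR x f (skL a x f T 0) s) /skY /=; lra.
Qed.

End injection_bound.

Section finite_injections.
Context {R : realType} {d : measure_display} {Omega : measurableType d}.
Variables (P : probability Omega R) (X : R -> Omega -> R) (E : nat -> Omega -> R).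
Hypothesis levyX : levy_process P X.
Hypothesis mE : forall k, measurable_fun setT (E k).
Hypothesis E_gt0 : forall k w, 0 < E k w.
Hypothesis E_law : forall k (B : set R), measurable B ->
  P (E k @^-1` B) = P (E 0%N @^-1` B).
Hypothesis E_indep : forall n, mutually_indep P n E.
Hypothesis XE : indep_sigma P (gen_X X) (gen_N E).
Variables (q : R) (q0 : 0 < q) (a x : R) (a0 : 0 <= a) (x0 : 0 <= x).

Let cX w : cadlag (X ^~ w). Proof. by case: levyX. Qed.
Let ltT w k : T_of E k w < T_of E k.+1 w. Proof. exact: T_of_lt. Qed.
Let dr k s w := drops (X ^~ w) (T_of E ^~ w) k s.

(** Discounted depth of the fall below the initial value, summed over unit levels. *)
Definition drop_disc (g : pathT R (R + nat)) : \bar R :=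
  (\sum_(0 <= m <oo) Psi (pred1 0%N) q (m%:R - 1) g)%E.

Let drop_disc_ge0 g : (0 <= drop_disc g)%E.
Proof. by apply: nneseries_ge0 => m _ _; exact: Psi_ge0. Qed.

Let measurable_drop_disc : measurable_fun setT drop_disc.
Proof. by apply: measurable_nneseries => [k g|k]; [exact: Psi_ge0|exact: measurable_Psi]. Qed.

Let measurable_ind (S : set R) : measurable S ->
  measurable_fun setT (fun s => (if `[< S s >] then 1 else 0)%:E : \bar R).
Proof.
move=> mS; apply/measurable_EFinP; apply: measurable_fun_ifT => //.
apply: (@measurable_fun_bool _ _ setT _ true) => //; rewrite setTI.
by rewrite (_ : _ @^-1` _ = S)//; apply/seteqP; split => s /=; move/asboolP.
Qed.

Let measurable_dr k w : measurable_fun setT (fun s => dr k s w).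
Proof.
apply: measurable_nneseries => [m s|m]; first by case: ifP.
apply: measurable_ind; exact: measurable_upset.
Qed.

Let integral_dr k w : (\int[expo q0]_s dr k s w =
  (expR (- q * T_of E k w))%:E * drop_disc (post X E k w))%E.
Proof.
rewrite integral_nneseries//.
- rewrite /drop_disc -nneseriesZl; last by move=> m _; exact: Psi_ge0.
  apply: eq_eseriesr => m _; rewrite -(expo_hitting levyX E_gt0 q0).
  set S := upset _; have mS : measurable S by exact: measurable_upset.
  rewrite -[X in expo q0 X]setIT -(integral_indic (expo q0) measurableT mS).
  apply: eq_integral => s _; rewrite indicE; congr (_%:E).
  by case: asboolP => h; [rewrite mem_set|rewrite memNset].
- by move=> m; apply: measurable_ind; exact: measurable_upset.
- by move=> m s _; case: ifP.
Qed.

Let stjE n w : stieltjes_exp q (sR X E a x n ^~ w) = (\int[expo q0]_s (sR X E a x n s w)%:E)%E.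
Proof.
rewrite (stieltjes_expE q0 (@sR_homo _ _ _ P X E levyX a x n w) (@sR_rc _ _ _ P X E levyX a x n w))//.
by move=> t; exact: sR_neg.
Qed.

Let measurable_sR n w : measurable_fun setT (fun s => (sR X E a x n s w)%:E).
Proof.
apply/measurable_EFinP; apply: nondecreasing_measurable => // s t.
exact: (@sR_homo _ _ _ P X E levyX a x n w).
Qed.

Let measurable_disc_drop k : measurable_fun setT
  (fun w => (expR (- q * T_of E k w))%:E * drop_disc (post X E k w))%E.
Proof.
apply: emeasurable_funM; last first.
  by apply: (measurableT_comp measurable_drop_disc); exact: (measurable_post levyX mE E_gt0 k).
apply/measurable_EFinP; apply: measurableT_comp => //; apply: measurable_funM => //.
exact: measurable_T_of.
Qed.

Lemma stieltjes_sR_le n w : good_path X E w -> (stieltjes_exp q (sR X E a x n ^~ w) <=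
  \sum_(j < n.+1) (expR (- q * T_of E j w))%:E * drop_disc (post X E j w))%E.
Proof.
move=> [_ nj]; rewrite stjE.
have dr0 j s : (0 <= dr j s w)%E by exact: count_series_ge0.
under eq_bigr do rewrite -integral_dr.
rewrite -ge0_integral_sum//.
apply: ge0_le_integral => //.
- by move=> s _; rewrite lee_fin; exact: (sR_ge0 E levyX).
- by apply: emeasurable_sum => j; exact: measurable_dr.
by move=> s _; apply: skR_le_drops => //; [exact: levy0 levyX w|exact: T_of0].
Qed.

Let v := (\int[P]_w drop_disc (post X E 0 w))%E.

Let integral_disc_drop j : (\int[P]_w ((expR (- q * T_of E j w))%:E * drop_disc (post X E j w)) =
  (fine (disc_ratio P E q) ^+ j)%:E * v)%E.
Proof.
case: j => [|j].
  rewrite expr0 mul1e; apply: eq_integral => w _.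
  by rewrite T_of0 mulr0 expR0 mul1e.
have c1 (t : R) (w : Omega) : 0 <= t -> (0 : R) <= 1 by [].
have := markov_integral levyX mE E_gt0 E_law E_indep XE q j (@adapted_cst _ _ _ X E 1)
  (fun w => caglad_cst 1) c1 measurable_drop_disc drop_disc_ge0.
rewrite /disc_div; under eq_integral do rewrite mulr1.
under [in X in _ = (X * _)%E]eq_integral do rewrite mulr1.
by rewrite (integral_disc levyX mE E_gt0 E_law E_indep XE q0).
Qed.

Let v_le : (v <= injections P q (sR X E a x 0) + (x + 2)%:E)%E.
Proof.
have [msR hsR rsR nsR] := sR_properties levyX mE E_gt0 a x 0.
have [mS S0] := measurable_stieltjes q0 msR hsR rsR nsR.
have x2 : (0 <= (x + 2)%:E :> \bar R)%E by rewrite lee_fin addr_ge0.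
have -> : (injections P q (sR X E a x 0) + (x + 2)%:E =
  \int[P]_w (stieltjes_exp q (sR X E a x 0 ^~ w) + (x + 2)%:E))%E.
  rewrite ge0_integralD//; congr (_ + _)%E.
  rewrite integral_cst// -[LHS]mule1; congr (_ * _)%E; exact/esym/probability_setT.
apply: ge0_le_integral; first exact: measurableT.
- by move=> w _; exact: drop_disc_ge0.
- by apply: (measurableT_comp measurable_drop_disc); exact: (measurable_post levyX mE E_gt0 0).
- by apply: emeasurable_funD; [exact: mS|exact: measurable_cst].
move=> w _; have := integral_dr 0 w; rewrite T_of0 mulr0 expR0 mul1e => <-.
have -> : (stieltjes_exp q (sR X E a x 0 ^~ w) + (x + 2)%:E =
    \int[expo q0]_s ((sR X E a x 0 s w)%:E + (x + 2)%:E))%E.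
  rewrite ge0_integralD//; last by move=> s _; rewrite lee_fin; exact: (sR_ge0 E levyX).
  rewrite stjE; congr (_ + _)%E.
  rewrite integral_cst// -[LHS]mule1; congr (_ * _)%E; exact/esym/(probability_setT (expo q0)).
apply: ge0_le_integral; first exact: measurableT.
- by move=> s _; exact: count_series_ge0.
- exact: measurable_dr.
- by apply: emeasurable_funD; [exact: measurable_sR|exact: measurable_cst].
move=> s _; rewrite -EFinD.
exact: (@drops0_le R a x (X ^~ w) (T_of E ^~ w) (cX w) x0 (levy0 levyX w) (T_of0 E w)).
Qed.

(** An admissible strategy makes the injections without dividends integrable, hence the expected
    discounted fall [v] from time 0. By the Markov property the falls after successive dates
    contribute a geometric series in [v], which dominates the barrier injections. *)
Lemma barrier_injections_fin rho Rp : admissible P q X E x rho Rp ->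
  (barrier_injections P X E q a x < +oo)%E.
Proof.
move=> [[ar [cr r0]] aR [ndR [rcR Rneg]] Rfin [N2 [mN2 N20 hN2]]].
have [N1 [mN1 N10 hN1]] := ae_good_path levyX mE E_gt0 E_law E_indep XE.
have mRp t : 0 <= t -> measurable_fun setT (Rp t) by exact: (adapted_measurable levyX mE aR).
have [mF F0] := measurable_stieltjes q0 mRp ndR rcR Rneg.
have mS n : measurable_fun setT (fun w => stieltjes_exp q (sR X E a x n ^~ w)).
  have [msR hsR rsR nsR] := sR_properties levyX mE E_gt0 a x n.
  by have [] := measurable_stieltjes q0 msR hsR rsR nsR.
(* With nonnegative dividends, an admissible injection dominates the running deficit of the strategy
   that pays none. *)
have i0 : (injections P q (sR X E a x 0) < +oo)%E.
  apply: le_lt_trans Rfin; apply: ae_ge0_le_integral => //.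
    by move=> w _; exact: stieltjes_exp_ge0.
  exists N2; split => // w; apply: contraPP => nN2 /=; apply; move=> _.
  have con : forall t, 0 <= t -> (0 <= (x + X t w + Rp t w)%:E - Ldiv E rho t w)%E.
    by apply: contrapT => h; apply: nN2; exact: hN2.
  have Rp0 s : 0 <= Rp s w.
    have [s0|s0] := leP 0 s; last by rewrite Rneg.
    by apply: (@le_trans _ _ (Rp (-1) w)); [rewrite Rneg ?oppr_lt0|apply: ndR; lra].
  rewrite stjE (stieltjes_expE q0 (ndR w) (rcR w)); last by move=> t; exact: Rneg.
  apply: ge0_le_integral => //.
  - by move=> s _; rewrite lee_fin; exact: (sR_ge0 E levyX).
  - by apply/measurable_EFinP; apply: nondecreasing_measurable => // s t; exact: ndR.
  move=> s _; rewrite lee_fin; apply: rsup_le => // u u0 us.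
  have := con u u0; rewrite sube_ge0 ?orbT// => h.
  have L0 := @le_Ldiv _ _ _ _ E_gt0 rho 0 u w (fun t => r0 t w).
  move: L0; rewrite T_of0 => /(_ u0); rewrite big_ord0 => L0.
  have := le_trans L0 h; rewrite lee_fin /skY /= => h'.
  apply: (@le_trans _ _ (Rp u w)); [lra|exact: ndR].
have vfin : (v < +oo)%E by apply: le_lt_trans v_le _; rewrite lte_add_pinfty// ltry.
have v0 : (0 <= v)%E by apply: integral_ge0.
have vE : v = (fine v)%:E by rewrite fineK// ge0_fin_numE.
pose th := fine (disc_ratio P E q).
have th1 : th < 1 by rewrite -lte_fin -disc_ratioE// disc_ratio_lt1.
have th0 : 0 <= th by apply: fine_ge0; exact: disc_ratio_ge0.
suff : (barrier_injections P X E q a x <= (fine v / (1 - th))%:E)%E.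
  by move=> h; apply: le_lt_trans h _; rewrite ltry.
apply: barrier_injections_le => // n.
apply: (@le_trans _ _ (\int[P]_w \sum_(j < n.+1) (expR (- q * T_of E j w))%:E * drop_disc (post X E j w))%E).
  apply: ae_ge0_le_integral => //.
  - by move=> w _; exact: stieltjes_exp_ge0.
  - by move=> w _; apply: sume_ge0 => j _; rewrite mule_ge0.
  - by apply: emeasurable_sum.
  exists N1; split => // w; apply: contraPP => nN1 /=; apply; move=> _.
  by apply: stieltjes_sR_le; exact: hN1.
rewrite ge0_integral_sum//; last by move=> j w _; rewrite mule_ge0.
under eq_bigr do rewrite integral_disc_drop vE -EFinM.
rewrite sumEFin lee_fin -mulr_suml mulrC ler_wpM2l ?fine_ge0//.
have d0 : 0 < 1 - th by rewrite subr_gt0.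
rewrite -(ler_pM2r d0) mulVf ?gt_eqF// mulrC -opprB mulNr -subrX1 opprB lerBlDr lerDl.
exact: exprn_ge0.
Qed.

End finite_injections.

(** * Optimality of the barrier at the level a* *)

Section optimality.
Context {R : realType} {d : measure_display} {Omega : measurableType d}.
Variables (P : probability Omega R) (X : R -> Omega -> R) (E : nat -> Omega -> R).
Hypothesis levyX : levy_process P X.
Hypothesis mE : forall k, measurable_fun setT (E k).
Hypothesis E_gt0 : forall k w, 0 < E k w.
Hypothesis E_law : forall k (B : set R), measurable B ->
  P (E k @^-1` B) = P (E 0%N @^-1` B).
Hypothesis E_indep : forall n, mutually_indep P n E.
Hypothesis XE : indep_sigma P (gen_X X) (gen_N E).
Variables (q : R) (q0 : 0 < q).

Let cX w : cadlag (X ^~ w). Proof. by case: levyX. Qed.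

Section truncation.
Variables (a x : R) (a0 : 0 <= a) (x0 : 0 <= x).

Lemma Ldiv_trunc n t w : Ldiv E (rho_trunc X E a x n) t w = (sL X E a x n t w)%:E.
Proof.
rewrite /Ldiv eseries_mkcond.
pose u k := if T_of E k.+1 w <= t then (if (k < n)%N then skdiv a x (X ^~ w) (T_of E ^~ w) k else 0) else 0.
rewrite (@eq_eseriesr _ _ (fun k => (u k)%:E)); last first.
  by move=> k _; rewrite (rho_trunc_T X E_gt0) /u; case: ifP.
rewrite (@nneseries_trunc _ u n).
- rewrite /sL skLE; congr (_%:E); apply: eq_bigr => k _; rewrite /u.
  by rewrite ltn_ord.
- by move=> k; rewrite /u; case: ifP => // _; case: ifP => // _; exact: skdiv_ge0.
- by move=> k nk; rewrite /u ltnNge nk/=; case: ifP.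
Qed.

Lemma truncated_admissible n : (barrier_injections P X E q a x < +oo)%E ->
  admissible P q X E x (rho_trunc X E a x n) (sR X E a x n).
Proof.
move=> Bfin; have [_ hsR rsR nsR] := sR_properties levyX mE E_gt0 a x n.
split => //.
- split; first exact: (adapted_rho_trunc levyX).
  split; first by move=> w; exact: (caglad_rho_trunc levyX).
  by move=> t w _; exact: rho_trunc_ge0.
- by have [_ [aR _] _] := cad_adapted_sLRU levyX E_gt0 a x n.
- apply: le_lt_trans Bfin.
  exact: (injections_le_barrier levyX mE E_gt0 q0).
apply: aeW => w t t0; rewrite Ldiv_trunc -EFinB lee_fin.
have := skU_ge0 a x (T_of E ^~ w) (cX w) n t0; rewrite /skU /skY /sR /sL; lra.
Qed.

(** Stopping after [n] payments keeps the first [n] dividends of the barrier strategy and does not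
    increase its injections. *)
Lemma barrier_le_value beta : 0 <= beta -> (barrier_injections P X E q a x < +oo)%E ->
  (barrier_value P q beta X E a x <= value P q beta X E x)%E.
Proof.
move=> beta0 Bfin; rewrite (barrier_valueE levyX mE E_gt0 E_law E_indep XE q0 a0 x0).
have B0 := barrier_injections_ge0 levyX mE E_gt0 q0 a x.
have bBfin : (beta%:E * barrier_injections P X E q a x)%E \is a fin_num.
  by rewrite fin_numM// ge0_fin_numE.
rewrite leeBlDr// /payments; apply: lime_le.
  apply: is_cvg_nneseries => k _ _; apply: integral_ge0 => w _.
  by rewrite lee_fin mulr_ge0 ?expR_ge0//; exact: rho_trunc_ge0.
apply: nearW => n; rewrite -leeBlDr//.
have adm := truncated_admissible n Bfin.
apply: (@le_trans _ _ (payoff P q beta E (fun k w => rho_trunc X E a x n (T_of E k.+1 w) w) (sR X E a x n))).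
  rewrite /payoff; apply: leeB; last first.
    apply: lee_wpmul2l; first by rewrite lee_fin.
    exact: (injections_le_barrier levyX mE E_gt0 q0).
  rewrite (integral_payments levyX mE E_gt0 q (rhos := fun=> rho_trunc X E a x n)); last 3 first.
  - by move=> _; exact: (adapted_rho_trunc levyX).
  - by move=> _ w; exact: (caglad_rho_trunc levyX).
  - by move=> _ t w _; exact: rho_trunc_ge0.
  have h0 k : xpredT k -> (0 <= \int[P]_w (disc_div E q (rho_trunc X E a x n) k.+1 w)%:E)%E.
    move=> _; apply: integral_ge0 => w _.
    by rewrite lee_fin mulr_ge0 ?expR_ge0//; exact: rho_trunc_ge0.
  rewrite /payments; apply: le_trans (nneseries_lim_ge n (fun k _ => h0 k)).
  rewrite (eq_big_nat _ _ (F2 := fun k => \int[P]_w (disc_div E q (rho_trunc X E a x n) k.+1 w)%:E)%E)// => k /andP[_ kn].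
  by apply: eq_integral => w _; rewrite /disc_div /rho_barrier !(rho_trunc_T X E_gt0) ltnSn kn.
by apply: ereal_sup_ubound; exists (rho_trunc X E a x n), (sR X E a x n).
Qed.

End truncation.

Let H b w := upset (hitting xpredT b (X ^~ w) (T_of E ^~ w) 0).

Let PsiH b w : Psi xpredT q b (post X E 0 w) = expo q0 (H b w).
Proof. by rewrite /H (expo_hitting levyX E_gt0 q0) T_of0 mulr0 expR0 mul1e. Qed.

Let H_homo b b' w : b <= b' -> H b' w `<=` H b w.
Proof.
move=> bb s [u [j [h1 h2 h3 h4]] us]; exists u => //; exists j; split => //; lra.
Qed.

Let mH b w : measurable (H b w). Proof. exact: measurable_upset. Qed.

Lemma fall_lt_nincr b b' : b <= b' -> fall_lt P X E q b' <= fall_lt P X E q b.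
Proof.
move=> bb; rewrite -lee_fin -!(fall_ltE levyX mE E_gt0 q0).
apply: ge0_le_integral => //.
- by move=> w _; exact: Psi_ge0.
- exact: (measurable_Psi_post levyX mE E_gt0).
- exact: (measurable_Psi_post levyX mE E_gt0).
by move=> w _; rewrite !PsiH; apply: le_measure; rewrite ?inE//; exact: H_homo.
Qed.

(** For the case a* = 0, where the levels just below a* are negative: the path at time 0 already
    counts as a fall. *)
Lemma fall_lt_neg b : b < 0 -> fall_lt P X E q b = 1.
Proof.
move=> b0; apply/EFin_inj; rewrite -(fall_ltE levyX mE E_gt0 q0).
rewrite (eq_integral (cst 1%E)) ?integral_cst//=; first by rewrite probability_setT mule1.
move=> w _ /=; rewrite PsiH; apply/eqP; rewrite eq_le probability_le1//=.
have <- : expo q0 `[0, +oo[%classic = 1%E by rewrite expo_ge// mulr0 expR0.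
apply: le_measure; rewrite ?inE// => s; rewrite /= in_itv/= andbT => s0.
by exists 0 => //; exists 0%N; split => //; rewrite T_of0// subrr oppr_gt0.
Qed.

Let PsiE_fine b w : (fine (expo q0 (H b w)))%:E = Psi xpredT q b (post X E 0 w).
Proof. by rewrite PsiH fineK// fin_num_measure. Qed.

Let cvg_fall_lt (b : nat -> R) (g : Omega -> R) l : (\int[P]_w (g w)%:E = l%:E)%E ->
  (forall w, expo q0 (H (b n) w) @[n --> \oo] --> (g w)%:E) ->
  fall_lt P X E q (b n) @[n --> \oo] --> l.
Proof.
move=> gl hb; have h : (\int[P]_w (fine (expo q0 (H (b n) w)))%:E @[n --> \oo] --> l%:E)%E.
  rewrite -gl; apply: bounded_cvg_integral => [n|n w|w].
  - apply/measurable_EFinP; rewrite (_ : _ \o _ = fun w => Psi xpredT q (b n) (post X E 0 w)).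
      exact: (measurable_Psi_post levyX mE E_gt0).
    by apply/funext => w; exact: PsiE_fine.
  - apply/andP; split; first exact: fine_ge0.
    by rewrite -lee_fin PsiE_fine (Psi_post_le1 levyX E_gt0 q0).
  - by have [_] := (fine_cvgP _ _).1 (hb w).
have [_] := (fine_cvgP _ _).1 h; apply: cvg_trans; apply: near_eq_cvg; apply: nearW => n /=.
by rewrite /fall_lt; congr fine; apply: eq_integral => w _; rewrite PsiE_fine.
Qed.

(** A fall by strictly more than [b] is a fall by more than [b + 1/(n+1)] for some [n], so the
    hitting events increase to the one at [b]. *)
Lemma fall_lt_right b : fall_lt P X E q (b + n.+1%:R^-1) @[n --> \oo] --> fall_lt P X E q b.
Proof.
apply: (@cvg_fall_lt _ (fun w => fine (expo q0 (H b w)))).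
  rewrite -(fall_ltE levyX mE E_gt0 q0); apply: eq_integral => w _; exact: PsiE_fine.
move=> w; rewrite PsiE_fine PsiH.
have -> : H b w = \bigcup_n H (b + n.+1%:R^-1) w.
  apply/seteqP; split; last first.
    by move=> s [n _]; apply: H_homo; rewrite lerDl.
  move=> s [u [j [h1 h2 h3 h4]] us].
  have /ltr_add_invr[n hn] : b < - (X u w - X (T_of E j w) w) by lra.
  by exists n => //; exists u => //; exists j; split => //; rewrite ltrNr.
apply: nondecreasing_cvg_mu => //; first by apply: bigcup_measurable => n _; exact: mH.
by move=> n m nm; apply/subsetPset; apply: H_homo; rewrite lerD2l lef_pV2 ?posrE// ler_nat.
Qed.

(** On [[0, s]] a cadlag path is bounded by some [M] and cannot fall by more than [2 M]. This makes
    the set defining a* nonempty. *)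
Lemma fall_lt_infty : fall_lt P X E q n%:R @[n --> \oo] --> (0 : R).
Proof.
apply: (@cvg_fall_lt _ (fun=> 0)); first by rewrite integral0.
move=> w; rewrite (_ : 0%:E = expo q0 set0); last by rewrite measure0.
have -> : set0 = \bigcap_n H n%:R w.
  apply/seteqP; split => // s hs.
  have [M hM] := cadlag_bounded s (cX w).
  have [n _ nM] : exists2 n : nat, True & 2 * M <= n%:R.
    by exists (Num.truncn (2 * M)).+1 => //; rewrite ltW// truncnS_gt.
  have [u [j [_ _ ju hu]] us] := hs n I.
  have Tj := T_of_ge0 E_gt0 j w.
  have := hM u (le_trans Tj ju) us; have := hM _ Tj (le_trans ju us).
  rewrite !ler_norml => /andP[h1 h2] /andP[h3 h4]; lra.
apply: nonincreasing_cvg_mu => //.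
- by rewrite (le_lt_trans (probability_le1 _ _))// ltry.
- exact: bigcap_measurable.
by move=> n m nm; apply/subsetPset; apply: H_homo; rewrite ler_nat.
Qed.

(** Unrolling the minima, the process reflected at [b] and started at [b] is the minimum over past
    dates of [b] plus the increment since that date. Here [t] is a value of the path, not a time,
    and is free for the induction. *)
Lemma prefl_lt0P w k b t : good_path X E w ->
  prefl b b (X ^~ w) (T_of E ^~ w) k + t - X (T_of E k w) w < 0 <->
  exists2 j, (j <= k)%N & t - X (T_of E j w) w < - b.
Proof.
move=> [_ nj]; elim: k t => [|k ih] t.
  rewrite /= T_of0; split=> [h|[j]]; first by exists 0%N => //; rewrite T_of0; lra.
  by rewrite leqn0 => /eqP->; rewrite T_of0; lra.
rewrite /= nj; set m := prefl _ _ _ _ k in ih *.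
split=> [|[j]].
  have [h|h] := leP (m + X (T_of E k.+1 w) w - X (T_of E k w) w) b => h1.
    have [|j jk hj] := (ih t).1; first lra.
    by exists j => //; exact: leqW.
  by exists k.+1 => //; lra.
rewrite leq_eqVlt => /orP[/eqP->|jk] hj.
  by have : Num.min (m + X (T_of E k.+1 w) w - X (T_of E k w) w) b <= b; [rewrite ge_min lexx orbT|lra].
have := (ih t).2 (ex_intro2 _ _ j jk hj).
have : Num.min (m + X (T_of E k.+1 w) w - X (T_of E k w) w) b <= m + X (T_of E k.+1 w) w - X (T_of E k w) w.
  by rewrite ge_min lexx.
lra.
Qed.

(** On a good path every time lies in exactly one block, so the first negative time of the reflected
    process is the first fall by more than [b] from any earlier date. *)
Lemma ruin_ltE b : ruin_lt P q X E b b = fall_lt P X E q b.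
Proof.
have [N [mN N0 hN]] := ae_good_path levyX mE E_gt0 E_law E_indep XE.
rewrite /ruin_lt /fall_lt; congr fine; apply: (ge0_integral_off mN N0) => w.
- by case: kappa_refl => [t| |]//; rewrite lee_fin expR_ge0.
- exact: Psi_ge0.
move=> /hN gw; rewrite PsiH /H expo_upset; last first.
  by move=> u [j [_ _ ju _]]; exact: le_trans (T_of_ge0 E_gt0 j w) ju.
rewrite -/(disc q _) /kappa_refl; congr (disc q (ereal_inf [set _ | t in _])).
apply/seteqP; split => t /=.
  move=> [k [/andP[kt tk] /(prefl_lt0P _ _ _ gw)[j jk hj]]]; exists j; split => //.
  exact: le_trans (T_of_le E_gt0 w jk) kt.
move=> [j [_ _ jt hj]]; have t0 := le_trans (T_of_ge0 E_gt0 j w) jt.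
have [k [kt tk]] := T_of_bracket gw.1 t0; exists k; rewrite kt; split => //.
apply/(prefl_lt0P _ _ _ gw); exists j => //.
rewrite -ltnS; apply: (ltT_lt (T := T_of E ^~ w)); first by move=> i; exact: T_of_lt.
exact: le_lt_trans tk.
Qed.

End optimality.

(** * The critical level and the comparison of payoffs *)

Section barrier_level.
Context {R : realType} {d : measure_display} {Omega : measurableType d}.
Variables (P : probability Omega R) (X : R -> Omega -> R) (E : nat -> Omega -> R).
Hypothesis levyX : levy_process P X.
Hypothesis mE : forall k, measurable_fun setT (E k).
Hypothesis E_gt0 : forall k w, 0 < E k w.
Hypothesis E_law : forall k (B : set R), measurable B ->
  P (E k @^-1` B) = P (E 0%N @^-1` B).
Hypothesis E_indep : forall n, mutually_indep P n E.
Hypothesis XE : indep_sigma P (gen_X X) (gen_N E).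
Variables (q beta : R) (q0 : 0 < q) (beta1 : 1 < beta).

Let beta0 : 0 < beta. Proof. exact: lt_trans beta1. Qed.
Let a := astar P q beta X E.
Let S := [set b : R | 0 <= b /\ beta * ruin_lt P q X E b b <= 1].

Let SE b : S b <-> 0 <= b /\ fall_lt P X E q b <= beta^-1.
Proof.
rewrite /S /= (ruin_ltE levyX mE E_gt0 E_law E_indep XE q0).
by rewrite -ler_pdivlMl// mulr1.
Qed.

Let S_inf : has_inf S.
Proof.
split; last by exists 0 => b [].
have /cvgrPdist_lt/(_ (beta^-1))[|n _ hn] := fall_lt_infty levyX mE E_gt0 q0.
  by rewrite invr_gt0.
exists n%:R; apply/SE; split => //; have := hn n (leqnn n).
by rewrite /= sub0r normrN ger0_norm ?fall_lt_ge0// => /ltW.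
Qed.

Lemma astar_ge0 : 0 <= a.
Proof. by apply: lb_le_inf => [|b []//]; case: S_inf. Qed.

Lemma fall_lt_astar : fall_lt P X E q a <= beta^-1.
Proof.
have lc := @fall_lt_right _ _ _ P X E levyX mE E_gt0 q q0 a.
rewrite -(cvg_lim _ lc)//; apply: limr_le; first exact: cvgP lc.
apply: nearW => n.
have e0 : 0 < n.+1%:R^-1 :> R by rewrite invr_gt0.
have [b Sb ba] := inf_adherent e0 S_inf.
have [_] := (SE b).1 Sb; apply: le_trans.
by apply: (fall_lt_nincr levyX mE E_gt0 q0); exact: ltW.
Qed.

Lemma fall_lt_below_astar b : b < a -> beta^-1 <= fall_lt P X E q b.
Proof.
move=> ba; have [b0|b0] := ltP b 0.
  by rewrite (fall_lt_neg levyX mE E_gt0 q0 b0) invf_le1// ltW.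
rewrite leNgt; apply/negP => h; move: ba; rewrite ltNge => /negP; apply.
by apply: ge_inf; [case: S_inf|apply/SE; split => //; exact: ltW].
Qed.

Lemma payoff_le_barrier x rho Rp : 0 <= x -> admissible P q X E x rho Rp ->
  (payoff P q beta E (fun k w => rho (T_of E k.+1 w) w) Rp <= barrier_value P q beta X E a x)%E.
Proof.
move=> x0 adm; have a0 := astar_ge0.
rewrite (barrier_valueE levyX mE E_gt0 E_law E_indep XE q0 a0 x0).
have Bbfin := barrier_injections_fin levyX mE E_gt0 E_law E_indep XE q0 a0 x0 adm.
have Bb0 := barrier_injections_ge0 levyX mE E_gt0 q0 a x.
have D b ba := barrier_duality levyX mE E_gt0 E_law E_indep XE q0 a0 x0 (b := b) ba adm.
have [[ar [cr r0]] _ _ Bfin _] := adm.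
rewrite /payoff (integral_payments levyX mE E_gt0 q (rhos := fun=> rho))// -/(injections P q Rp).
have A0 := payments_ge0 P E_gt0 q (rhos := fun=> rho) (fun=> r0).
have Ab0 : (0 <= payments P E q (rho_barrier X E a x))%E.
  by apply: payments_ge0 => // k t w _; exact: rho_trunc_ge0.
have B0 : (0 <= injections P q Rp)%E by apply: integral_ge0 => w _; exact: stieltjes_exp_ge0.
move: D A0 Ab0 B0 Bb0 Bfin Bbfin; rewrite -/(injections P q Rp).
case: (injections P q Rp) => [B| |]//; case: (barrier_injections _ _ _ _ _ _) => [Bb| |]//.
case: (payments P E q (rho_barrier X E a x)) => [Ab| |]//; last first.
  by move=> *; rewrite -EFinM addye// leey.
move=> D A0 _ _ _ _ _.
(* A positive weight turns infinite dividends into a violation of the duality, whose right side is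
   finite here; so [A] is finite too. *)
have cpos b : b < a -> 0 < fall_lt P X E q b.
  by move=> ba; apply: lt_le_trans (fall_lt_below_astar ba); rewrite invr_gt0.
case: (payments P E q (fun=> rho)) A0 D => [A| |]// _ D; last first.
  have a1 : a - 1 < a by lra.
  by have := D (a - 1) (ltW a1); rewrite mulry gtr0_sg ?cpos// mul1e addye//.
rewrite -!EFinM -!EFinB lee_fin.
have {}D b : b <= a -> fall_lt P X E q b * (A - Ab) <= B - Bb + (a - b).
  by move=> /D; rewrite -!EFinM -!EFinD lee_fin mulrBr; lra.
suff h : beta^-1 * (A - Ab) <= B - Bb.
  have : A - Ab <= beta * (B - Bb) by rewrite -ler_pdivrMl.
  by rewrite mulrBr; lra.
(* More dividends than the barrier: a weight of at least [1/beta] is wanted, found at level [a - e]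
   with slack exactly [e]. *)
have [A1|A1] := leP 0 (A - Ab).
  apply/ler_addgt0Pr => e e0; have ae : a - e < a by lra.
  have := D _ (ltW ae); rewrite subKr.
  by apply: le_trans; apply: ler_wpM2r => //; exact: fall_lt_below_astar.
(* Fewer dividends than the barrier: multiplying by a negative number wants a weight of at most
   [1/beta], found at [a] itself without slack. *)
have := D a (lexx a); rewrite subrr addr0; apply: le_trans.
by rewrite ler_nM2r//; exact: fall_lt_astar.
Qed.

End barrier_level.

Unset Implicit Arguments. Set Strict Implicit. Set Printing Implicit Defensive.

Theorem mainTheorem10 (R : realType) (d : measure_display) (Omega : measurableType d)
    (P : probability Omega R) (X : R -> Omega -> R) (E : nat -> Omega -> R)
    (r q beta : R) :
  0 < r -> 0 < q -> 1 < beta ->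
  levy_process P X ->
  poisson_interarrivals P r E ->
  indep_sigma P (gen_X X) (gen_N E) ->
  (* (A1) *) P.-integrable setT (EFin \o X 1) ->
  (* (A2) *) ~ driftless_CP P X ->
  (* (A3) *) (~ bv_paths P X -> forall a, 0 < a -> good_density (ruin_lt P q X E a)) ->
  forall x, 0 <= x ->
    value P q beta X E x = barrier_value P q beta X E (astar P q beta X E) x.
Proof.
move=> _ q0 beta1 levyX [mE E_gt0 E_exp E_indep] XE _ _ _ x x0.
have E_law k (B : set R) : measurable B -> P (E k @^-1` B) = P (E 0%N @^-1` B).
  by move=> mB; rewrite !E_exp.
have a0 := astar_ge0 levyX mE E_gt0 E_law E_indep XE q0 beta1.
apply/eqP; rewrite eq_le; apply/andP; split.
  apply: ge_ereal_sup => _ [rho [Rp [adm ->]]].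
  exact: payoff_le_barrier.
have [Bfin|] := ltP (barrier_injections P X E q (astar P q beta X E) x) +oo%E.
  by apply: (barrier_le_value levyX mE E_gt0 E_law E_indep XE q0) => //; lra.
(* In the extended reals [+oo] plus [-oo] is [-oo], so infinite injections make the barrier value
   [-oo] even if its dividends are infinite as well. *)
rewrite leye_eq => /eqP Binf; rewrite (barrier_valueE levyX mE E_gt0 E_law E_indep XE q0 a0 x0) Binf.
by rewrite mulry gtr0_sg ?mul1e ?addeNy ?leNye//; lra.
Qed.
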